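(* Let $X$ be an $n$-dimensional smooth manifold equipped with a Riemannian metric $g$, let $f:X\to\mathbb{R}$ be a Morse function, let $V=\nabla f$, and let $p$ be a critical point of $f$. Let $\lambda_1,\dots,\lambda_n$ be the Morse eigenvalues of $p$, i.e. the eigenvalues (with multiplicity) of the endomorphism $g^{jk}\nabla_iV_j|_p\in T_pX\otimes T_p^*X$. Assume that $\lambda_1,\dots,\lambda_n$ satisfy the $\mathbb{N}$-linearity condition. Then there exist an open neighbourhood $\tilde U$ of $p$ in $X$, an open set $U\subset\mathbb{R}^n$ containing $\mathbf{0}$, and a local coordinate chart $\Phi:U\to\tilde U$, smooth with smooth inverse, with $\Phi(\mathbf{0})=p$, such that $$\Phi^*(V)=V_0=\sum_{i=1}^n\lambda_i x_i\frac{\partial}{\partial x_i}$$ at every $\mathbf{x}\in U$.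
   Context: A Morse function is a smooth function $f:X\to\mathbb{R}$ all of whose critical points are non-degenerate (the Hessian at the critical point has full rank). The gradient $\nabla f$ is taken with respect to $g$. For a diffeomorphism $\Phi$ and a vector field $V$ on its target, $\Phi^*(V)=(D\Phi)^{-1}(V\circ\Phi)$. $\mathbb{N}$-linearity condition: real numbers $\lambda_1,\dots,\lambda_n$ satisfy it if, for every $i\in\{1,\dots,n\}$ and every $(a_1,\dots,a_n)\in\mathbb{N}^n$ with $a_1+\dots+a_n\ge 2$ (where $\mathbb{N}$ includes $0$), one has $a_1\lambda_1+\dots+a_n\lambda_n-\lambda_i\neq 0$. *)

(* Defs.v *)
From HB Require Import structures.
From mathcomp Require Import all_boot all_order all_algebra.
From mathcomp Require Import all_classical all_reals all_analysis.

Set Implicit Arguments.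
Unset Strict Implicit.
Unset Printing Implicit Defensive.

Import Order.TTheory GRing.Theory Num.Theory.
Import numFieldNormedType.Exports.

Local Open Scope classical_set_scope.
Local Open Scope ring_scope.

(* Points and tangent vectors of R^n are row vectors. Following 'J, linear maps
   act on the right: ('J F x) i j is the derivative of F_j in direction i. *)

Section calculus.
Context {R : realType}.

Definition partial n (i : 'I_n) (h : 'rV[R]_n -> R) (x : 'rV[R]_n) : R :=
  'D_(delta_mx 0 i) h x.

(* Meant for open U only. A function with continuous partial derivatives is
   differentiable, so asking for differentiability rather than for the mere
   existence of the partial derivatives does not change the class C^k. *)
Fixpoint Ck_on n (k : nat) (U : set 'rV[R]_n) (h : 'rV[R]_n -> R) : Prop :=
  if k is k'.+1 then
    (forall x, U x -> differentiable h x) /\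
    (forall i, Ck_on k' U (partial i h))
  else forall x, U x -> {for x, continuous h}.

Definition smooth_on n (U : set 'rV[R]_n) (h : 'rV[R]_n -> R) : Prop :=
  forall k, Ck_on k U h.

Definition smooth_map_on n m (U : set 'rV[R]_n) (F : 'rV[R]_n -> 'rV[R]_m) :
    Prop :=
  forall j, smooth_on U (fun x => F x 0 j).

End calculus.

(* A homeomorphism between the open sets [source] and [target]; the values of
   [coord] outside [source] and of [param] outside [target] are irrelevant. *)
Record chart (R : realType) (X : topologicalType) (n : nat) := Chart {
  source : set X;
  target : set 'rV[R]_n;
  coord : X -> 'rV[R]_n;
  param : 'rV[R]_n -> X;
  open_source : open source;
  open_target : open target;
  coord_target : forall q, source q -> target (coord q);
  param_source : forall x, target x -> source (param x);
  coordK : forall q, source q -> param (coord q) = q;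
  paramK : forall x, target x -> coord (param x) = x;
  coord_continuous : forall q, source q -> {for q, continuous coord};
  param_continuous : forall x, target x -> {for x, continuous param}
}.

Section transition.
Context {R : realType} {X : topologicalType} {n : nat}.
Implicit Types c d : chart R X n.

Definition overlap c d : set 'rV[R]_n :=
  target c `&` param c @^-1` source d.

Definition transition c d : 'rV[R]_n -> 'rV[R]_n := coord d \o param c.

Definition compatible c d : Prop :=
  smooth_map_on (overlap c d) (transition c d) /\
  smooth_map_on (overlap d c) (transition d c).

End transition.

(* The atlas need not be maximal: see [smooth_chart] for the maximal one. *)
Record smooth_manifold (R : realType) (n : nat) := SmoothManifold {
  carrier :> topologicalType;
  manifold_hausdorff : hausdorff_space carrier;
  manifold_second_countable : @second_countable carrier;
  atlas : set (chart R carrier n);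
  atlas_cover : forall q : carrier, exists2 c, atlas c & source c q;
  atlas_compatible : forall c d, atlas c -> atlas d -> compatible c d
}.

Section manifold.
Context {R : realType} {n : nat}.
Variable X : smooth_manifold R n.
Implicit Types (c d : chart R X n) (q : X) (f : X -> R).

Definition smooth_chart d : Prop := forall c, atlas c -> compatible c d.

(* A metric is given by its matrices (g_ij) in the charts of the atlas;
   [metric_change] is the transformation law of (0,2)-tensors. *)
Record riemannian_metric := RiemannianMetric {
  metric : chart R X n -> 'rV[R]_n -> 'M[R]_n;
  metric_smooth : forall c, atlas c ->
    forall i j, smooth_on (target c) (fun x => metric c x i j);
  metric_sym : forall c, atlas c -> forall x, target c x ->
    (metric c x)^T = metric c x;
  metric_pos : forall c, atlas c -> forall x, target c x ->
    forall v : 'rV[R]_n, v != 0 -> 0 < (v *m metric c x *m v^T) 0 0;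
  metric_change : forall c d, atlas c -> atlas d -> forall x, overlap c d x ->
    let J := 'J (transition c d) x in
    metric c x = J *m metric d (transition c d x) *m J^T
}.

Definition local_expr f c : 'rV[R]_n -> R := f \o param c.

Definition smooth_fun f : Prop :=
  forall c, atlas c -> smooth_on (target c) (local_expr f c).

Definition differential f c (x : 'rV[R]_n) : 'rV[R]_n :=
  \row_i partial i (local_expr f c) x.

Definition hessian f c (x : 'rV[R]_n) : 'M[R]_n :=
  \matrix_(i, j) partial i (partial j (local_expr f c)) x.

(* Criticality, non-degeneracy and the Morse eigenvalues below do not depend on
   the chart around the point, so "in every chart" and "in some chart" agree. *)
Definition critical_point f q : Prop :=
  forall c, atlas c -> source c q -> differential f c (coord c q) = 0.

Definition nondegenerate_at f q : Prop :=
  forall c, atlas c -> source c q -> \rank (hessian f c (coord c q)) = n.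

Definition morse_function f : Prop :=
  smooth_fun f /\ forall q, critical_point f q -> nondegenerate_at f q.

(* A vector field is given by its components in the charts of the atlas. *)
Definition vector_field := chart R X n -> 'rV[R]_n -> 'rV[R]_n.

Variable g : riemannian_metric.

Definition inv_metric c (x : 'rV[R]_n) : 'M[R]_n := invmx (metric g c x).

(* V^k = g^{kl} d_l f *)
Definition gradient f : vector_field := fun c x =>
  \row_k \sum_l inv_metric c x k l * differential f c x 0 l.

Definition christoffel c (k i j : 'I_n) (x : 'rV[R]_n) : R :=
  2^-1 * \sum_l inv_metric c x k l *
    (partial i (fun y => metric g c y j l) x
     + partial j (fun y => metric g c y i l) x
     - partial l (fun y => metric g c y i j) x).

(* V_j = g_{jk} V^k *)
Definition lower_index (V : vector_field) c (j : 'I_n) (x : 'rV[R]_n) : R :=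
  \sum_k metric g c x j k * V c x 0 k.

(* nabla_i V_j, for the Levi-Civita connection *)
Definition covariant_derivative (V : vector_field) c (i j : 'I_n)
    (x : 'rV[R]_n) : R :=
  partial i (lower_index V c j) x
  - \sum_k christoffel c k i j x * lower_index V c k x.

(* Entry (i, k) is g^{jk} nabla_i V_j. *)
Definition morse_endomorphism f c (x : 'rV[R]_n) : 'M[R]_n :=
  \matrix_(i, k) \sum_j
    inv_metric c x j k * covariant_derivative (gradient f) c i j x.

Definition morse_eigenvalues f q (lambda : 'I_n -> R) : Prop :=
  forall c, atlas c -> source c q ->
    char_poly (morse_endomorphism f c (coord c q)) =
    \prod_(i < n) ('X - (lambda i)%:P).

(* (DPhi_x)^-1 (V (Phi x)), computed through the components of V in a chart c
   around Phi x. *)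
Definition pullback (Phi : 'rV[R]_n -> X) (V : vector_field) c (x : 'rV[R]_n) :
    'rV[R]_n :=
  V c (coord c (Phi x)) *m invmx ('J (coord c \o Phi) x).

End manifold.

Definition N_linearity (R : realType) (n : nat) (lambda : 'I_n -> R) : Prop :=
  forall (i : 'I_n) (a : 'I_n -> nat), (2 <= \sum_(j < n) a j)%N ->
    \sum_(j < n) (a j)%:R * lambda j - lambda i <> 0.

(* Main.v *)
(* In a chart around p the gradient field has differential Hess(f) g^-1 at p,
   which is self-adjoint for g; hence a linear change of coordinates makes it
   diag(lambda). By N-linearity the homological equations for the Taylor
   coefficients of a conjugacy to the linear field are solvable degree by
   degree, and Borel's lemma turns the formal solution into a smooth map which
   conjugates up to a remainder flat at 0. All lambda_i are nonzero, so 0 is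
   hyperbolic: a conic cutoff writes the remainder as a sum of two terms, one
   flat along the unstable subspace, the other along the stable one. Each is
   removed by solving the conjugacy equation by iterated integration along the
   linear flow, forward for the first term and backward for the second; the
   exponential contraction beats every growth rate because of flatness. The
   inverse function theorem turns the resulting conjugacy into a chart. *)
From HB Require Import structures.
From mathcomp Require Import all_boot all_order all_algebra.
From mathcomp Require Import all_classical all_reals all_analysis.
From mathcomp Require Import measurable_realfun perm ring lra.
Require Import Defs.

Set Implicit Arguments.
Unset Strict Implicit.
Unset Printing Implicit Defensive.

Import Order.TTheory GRing.Theory Num.Theory.
Import numFieldNormedType.Exports.

Local Open Scope classical_set_scope.
Local Open Scope ring_scope.

(** * Calculus on row vectors *)

(** A conjugacy is always expressed by the equation [Vlin lam (F i) z = V i (rowf F z)], so no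
    nonlinear flow occurs: only the explicit flow of the linear field is integrated. The main
    obstacle is to obtain derivatives of all orders on one neighbourhood. The integrals live on a
    strip [rho x < r] around the unstable subspace, which the forward flow preserves, and a partial
    derivative in direction [i] merely replaces the exponent [mu] by [mu - lam i]. Flatness
    compensates every exponent, so the width of the strip does not depend on the order of
    differentiation. The strip is in general unbounded, hence remainders are first cut off to
    functions on the whole space. A second obstacle is that the two flat terms cannot be removed
    independently: the second one is pulled back through the conjugacy that removes the first, and
    must still vanish in a cone around the stable subspace; [cone_stable] ensures this at the price
    of a narrower cone. Derivatives of integrals, limits and inverse maps all come from a quadratic
    Taylor remainder, a bound that these operations preserve. *)

Section partials.
Context {R : realType} {n : nat}.
Implicit Types (x v : 'rV[R]_n) (f g h : 'rV[R]_n -> R) (U : set 'rV[R]_n).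

Lemma row_norm_le x i : `|x 0 i| <= `|x|.
Proof.
rewrite [leRHS]/Num.norm /= mx_normrE.
exact: (le_bigmax_cond 0 (fun ij : 'I_1 * 'I_n => `|x ij.1 ij.2|) (j := (0, i))).
Qed.

Lemma row_norm_ub x (C : R) : 0 <= C -> (forall i, `|x 0 i| <= C) -> `|x| <= C.
Proof.
move=> C0 xC; rewrite [leLHS]/Num.norm /= mx_normrE.
by apply: bigmax_le => // -[i j] _ /=; rewrite ord1.
Qed.

(** A partial l1 norm. For [P] selecting the negative eigenvalues it is the l1 distance to the
    unstable subspace, for [xpredT] the l1 distance to the origin. Flatness is expressed by powers
    of such weights. *)
Definition wt (P : pred 'I_n) x : R := \sum_(i | P i) `|x 0 i|.

Lemma wt_ge0 P x : 0 <= wt P x.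
Proof. exact: sumr_ge0. Qed.

Lemma wtT_le x : wt xpredT x <= n%:R * `|x|.
Proof.
rewrite /wt (le_trans (ler_sum _ (fun i _ => row_norm_le x i))) //.
by rewrite sumr_const card_ord mulr_natl.
Qed.

Lemma le_wt (P : pred 'I_n) x i : P i -> `|x 0 i| <= wt P x.
Proof. by move=> Pi; rewrite /wt (bigD1 i)//= lerDl sumr_ge0. Qed.

Lemma diff_partial h x v : differentiable h x ->
  'd h x v = \sum_i partial i h x * v 0 i.
Proof.
move=> dh; rewrite [in LHS](row_sum_delta v) linear_sum /=.
apply: eq_bigr => i _; rewrite linearZ /= /partial deriveE//.
by rewrite mulrC.
Qed.

(** A quadratic remainder is more than the little o required, but unlike the latter it passes
    through integration over the half line, limits of sequences and inversion of maps. The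
    differentiability proofs in [Tint_quad], [flim_partial] and [inverse_function] are reduced to
    this criterion. *)
Lemma differentiable_quad h (g : 'I_n -> R) x (C d : R) : 0 < d ->
  (forall v, `|v| < d ->
     `|h (x + v) - h x - \sum_i g i * v 0 i| <= C * `|v| ^+ 2) ->
  differentiable h x /\ forall i, partial i h x = g i.
Proof.
move=> d0 hq.
pose L := fun v : 'rV[R]_n => \sum_i g i * v 0 i.
have Llin : linear L.
  move=> a u v; rewrite /L scaler_sumr -big_split /=.
  by apply: eq_bigr => i _; rewrite !mxE /GRing.scale /=; ring.
pose LL := GRing.isLinear.Build R 'rV[R]_n R *:%R L Llin.
pose Lf : {linear 'rV[R]_n -> R} := HB.pack L LL.
have Lc : continuous Lf.
  move=> v; apply: differentiable_continuous.
  rewrite (_ : (Lf : 'rV[R]_n -> R) = \sum_i (g i *: (fun u : 'rV[R]_n => u 0 i))).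
    by apply: differentiable_sum => i; apply/differentiableZ/differentiable_coord.
  by apply/funext => u; rewrite fct_sumE.
have nb (a : R) : 0 < a -> \forall v \near (0 : 'rV[R]_n), `|v| < a.
  by move=> a0; exact: pseudometric_normed_Zmodule.nbhs0_lt.
have hE : h \o shift x = cst (h x) + Lf +o_ (0 : 'rV[R]_n) id.
  apply/eqaddoP => e e0; near=> v => /=.
  have vd : `|v| < d by near: v; exact: nb.
  have ve : `|v| < e / (`|C| + 1).
    by near: v; apply: nb; rewrite divr_gt0// ltr_wpDl.
  have -> : (h \o shift x - (cst (h x) + Lf)) v =
            h (x + v) - h x - \sum_i g i * v 0 i.
    rewrite /= !fctE /= [v + x]addrC opprD addrA; congr (_ - _).
  rewrite (le_trans (hq v vd))// expr2 mulrA ler_wpM2r//.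
  rewrite (@le_trans _ _ ((`|C| + 1) * `|v|))//.
    by rewrite ler_wpM2r// (le_trans (ler_norm C))// lerDl.
  by rewrite mulrC -ler_pdivlMr ?ltW// ltr_wpDl.
have dE : 'd h x = Lf :> ('rV[R]_n -> R) by exact: diff_unique.
have dh : differentiable h x.
  apply/diff_locallyP; split; first by rewrite dE.
  by rewrite dE.
split=> // i; rewrite /partial deriveE// dE /= /L (bigD1 i)//= big1.
  by rewrite addr0 mxE !eqxx mulr1.
by move=> j ji; rewrite mxE (negbTE ji) andbF mulr0.
Unshelve. all: by end_near. Qed.

End partials.

Section differential_rules.
Context {R : realType} {n : nat}.
Implicit Types (x v : 'rV[R]_n) (f g h : 'rV[R]_n -> R) (U : set 'rV[R]_n).

Lemma near_eq_differentiable f g x : (\forall y \near x, f y = g y) ->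
  differentiable f x -> differentiable g x.
Proof.
move=> fg /diff_locallyP [dfc dE].
have dE2 : g \o shift x = cst (g x) + 'd f x +o_ (0 : 'rV[R]_n) id.
  apply/eqaddoP => e e0; move/eqaddoP: dE => /(_ e e0) dE.
  have fg0 : \forall v \near (0 : 'rV[R]_n), f (v + x) = g (v + x).
    move/nbhs_ballP: fg => [d /= d0 fg]; apply/nbhs_ballP; exists d => //= v.
    rewrite -!ball_normE /= sub0r normrN => vd; apply: fg.
    by rewrite -ball_normE /= opprD addrCA subrr addr0 normrN.
  near=> v.
  have -> : (g \o shift x - (cst (g x) + 'd f x)) v =
            (f \o shift x - (cst (f x) + 'd f x)) v.
    rewrite !fctE /= (nbhs_singleton fg); congr (_ - _).
    by apply/esym; near: v; exact: fg0.
  by near: v; exact: dE.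
have dgE : 'd g x = 'd f x :> ('rV[R]_n -> R) by exact: diff_unique.
by apply/diff_locallyP; rewrite dgE.
Unshelve. all: by end_near. Qed.

Lemma near_eq_partial f g x i : (\forall y \near x, f y = g y) ->
  partial i f x = partial i g x.
Proof. by move=> fg; exact: near_eq_derive. Qed.

Lemma partialD f g x i : differentiable f x -> differentiable g x ->
  partial i (fun y => f y + g y) x = partial i f x + partial i g x.
Proof. by move=> df dg; rewrite /partial -deriveD//; exact: diff_derivable. Qed.

Lemma partialM f g x i : differentiable f x -> differentiable g x ->
  partial i (fun y => f y * g y) x = partial i f x * g x + f x * partial i g x.
Proof.
move=> df dg; rewrite /partial.
have -> : (fun y => f y * g y) = f * g by [].
rewrite deriveM; try exact: diff_derivable.
by rewrite /GRing.scale /= addrC; congr (_ + _); rewrite mulrC.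
Qed.

Lemma partial_cst a x i : partial i (fun=> a) x = 0.
Proof. by rewrite /partial (derive_cst a). Qed.

Lemma partial_coord j x i : partial i (fun y : 'rV[R]_n => y 0 j) x = (i == j)%:R.
Proof.
pose g k : R := (k == j)%:R.
have [//|v _|_ ->//] := @differentiable_quad _ _ (fun y => y 0 j) g x 0 1.
rewrite /g mul0r normr_le0 (bigD1 j)//= eqxx mul1r mxE big1 ?addr0; last first.
  by move=> k /negbTE->; rewrite mul0r.
by apply/eqP; ring.
Qed.

End differential_rules.

Section differential_rows.
Context {R : realType} {n : nat}.
Implicit Types (x v : 'rV[R]_n).

Lemma differentiable_row m (F : 'rV[R]_n -> 'rV[R]_m) x :
  (forall j, differentiable (fun y => F y 0 j) x) -> differentiable F x.
Proof.
move=> dF.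
have -> : F = \sum_j (fun y => F y 0 j *: delta_mx 0 j).
  by apply/funext => y; rewrite fct_sumE -row_sum_delta.
by apply: differentiable_sum => j; exact: differentiableZl.
Qed.

Lemma diff_row m (F : 'rV[R]_n -> 'rV[R]_m) x v j : differentiable F x ->
  'd F x v 0 j = 'd (fun y => F y 0 j) x v.
Proof.
move=> dF; pose c := fun y : 'rV[R]_m => y 0 j.
have dc : differentiable c (F x) by exact: differentiable_coord.
have -> : 'd (fun y => F y 0 j) x v = 'd c (F x) ('d F x v).
  by rewrite -[fun y => F y 0 j]/(c \o F) (@diff_comp _ _ _ _ F c).
rewrite diff_partial// (bigD1 j)//= partial_coord eqxx mul1r big1 ?addr0// => k kj.
by rewrite partial_coord (negbTE kj) mul0r.
Qed.

Lemma differentiable_coord_row m (F : 'rV[R]_n -> 'rV[R]_m) x j :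
  differentiable F x -> differentiable (fun y => F y 0 j) x.
Proof.
move=> dF; pose c := fun y : 'rV[R]_m => y 0 j.
rewrite -[fun y => F y 0 j]/(c \o F); apply: differentiable_comp => //.
exact: differentiable_coord.
Qed.

Lemma jacobianE m (F : 'rV[R]_n -> 'rV[R]_m) x i j : differentiable F x ->
  ('J F x) i j = partial i (fun y => F y 0 j) x.
Proof.
move=> dF; rewrite /jacobian /lin1_mx mxE diff_row//.
by rewrite /partial deriveE//; exact: differentiable_coord_row.
Qed.

End differential_rows.

Lemma differentiable_comp_row {R : realType} {n m : nat}
    (h : 'rV[R]_m -> R) (F : 'rV[R]_n -> 'rV[R]_m) x :
  (forall j, differentiable (fun y => F y 0 j) x) -> differentiable h (F x) ->
  differentiable (fun y => h (F y)) x.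
Proof.
move=> dF dh; apply: (@differentiable_comp _ _ _ _ F h) => //.
exact: differentiable_row.
Qed.

Lemma partial_comp {R : realType} {n m : nat}
    (h : 'rV[R]_m -> R) (F : 'rV[R]_n -> 'rV[R]_m) x i :
  (forall j, differentiable (fun y => F y 0 j) x) -> differentiable h (F x) ->
  partial i (fun y => h (F y)) x =
  \sum_j partial j h (F x) * partial i (fun y => F y 0 j) x.
Proof.
move=> dF dh; have dF' := differentiable_row dF.
rewrite /partial deriveE; last exact: differentiable_comp_row.
rewrite (@diff_comp _ _ _ _ F h)//= diff_partial//.
by apply: eq_bigr => j _; congr (_ * _); rewrite diff_row// /partial deriveE.
Qed.

Section mean_value.
Context {R : realType} {n : nat}.
Implicit Types (x v : 'rV[R]_n) (f g h : 'rV[R]_n -> R) (U : set 'rV[R]_n).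

Lemma is_derive_line h x v (t : R) : differentiable h (x + t *: v) ->
  is_derive t 1 (fun s => h (x + s *: v)) (\sum_i partial i h (x + t *: v) * v 0 i).
Proof.
move=> dh.
have dl : is_diff t (fun s : R => x + s *: v) (fun s => s *: v).
  have : is_diff t (cst x + ( *:%R ^~ v) : R -> 'rV[R]_n) (0 + *:%R ^~ v).
    exact: is_diffD.
  by rewrite add0r.
have dc : differentiable (h \o (fun s : R => x + s *: v)) t.
  exact: differentiable_comp.
apply: DeriveDef; first exact: (diff_derivable (f := h \o (fun s : R => x + s *: v))).
rewrite -[fun s => _]/(h \o (fun s : R => x + s *: v)) deriveE//.
by rewrite diff_comp//= diff_val scale1r diff_partial.
Qed.

Lemma mean_value h x v :
  (forall t : R, 0 <= t <= 1 -> differentiable h (x + t *: v)) ->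
  exists2 t : R, 0 <= t <= 1 &
    h (x + v) - h x = \sum_i partial i h (x + t *: v) * v 0 i.
Proof.
move=> dh.
pose df t := \sum_i partial i h (x + t *: v) * v 0 i.
have dl (t : R) : 0 <= t <= 1 -> is_derive t 1 (fun s => h (x + s *: v)) (df t).
  by move=> t01; apply: is_derive_line; exact: dh.
have [||t] := @MVT_segment R (fun s => h (x + s *: v)) df 0 1 ler01.
- by move=> t t01; apply: dl; move: t01; rewrite in_itv/= => /andP[/ltW-> /ltW->].
- apply: derivable_within_continuous => t; rewrite in_itv/= => t01.
  by have [] := dl t t01.
rewrite in_itv/= => t01 dE; exists t => //.
by move: dE; rewrite scale1r scale0r addr0 subr0 mulr1.
Qed.

End mean_value.

Section Ck_closure.
Context {R : realType} {n : nat}.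
Implicit Types (x v : 'rV[R]_n) (f g h : 'rV[R]_n -> R) (U : set 'rV[R]_n).

Lemma Ck_ext k U f g : open U -> (forall x, U x -> f x = g x) ->
  Ck_on k U f -> Ck_on k U g.
Proof.
move=> oU; elim: k f g => [|k IH] f g fg /=.
  move=> cf x Ux; have fgx : \forall y \near x, f y = g y.
    by apply: filterS (open_nbhs_nbhs (conj oU Ux)) => y /fg.
  have fgx' : f @ x --> g x by rewrite -(fg _ Ux); exact: cf.
  apply: cvg_trans fgx'; exact: (@near_eq_cvg _ _ (nbhs x) _ f g).
move=> [df Cf]; split.
  move=> x Ux; apply: near_eq_differentiable (df x Ux).
  by apply: filterS (open_nbhs_nbhs (conj oU Ux)) => y /fg.
move=> i; apply: IH (Cf i) => x Ux; apply: near_eq_partial.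
by apply: filterS (open_nbhs_nbhs (conj oU Ux)) => y /fg.
Qed.

Lemma Ck_sub k U W f : W `<=` U -> Ck_on k U f -> Ck_on k W f.
Proof.
move=> WU; elim: k f => [|k IH] f /=; first by move=> cf x /WU /cf.
by move=> [df Cf]; split=> [x /WU /df //|i]; exact: IH.
Qed.

Lemma Ck_setU k U W f : Ck_on k U f -> Ck_on k W f -> Ck_on k (U `|` W) f.
Proof.
elim: k f => [|k IH] f /= => [cU cW x [/cU|/cW]//|].
by move=> [dU CU] [dW CW]; split=> [x [/dU|/dW]//|i]; exact: IH.
Qed.

Lemma CkW k U f : Ck_on k.+1 U f -> Ck_on k U f.
Proof.
elim: k f => [|k IH] f /= [df Cf].
  by move=> x /df /differentiable_continuous.
by split=> // i; apply: IH; exact: Cf.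
Qed.

Lemma Ck_cst k U (a : R) : Ck_on k U (fun=> a).
Proof.
elim: k a => [|k IH] a /=; first by move=> x _; apply: cst_continuous.
split=> [x _|i]; first exact: differentiable_cst.
rewrite (_ : partial i _ = fun=> 0); first exact: IH.
by apply/funext => x; rewrite partial_cst.
Qed.

Lemma Ck_coord k U j : Ck_on k U (fun x => x 0 j).
Proof.
case: k => [|k] /=.
  by move=> x _; apply: differentiable_continuous; exact: differentiable_coord.
split=> [x _|i]; first exact: differentiable_coord.
rewrite (_ : partial i _ = fun=> (i == j)%:R); first exact: Ck_cst.
by apply/funext => x; rewrite partial_coord.
Qed.

Lemma CkD k U f g : open U -> Ck_on k U f -> Ck_on k U g ->
  Ck_on k U (fun x => f x + g x).
Proof.
move=> oU; elim: k f g => [|k IH] f g /=.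
  by move=> cf cg x Ux; apply: (@continuousD _ _ _ f g); [exact: cf|exact: cg].
move=> [df Cf] [dg Cg]; split=> [x Ux|i].
  by apply: differentiableD; [exact: df|exact: dg].
apply: (@Ck_ext _ _ (fun x => partial i f x + partial i g x)) => //.
  by move=> x Ux; rewrite partialD//; [exact: df|exact: dg].
exact: IH.
Qed.

Lemma CkM k U f g : open U -> Ck_on k U f -> Ck_on k U g ->
  Ck_on k U (fun x => f x * g x).
Proof.
move=> oU; elim: k f g => [|k IH] f g /=.
  by move=> cf cg x Ux; apply: (@continuousM _ _ f g); [exact: cf|exact: cg].
move=> [df Cf] [dg Cg]; split=> [x Ux|i].
  by apply: differentiableM; [exact: df|exact: dg].
apply: (@Ck_ext _ _ (fun x => partial i f x * g x + f x * partial i g x)) => //.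
  by move=> x Ux; rewrite partialM//; [exact: df|exact: dg].
by apply: CkD => //; apply: IH => //; exact: CkW.
Qed.

Lemma CkV k U f : open U -> (forall x, U x -> f x != 0) -> Ck_on k U f ->
  Ck_on k U (fun x => (f x)^-1).
Proof.
move=> oU f0; elim: k f f0 => [|k IH] f f0 /=.
  by move=> cf x Ux; apply: (@continuousV _ _ f); [exact: f0|exact: cf].
move=> [df Cf]; split=> [x Ux|i].
  by apply: differentiableV; [exact: df|exact: f0].
apply: (@Ck_ext _ _ (fun x => -1 * partial i f x * ((f x)^-1 * (f x)^-1))) => //.
  move=> x Ux; rewrite /partial deriveV ?f0//; last exact/diff_derivable/df.
  by rewrite /GRing.scale /= expr2 invfM; ring.
apply: CkM => //; first by apply: CkM => //; exact: Ck_cst.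
by apply: CkM => //; apply: IH => //; exact: CkW.
Qed.

Lemma Ck_sum k U (I : Type) (r : seq I) (P : pred I) (F : I -> 'rV[R]_n -> R) :
  open U -> (forall i, P i -> Ck_on k U (F i)) ->
  Ck_on k U (fun x => \sum_(i <- r | P i) F i x).
Proof.
move=> oU CF; elim: r => [|i r IH].
  by apply: (Ck_ext oU _ (Ck_cst k U 0)) => x _; rewrite big_nil.
case: (boolP (P i)) => Pi.
  by apply: (Ck_ext oU _ (CkD oU (CF i Pi) IH)) => x _; rewrite big_cons Pi.
by apply: (Ck_ext oU _ IH) => x _; rewrite big_cons (negbTE Pi).
Qed.

Lemma Ck_prod k U (I : Type) (r : seq I) (P : pred I) (F : I -> 'rV[R]_n -> R) :
  open U -> (forall i, P i -> Ck_on k U (F i)) ->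
  Ck_on k U (fun x => \prod_(i <- r | P i) F i x).
Proof.
move=> oU CF; elim: r => [|i r IH].
  by apply: (Ck_ext oU _ (Ck_cst k U 1)) => x _; rewrite big_nil.
case: (boolP (P i)) => Pi.
  by apply: (Ck_ext oU _ (CkM oU (CF i Pi) IH)) => x _; rewrite big_cons Pi.
by apply: (Ck_ext oU _ IH) => x _; rewrite big_cons (negbTE Pi).
Qed.

End Ck_closure.

Lemma continuous_row {R : realType} {T : topologicalType} {m : nat}
    (F : T -> 'rV[R]_m) (x : T) :
  (forall j, {for x, continuous (fun y => F y 0 j)}) -> {for x, continuous F}.
Proof.
move=> cF; apply/cvgrPdist_lt => e e0.
have e20 : 0 < e / 2 by rewrite divr_gt0.
have nF : \forall y \near x, forall j, `|F x 0 j - F y 0 j| < e / 2.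
  apply: filter_forall => j.
  by have /cvgrPdist_lt/(_ _ e20) := cF j.
near=> y; apply: (@le_lt_trans _ _ (e / 2)); last first.
  by rewrite ltr_pdivrMr// ltr_pMr// ltr1n.
apply: row_norm_ub => [|j]; first exact: ltW.
by rewrite !mxE; apply: ltW; move: j; near: y.
Unshelve. all: by end_near. Qed.

Lemma Ck_comp {R : realType} {n m : nat} k (U : set 'rV[R]_n)
    (W : set 'rV[R]_m) (h : 'rV[R]_m -> R) (F : 'rV[R]_n -> 'rV[R]_m) :
  open U -> (forall x, U x -> W (F x)) ->
  (forall j, Ck_on k U (fun x => F x 0 j)) -> Ck_on k W h ->
  Ck_on k U (fun x => h (F x)).
Proof.
move=> oU UW; elim: k h => [|k IH] h /=.
  move=> cF ch x Ux.
  apply: (@continuous_comp _ _ _ F h); last exact/ch/UW.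
  by apply: continuous_row => j; exact: cF.
move=> CF [dh Ch]; have CkF j : Ck_on k U (fun x => F x 0 j).
  by apply: CkW; exact: CF.
split=> [x Ux|i].
  apply: differentiable_comp_row => [j|]; first by have [d _] := CF j; exact: d.
  by apply: dh; exact: UW.
apply: (@Ck_ext _ _ _ _ (fun x => \sum_j partial j h (F x) * partial i (fun y => F y 0 j) x)) => //.
  move=> x Ux; rewrite partial_comp// => [j|]; first by have [d _] := CF j; exact: d.
  by apply: dh; exact: UW.
apply: Ck_sum => // j _; apply: CkM => //; first exact: IH.
by have [_] := CF j; exact.
Qed.

(** * Integrals over the half line *)

Section half_line.
Context {R : realType}.
Notation mu := (@lebesgue_measure R).
Implicit Types (phi psi : R -> R) (a K : R).

Definition half_int phi : R := \int[mu]_(t in `[0, +oo[) phi t.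

(** Domination by one exponential is the integrability criterion throughout. It is stable under
    finite sums and multiples with explicit constants, and the resulting bound [K / a] in
    [half_int_bound] becomes small when the rate [a] is large. *)
Definition decaying a K phi : Prop :=
  (forall t, 0 <= t -> {for t, continuous phi}) /\
  (forall t, 0 <= t -> `|phi t| <= K * expR (- (a * t))).

Lemma continuous_expRM a : continuous (fun t : R => expR (- (a * t))).
Proof.
move=> t; apply: (@continuous_comp _ _ _ (fun t : R => - (a * t)) expR).
  apply: (@continuousN _ _ _ (fun t => a * t)).
  by apply: (@continuousM _ _ (fun=> a) id) => //; exact: cst_continuous.
exact: continuous_expR.
Qed.

Lemma cvgy_expRM a : 0 < a -> expR (- (a * t)) @[t --> +oo] --> (0 : R).
Proof.
move=> a0.
apply: (@cvg_comp _ _ _ (fun t => a * t) (fun t : R => expR (- t)) _ (pinfty_nbhs R)); last exact: cvgr_expR.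
exact: gt0_cvgMry.
Qed.

Lemma within_half_line phi :
  (forall t, 0 <= t -> {for t, continuous phi}) ->
  {within `[0, +oo[, continuous phi}.
Proof.
move=> cphi; apply: continuous_in_subspaceT => t; rewrite inE/= in_itv/= andbT.
exact: cphi.
Qed.

Lemma is_derive_expRM a (t : R) :
  is_derive t 1 (fun s : R => - expR (- (a * s))) (a * expR (- (a * t))).
Proof.
have da : is_derive t 1 (fun s : R => - (a * s)) (- a).
  have : is_derive t 1 (- (a \*: (@id R))) (- (a *: 1)) by exact: is_deriveN.
  by rewrite /GRing.scale /= mulr1.
have h := is_deriveN (@is_derive1_comp _ expR (fun s : R => - (a * s)) t _ _
  (is_derive_expR (- (a * t))) da).
by apply: (is_derive_eq h); ring.
Qed.

Lemma half_int_exp a : 0 < a ->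
  (\int[mu]_(t in `[0%R, +oo[) (a * expR (- (a * t)))%:E = 1)%E.
Proof.
move=> a0; rewrite (@ge0_continuous_FTC2y _ _ (fun t => - expR (- (a * t))) _ 0).
- by rewrite mulr0 oppr0 expR0 EFinN oppeK add0e.
- by move=> t _; rewrite mulr_ge0 ?expR_ge0// ltW.
- apply: within_half_line => t _; apply: (@continuousM _ _ (fun=> a)).
    exact: cst_continuous.
  exact: continuous_expRM.
- by rewrite -oppr0; apply: cvgN; exact: cvgy_expRM.
- by move=> t _; have [] := is_derive_expRM a t.
- by apply: cvgN; apply: cvg_at_right_filter; exact: continuous_expRM.
- by move=> t _; rewrite derive1E; have [] := is_derive_expRM a t.
Qed.

Lemma integrable_exp a K : 0 < a ->
  mu.-integrable `[0, +oo[ (EFin \o (fun t : R => K * expR (- (a * t)))).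
Proof.
move=> a0.
pose e (t : R) := a * expR (- (a * t)).
have ia : mu.-integrable `[0, +oo[ (EFin \o e).
  apply/integrableP; split.
    apply/measurable_EFinP; apply: measurable_funTS.
    have ce : continuous e.
      by move=> t; apply: cvgMl_tmp; exact: continuous_expRM.
    exact: continuous_measurable_fun.
  under eq_integral do rewrite /= ger0_norm ?mulr_ge0 ?expR_ge0 ?ltW//.
  by rewrite half_int_exp// ltry.
have : mu.-integrable `[0, +oo[ (fun t => (K / a)%:E * (e t)%:E)%E.
  exact: integrableZl.
apply: eq_integrable => // t _ /=.
by rewrite -EFinM mulrA divfK ?gt_eqF.
Qed.

Lemma half_int_expE a K : 0 < a ->
  half_int (fun t => K * expR (- (a * t))) = K / a.
Proof.
move=> a0; rewrite /half_int RintegralZl//; last first.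
  by have := integrable_exp 1 a0; apply: eq_integrable => // t _ /=; rewrite mul1r.
congr (_ * _); apply: (mulfI (lt0r_neq0 a0)).
rewrite -RintegralZl//; last first.
  by have := integrable_exp 1 a0; apply: eq_integrable => // t _ /=; rewrite mul1r.
by rewrite /Rintegral half_int_exp// mulfV ?gt_eqF.
Qed.

Lemma decaying_integrable a K phi : 0 < a -> decaying a K phi ->
  mu.-integrable `[0, +oo[ (EFin \o phi).
Proof.
move=> a0 [cphi bphi].
apply: (le_integrable _ _ _ (integrable_exp K a0)) => //.
  apply/measurable_EFinP; apply: subspace_continuous_measurable_fun => //.
  exact: within_half_line.
move=> t; rewrite /= in_itv/= andbT => t0; rewrite lee_fin.
by rewrite (le_trans (bphi _ t0))// ler_norm.
Qed.

Lemma half_int_bound a K phi : 0 < a -> decaying a K phi ->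
  `|half_int phi| <= K / a.
Proof.
move=> a0 dphi; have iphi := decaying_integrable a0 dphi.
rewrite -(half_int_expE K a0).
rewrite (le_trans (le_normr_Rintegral _ iphi))//.
apply: le_Rintegral => //; first exact: (integrable_norm iphi).
  exact: integrable_exp.
by move=> t; rewrite /= in_itv/= andbT; exact: (dphi.2 t).
Qed.

Lemma half_intD a K a' K' phi psi : 0 < a -> 0 < a' ->
  decaying a K phi -> decaying a' K' psi ->
  half_int (fun t => phi t + psi t) = half_int phi + half_int psi.
Proof.
move=> a0 a'0 dphi dpsi; apply: RintegralD => //.
  exact: decaying_integrable dphi.
exact: decaying_integrable dpsi.
Qed.

Lemma half_intZ a K c phi : 0 < a -> decaying a K phi ->
  half_int (fun t => c * phi t) = c * half_int phi.
Proof. by move=> a0 dphi; apply: RintegralZl => //; exact: decaying_integrable dphi. Qed.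

Lemma eq_half_int phi psi : (forall t, 0 <= t -> phi t = psi t) ->
  half_int phi = half_int psi.
Proof.
move=> pp; apply: eq_Rintegral => t; rewrite inE/= in_itv/= andbT.
exact: pp.
Qed.

Lemma decayingZ a K c phi : decaying a K phi ->
  decaying a (`|c| * K) (fun t => c * phi t).
Proof.
move=> [cphi bphi]; split=> t t0.
  by apply: (@continuousM _ _ (fun=> c)); [exact: cst_continuous|exact: cphi].
by rewrite normrM -mulrA ler_wpM2l// bphi.
Qed.

Lemma decayingD a K K' phi psi : decaying a K phi -> decaying a K' psi ->
  decaying a (K + K') (fun t => phi t + psi t).
Proof.
move=> [cphi bphi] [cpsi bpsi]; split=> t t0.
  by apply: (@continuousD _ _ _ phi psi); [exact: cphi|exact: cpsi].
by rewrite mulrDl (le_trans (ler_normD _ _))// lerD// ?bphi ?bpsi.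
Qed.

Lemma decaying0 a : decaying a 0 (fun=> 0).
Proof.
split=> t t0; first exact: cst_continuous.
by rewrite normr0 mul0r.
Qed.

Lemma decaying_sum a (I : Type) (r : seq I) (K : I -> R) (F : I -> R -> R) :
  (forall i, decaying a (K i) (F i)) ->
  decaying a (\sum_(i <- r) K i) (fun t => \sum_(i <- r) F i t).
Proof.
move=> dF; elim: r => [|i r IH].
  rewrite big_nil (_ : (fun t : R => _) = fun=> 0); first exact: decaying0.
  by apply/funext => t; rewrite big_nil.
rewrite big_cons (_ : (fun t : R => _) = (fun t => F i t + \sum_(i <- r) F i t)).
  exact: decayingD.
by apply/funext => t; rewrite big_cons.
Qed.

Lemma half_int_sum a (I : Type) (r : seq I) (K : I -> R) (F : I -> R -> R) :
  0 < a -> (forall i, decaying a (K i) (F i)) ->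
  half_int (fun t => \sum_(i <- r) F i t) = \sum_(i <- r) half_int (F i).
Proof.
move=> a0 dF; elim: r => [|i r IH].
  rewrite big_nil (_ : (fun t : R => _) = (fun t => 0 * 0)).
    by rewrite (half_intZ 0 a0 (decaying0 a)) mul0r.
  by apply/funext => t; rewrite big_nil mul0r.
rewrite big_cons -IH -(half_intD a0 a0 (dF i) (decaying_sum r dF)).
by congr half_int; apply/funext => t; rewrite big_cons.
Qed.

(* [phi - K e^{-t}] is nondecreasing, which reduces the claim to the
   fundamental theorem of calculus for nonnegative integrands. *)
Lemma half_int_derive K K' phi (dphi : R -> R) :
  (forall t : R, 0 <= t -> is_derive t 1 phi (dphi t)) ->
  decaying 1 K phi -> decaying 1 K' dphi -> half_int dphi = - phi 0.
Proof.
move=> dp [cphi bphi] ddphi; have [cdphi bdphi] := ddphi.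
pose psi t := dphi t + K' * expR (- (1 * t)).
have dexp : decaying 1 `|K'| (fun t => K' * expR (- (1 * t))).
  split=> t t0.
    apply: (@continuousM _ _ (fun=> K')); first exact: cst_continuous.
    exact: continuous_expRM.
  by rewrite normrM (ger0_norm (expR_ge0 _)).
have dG (t : R) : 0 <= t ->
    is_derive t 1 (fun s => phi s + K' * - expR (- (1 * s))) (psi t).
  move=> t0; have h1 := dp t t0; have h2 := is_derive_expRM 1 t.
  have h := is_deriveD h1 (is_deriveZ K' h2).
  by apply: (is_derive_eq h); rewrite /psi /GRing.scale /=; ring.
have psiE : half_int psi = 0 - (phi 0 + K' * - expR (- (1 * 0))).
  rewrite /half_int.
  apply: (@Rintegral_ge0_continuous_FTC2y _ psi (fun s => phi s + K' * - expR (- (1 * s))) 0 0).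
  - move=> t t0; rewrite /psi -lerBlDr sub0r.
    by have := bdphi t t0; rewrite ler_norml => /andP[].
  - apply: within_half_line => t t0; apply: (@continuousD _ _ _ dphi).
      exact: cdphi.
    exact: dexp.1.
  - rewrite -[X in _ --> X](_ : 0 + K' * - 0 = 0); last by rewrite oppr0 mulr0 addr0.
    apply: cvgD; last by apply: cvgMl_tmp; apply: cvgN; exact: cvgy_expRM.
    apply/norm_cvg0P.
    apply: (@squeeze_cvgr _ _ _ _ (fun=> 0) (fun t => K * expR (- (1 * t)))).
    + near=> t; rewrite normr_ge0 bphi//; near: t.
    + exact: cvg_cst.
    + by rewrite -(mulr0 K); apply: cvgMl_tmp; exact: cvgy_expRM.
  - by move=> t t0; have [] := dG t (ltW t0).
  - apply: cvg_at_right_filter; apply: (@continuousD _ _ _ phi).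
      exact: cphi.
    apply: (@continuousM _ _ (fun=> K')); first exact: cst_continuous.
    by apply: cvgN; exact: continuous_expRM.
  - move=> t; rewrite in_itv/= andbT => t0; rewrite derive1E.
    by have [] := dG t (ltW t0).
have := psiE; rewrite (half_intD ltr01 ltr01 ddphi dexp) half_int_expE//.
by rewrite mulr0 oppr0 expR0; lra.
Unshelve. all: by end_near. Qed.

End half_line.

(** * Closure properties of smooth functions and Taylor estimates *)

Section smooth_functions.
Context {R : realType} {n : nat}.
Implicit Types (x v : 'rV[R]_n) (f g h : 'rV[R]_n -> R) (U : set 'rV[R]_n).

Lemma smooth_differentiable U f x : smooth_on U f -> U x -> differentiable f x.
Proof. by move=> /(_ 1%N)[df _]; exact: df. Qed.

Lemma smooth_partial U f i : smooth_on U f -> smooth_on U (partial i f).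
Proof. by move=> sf k; have [_] := sf k.+1; exact. Qed.

Lemma smooth_ext U f g : open U -> (forall x, U x -> f x = g x) ->
  smooth_on U f -> smooth_on U g.
Proof. by move=> oU fg sf k; exact: Ck_ext (sf k). Qed.

Lemma smooth_sub U W f : W `<=` U -> smooth_on U f -> smooth_on W f.
Proof. by move=> WU sf k; exact: Ck_sub (sf k). Qed.

Lemma smooth_setU U W f : smooth_on U f -> smooth_on W f -> smooth_on (U `|` W) f.
Proof. by move=> sU sW k; exact: Ck_setU. Qed.

Lemma smooth_cst U (a : R) : smooth_on U (fun=> a).
Proof. by move=> k; exact: Ck_cst. Qed.

Lemma smooth_coord U j : smooth_on U (fun x => x 0 j).
Proof. by move=> k; exact: Ck_coord. Qed.

Lemma smoothD U f g : open U -> smooth_on U f -> smooth_on U g ->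
  smooth_on U (fun x => f x + g x).
Proof. by move=> oU sf sg k; exact: CkD. Qed.

Lemma smoothM U f g : open U -> smooth_on U f -> smooth_on U g ->
  smooth_on U (fun x => f x * g x).
Proof. by move=> oU sf sg k; exact: CkM. Qed.

Lemma smoothZ U a f : open U -> smooth_on U f -> smooth_on U (fun x => a * f x).
Proof. by move=> oU sf; apply: smoothM => //; exact: smooth_cst. Qed.

Lemma smoothN U f : open U -> smooth_on U f -> smooth_on U (fun x => - f x).
Proof.
move=> oU sf; apply: (smooth_ext oU _ (smoothZ (-1) oU sf)) => x _.
by rewrite mulN1r.
Qed.

Lemma smoothB U f g : open U -> smooth_on U f -> smooth_on U g ->
  smooth_on U (fun x => f x - g x).
Proof. by move=> oU sf sg; apply: smoothD => //; exact: smoothN. Qed.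

Lemma smoothV U f : open U -> (forall x, U x -> f x != 0) -> smooth_on U f ->
  smooth_on U (fun x => (f x)^-1).
Proof. by move=> oU f0 sf k; exact: CkV. Qed.

Lemma smooth_sum U (I : Type) (r : seq I) (P : pred I) (F : I -> 'rV[R]_n -> R) :
  open U -> (forall i, P i -> smooth_on U (F i)) ->
  smooth_on U (fun x => \sum_(i <- r | P i) F i x).
Proof. by move=> oU sF k; apply: Ck_sum => // i Pi; exact: sF. Qed.

Lemma smooth_prod U (I : Type) (r : seq I) (P : pred I) (F : I -> 'rV[R]_n -> R) :
  open U -> (forall i, P i -> smooth_on U (F i)) ->
  smooth_on U (fun x => \prod_(i <- r | P i) F i x).
Proof. by move=> oU sF k; apply: Ck_prod => // i Pi; exact: sF. Qed.

Lemma partialZ a f x i : differentiable f x ->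
  partial i (fun y => a * f y) x = a * partial i f x.
Proof.
move=> df; rewrite (partialM _ (differentiable_cst a x) df) partial_cst.
by rewrite mul0r add0r.
Qed.

Lemma partial_sum (I : finType) (F : I -> 'rV[R]_n -> R) x i :
  (forall j, differentiable (F j) x) ->
  partial i (fun y => \sum_j F j y) x = \sum_j partial i (F j) x.
Proof.
move=> dF.
suff H : forall s : seq I,
    differentiable (fun y => \sum_(j <- s) F j y) x /\
    partial i (fun y => \sum_(j <- s) F j y) x = \sum_(j <- s) partial i (F j) x.
  by have [_ ->] := H (index_enum I).
elim=> [|j s [ds IH]].
  rewrite big_nil (_ : (fun y => _) = fun=> 0); last first.
    by apply/funext => y; rewrite big_nil.
  by split; [exact: differentiable_cst|exact: partial_cst].
rewrite big_cons (_ : (fun y => _) = fun y => F j y + \sum_(k <- s) F k y).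
  by split; [exact: differentiableD|rewrite partialD// IH].
by apply/funext => y; rewrite big_cons.
Qed.

Lemma ball_row_norm x v (d : R) : `|v| < d -> ball x d (x + v).
Proof. by move=> vd; rewrite -ball_normE /= opprD addrA subrr sub0r normrN. Qed.

Lemma ball_segment x v (d t : R) : 0 <= t <= 1 -> `|v| < d -> ball x d (x + t *: v).
Proof.
move=> /andP[t0 t1] vd; apply: ball_row_norm.
by rewrite normrZ ger0_norm// (le_lt_trans _ vd)// ler_piMl.
Qed.

Lemma sum_mul_le (a : 'I_n -> R) v (C : R) : (forall i, `|a i| <= C) ->
  `|\sum_i a i * v 0 i| <= n%:R * (C * `|v|).
Proof.
move=> aC; rewrite (le_trans (ler_norm_sum _ _ _))//.
apply: (@le_trans _ _ (\sum_(i < n) C * `|v|)).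
  apply: ler_sum => i _; rewrite normrM ler_pM//.
  exact: row_norm_le.
by rewrite sumr_const card_ord mulr_natl.
Qed.

Lemma lipschitz_ball f x v (C d : R) : `|v| < d ->
  (forall y, ball x d y -> differentiable f y) ->
  (forall y i, ball x d y -> `|partial i f y| <= C) ->
  `|f (x + v) - f x| <= n%:R * (C * `|v|).
Proof.
move=> vd df Cf.
have [t t01|t t01 ->] := @mean_value _ _ f x v; first exact/df/ball_segment.
by apply: sum_mul_le => i; exact/Cf/ball_segment.
Qed.

(** Two uses of the mean value theorem: the first replaces the increment by partial derivatives at a
    point of the segment, the second compares these with the partial derivatives at [x]. The
    constant depends only on [C] and the dimension, so the estimate is uniform over families of
    functions. *)
Lemma taylor2_ball f x v (C d : R) : `|v| < d ->
  (forall y, ball x d y -> differentiable f y) ->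
  (forall y i, ball x d y -> differentiable (partial i f) y) ->
  (forall y i j, ball x d y -> `|partial j (partial i f) y| <= C) ->
  `|f (x + v) - f x - \sum_i partial i f x * v 0 i| <= n%:R * (n%:R * C) * `|v| ^+ 2.
Proof.
move=> vd df d2f Cf.
have [t t01|t t01 ->] := @mean_value _ _ f x v; first exact/df/ball_segment.
rewrite -sumrB; under eq_bigr do rewrite -mulrBl.
have C1 i : `|partial i f (x + t *: v) - partial i f x| <= n%:R * (C * `|v|).
  have tv : `|t *: v| <= `|v|.
    by case/andP: t01 => t0 t1; rewrite normrZ ger0_norm// ler_piMl.
  have C0 : 0 <= C.
    by rewrite (le_trans (normr_ge0 _) (Cf x i i _))//; apply: ballxx;
       exact: le_lt_trans vd.
  apply: (@le_trans _ _ (n%:R * (C * `|t *: v|))).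
    apply: lipschitz_ball => [|y|y j]; [exact: le_lt_trans vd|exact: d2f|exact: Cf].
  by rewrite ler_wpM2l// ler_wpM2l.
rewrite (le_trans (sum_mul_le v C1))// expr2 !mulrA lexx//.
Qed.

End smooth_functions.

Lemma smooth_comp {R : realType} {n m : nat} (U : set 'rV[R]_n)
    (W : set 'rV[R]_m) (h : 'rV[R]_m -> R) (F : 'rV[R]_n -> 'rV[R]_m) :
  open U -> (forall x, U x -> W (F x)) -> smooth_map_on U F -> smooth_on W h ->
  smooth_on U (fun x => h (F x)).
Proof. by move=> oU UW sF sh k; apply: (Ck_comp oU UW) => // j; exact: sF. Qed.

(** * The flow of a diagonal linear vector field *)

Section linear_flow.
Context {R : realType} {n : nat}.
Variable lam : 'I_n -> R.
Implicit Types (x v : 'rV[R]_n) (f g h : 'rV[R]_n -> R) (S : set 'rV[R]_n).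

Definition flow (t : R) x : 'rV[R]_n := \row_i (expR (lam i * t) * x 0 i).

Lemma flow0 x : flow 0 x = x.
Proof. by apply/rowP => i; rewrite mxE mulr0 expR0 mul1r. Qed.

Let flow_coord t j : (fun y => flow t y 0 j) = fun y => expR (lam j * t) * y 0 j.
Proof. by apply/funext => y; rewrite mxE. Qed.

Let differentiable_flow_coord t x j : differentiable (fun y => flow t y 0 j) x.
Proof.
rewrite flow_coord; apply: (smooth_differentiable (U := setT)) => //.
by apply: smoothZ => //; [exact: openT|exact: smooth_coord].
Qed.

Lemma differentiable_flow h t x : differentiable h (flow t x) ->
  differentiable (fun y => h (flow t y)) x.
Proof.
by apply: differentiable_comp_row => j; exact: differentiable_flow_coord.
Qed.

Lemma partial_flow h t x i : differentiable h (flow t x) ->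
  partial i (fun y => h (flow t y)) x = expR (lam i * t) * partial i h (flow t x).
Proof.
move=> dh.
rewrite partial_comp// (bigD1 i)//= big1 ?addr0 => [|j ji].
  rewrite flow_coord partialZ; last exact: differentiable_coord.
  by rewrite partial_coord eqxx mulr1 mulrC.
rewrite flow_coord partialZ; last exact: differentiable_coord.
by rewrite partial_coord eq_sym (negbTE ji) !mulr0.
Qed.

Lemma is_derive_flow h x (t : R) : differentiable h (flow t x) ->
  is_derive t 1 (fun s => h (flow s x))
    (\sum_i lam i * flow t x 0 i * partial i h (flow t x)).
Proof.
move=> dh.
have de i : is_derive t 1 (fun s : R => expR (lam i * s) * x 0 i) (lam i * flow t x 0 i).
  have h1 : is_derive t 1 (fun s : R => lam i * s) (lam i).
    have h1 := @is_deriveZ _ _ _ id (lam i) t 1 1 _.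
    by apply: (is_derive_eq (h1 _)); rewrite /GRing.scale /= mulr1.
  have h2 := @is_derive1_comp _ expR (fun s : R => lam i * s) t _ _
     (is_derive_expR (lam i * t)) h1.
  have h3 := @is_deriveZ _ _ _ (fun s : R => expR (lam i * s)) (x 0 i) t 1 _ h2.
  have h4 : is_derive t 1 (fun s : R => x 0 i * expR (lam i * s)) (lam i * flow t x 0 i).
    by apply: (is_derive_eq h3); rewrite /GRing.scale /= mxE; ring.
  rewrite (_ : (fun s : R => _) = fun s : R => x 0 i * expR (lam i * s))//.
  by apply/funext => s; rewrite mulrC.
have ddf i : differentiable (fun s : R => expR (lam i * s) * x 0 i) t.
  by apply/derivable1_diffP; have [] := de i.
have fE : (fun s => flow s x) = \sum_i (fun s : R => (expR (lam i * s) * x 0 i) *: (delta_mx 0 i : 'rV[R]_n)).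
  apply/funext => s; rewrite fct_sumE [LHS]row_sum_delta.
  by apply: eq_bigr => i _; rewrite mxE.
have dflow : differentiable (fun s => flow s x) t.
  rewrite fE; apply: differentiable_sum => i; exact: differentiableZl.
have dflowE i : 'd (fun s => flow s x) t 1 0 i = lam i * flow t x 0 i.
  have dc : differentiable (fun y : 'rV[R]_n => y 0 i) (flow t x).
    exact: differentiable_coord.
  have := @diff_comp _ _ _ _ (fun s => flow s x) (fun y : 'rV[R]_n => y 0 i) t dflow dc.
  move/(congr1 (fun f : R -> R => f 1)) => /=.
  rewrite [X in _ = X]diff_partial// (bigD1 i)//= partial_coord eqxx mul1r big1 ?addr0; last first.
    by move=> k /negbTE ki; rewrite partial_coord ki mul0r.
  move=> <-; have [_ <-] := de i.
  rewrite deriveE//; congr ('d _ _ _); apply/funext => s /=.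
  by rewrite mxE.
apply: DeriveDef.
  apply/diff_derivable.
  exact: (@differentiable_comp _ _ _ _ (fun s => flow s x) h).
rewrite deriveE; last exact: (@differentiable_comp _ _ _ _ (fun s => flow s x) h).
rewrite (@diff_comp _ _ _ _ (fun s => flow s x) h)//= diff_partial//.
by apply: eq_bigr => i _; rewrite dflowE mulrC.
Qed.

Lemma continuous_flow h x (t : R) : differentiable h (flow t x) ->
  {for t, continuous (fun s => h (flow s x))}.
Proof.
move=> /is_derive_flow[dh _].
by apply/differentiable_continuous/derivable1_diffP.
Qed.

(* [Tint mu h] solves [\sum_j lam j * x_j * D_j u = mu * u + h]: along the flow
   the equation is linear in one variable. *)
Definition orb (mu : R) h x (t : R) : R := expR (- (mu * t)) * h (flow t x).

Definition Tint mu h x : R := - half_int (orb mu h x).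

(* The integral defining [Tint mu h] and its k-fold derivatives converge; each
   derivative commutes with the flow at the price of [mu - lam i] for [mu]. *)
Fixpoint adm (k : nat) S (mu : R) h : Prop :=
  (exists C, forall x t, S x -> 0 <= t -> `|orb mu h x t| <= C * expR (- (1 * t))) /\
  if k is k'.+1 then forall i, adm k' S (mu - lam i) (partial i h) else True.

Lemma adm_bound k S mu h : adm k S mu h ->
  exists C, forall x t, S x -> 0 <= t -> `|orb mu h x t| <= C * expR (- (1 * t)).
Proof. by case: k => [[]|k []]. Qed.

Variable S : set 'rV[R]_n.
Hypothesis oS : open S.
Hypothesis flowS : forall t x, 0 <= t -> S x -> S (flow t x).

Lemma decaying_orb mu h C x : smooth_on S h -> S x ->
  (forall x t, S x -> 0 <= t -> `|orb mu h x t| <= C * expR (- (1 * t))) ->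
  decaying 1 C (orb mu h x).
Proof.
move=> sh Sx bC; split=> t t0; last exact: bC.
apply: (@continuousM _ _ (fun t => expR (- (mu * t))) (fun t => h (flow t x))).
  exact: continuous_expRM.
by apply: continuous_flow; apply: (smooth_differentiable sh); exact: flowS.
Qed.

Lemma differentiable_orb mu h (t : R) x : 0 <= t -> smooth_on S h -> S x ->
  differentiable (fun y => orb mu h y t) x.
Proof.
move=> t0 sh Sx; apply: differentiableM; first exact: differentiable_cst.
by apply: differentiable_flow; apply: (smooth_differentiable sh); exact: flowS.
Qed.

Lemma partial_orb mu h (t : R) x i : 0 <= t -> smooth_on S h -> S x ->
  partial i (fun y => orb mu h y t) x = orb (mu - lam i) (partial i h) x t.
Proof.
move=> t0 sh Sx.
have dh := smooth_differentiable sh (flowS t0 Sx).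
rewrite partialZ; last exact: differentiable_flow.
rewrite partial_flow// /orb mulrA -expRD; congr (expR _ * _).
by rewrite mulrBl; ring.
Qed.

(** Differentiation under the integral sign: for each [t] the second order Taylor estimate of
    [orb mu h] holds with a constant proportional to [expR (- (1 * t))], and [half_int_bound]
    integrates it. The second derivatives in that estimate are the reason for [adm 2]. *)
Lemma Tint_quad mu h x : smooth_on S h -> adm 2 S mu h -> S x ->
  exists C d, [/\ 0 < d, forall v, `|v| < d -> S (x + v) & forall v, `|v| < d ->
    `|Tint mu h (x + v) - Tint mu h x -
      \sum_i Tint (mu - lam i) (partial i h) x * v 0 i| <= C * `|v| ^+ 2].
Proof.
move=> sh [[C0 bC0] /= ah] Sx.
have [d d0 dS] : exists2 d : R, 0 < d & ball x d `<=` S.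
  by have /nbhs_ballP[d d0 dS] := open_nbhs_nbhs (conj oS Sx); exists d.
have {}bC1 i : exists C, forall x t, S x -> 0 <= t ->
    `|orb (mu - lam i) (partial i h) x t| <= C * expR (- (1 * t)).
  by have [] := ah i.
have /choice[C1 {}bC1] := bC1.
have bC2 (ij : 'I_n * 'I_n) : exists C, forall x t, S x -> 0 <= t ->
    `|orb (mu - lam ij.1 - lam ij.2) (partial ij.2 (partial ij.1 h)) x t| <= C * expR (- (1 * t)).
  by case: ij => i j; have [_ /(_ j)[]] := ah i.
have /choice[C2 {}bC2] := bC2.
(* A finite sum of absolute values serves as a common bound in place of a maximum over the indices;
   the same device recurs below. *)
pose C := \sum_ij `|C2 ij|.
have CC2 ij : C2 ij <= C.
  rewrite (le_trans (ler_norm _))// /C (bigD1 ij)//= lerDl.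
  exact: sumr_ge0.
exists (n%:R * (n%:R * C)), d; split=> // v vd; first exact/dS/ball_row_norm.
have Sxv : S (x + v) by exact/dS/ball_row_norm.
have dx := decaying_orb sh Sx bC0; have dxv := decaying_orb sh Sxv bC0.
have d1 i := decaying_orb (smooth_partial i sh) Sx (bC1 i).
(* The Taylor remainder of the integrand, written as a linear combination of decaying functions so
   that its integral splits. *)
pose psi t := orb mu h (x + v) t + (-1 * orb mu h x t) +
  -1 * \sum_i v 0 i * orb (mu - lam i) (partial i h) x t.
have dsum := decaying_sum (index_enum 'I_n) (fun i => decayingZ (v 0 i) (d1 i)).
have intE : half_int psi = half_int (orb mu h (x + v)) - half_int (orb mu h x)
    - \sum_i v 0 i * half_int (orb (mu - lam i) (partial i h) x).
  rewrite /psi (half_intD ltr01 ltr01 (decayingD dxv (decayingZ (-1) dx)) (decayingZ (-1) dsum)).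
  rewrite (half_intD ltr01 ltr01 dxv (decayingZ (-1) dx)) (half_intZ (-1) ltr01 dx).
  rewrite (half_intZ (-1) ltr01 dsum) (half_int_sum _ ltr01 (fun i => decayingZ (v 0 i) (d1 i))).
  rewrite !mulN1r; congr (_ - _); apply: eq_bigr => i _.
  by rewrite (half_intZ (v 0 i) ltr01 (d1 i)).
have -> : Tint mu h (x + v) - Tint mu h x -
      \sum_i Tint (mu - lam i) (partial i h) x * v 0 i = - half_int psi.
  rewrite intE /Tint !opprB opprK addrC; congr (_ + _); last by rewrite addrC.
  by rewrite -sumrN; apply: eq_bigr => i _; rewrite mulNr opprK mulrC.
rewrite normrN -[leRHS]divr1; apply: half_int_bound => //.
have [cpsi _] : decaying 1 _ psi := decayingD (decayingD dxv (decayingZ (-1) dx)) (decayingZ (-1) dsum).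
split=> // t t0.
have -> : psi t = orb mu h (x + v) t - orb mu h x t -
    \sum_i partial i (fun y => orb mu h y t) x * v 0 i.
  rewrite /psi !mulN1r; congr (_ - _); apply: eq_bigr => i _.
  by rewrite mulrC (partial_orb mu i t0 sh Sx).
have d1y y : ball x d y -> forall i, partial i (fun y => orb mu h y t) y = orb (mu - lam i) (partial i h) y t.
  by move=> /dS Sy i; exact: (partial_orb mu i t0 sh Sy).
have near1 y : ball x d y -> forall i, \forall z \near y,
    orb (mu - lam i) (partial i h) z t = partial i (fun y => orb mu h y t) z.
  move=> yd i; have : \forall z \near y, ball x d z.
    by apply: open_nbhs_nbhs; split=> //; exact: ball_open.
  by apply: filterS => z /d1y ->.
rewrite (le_trans (taylor2_ball (C := C * expR (- (1 * t))) vd _ _ _))//.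
- by move=> y /dS Sy; exact: differentiable_orb.
- move=> y i yd; apply: near_eq_differentiable (near1 _ yd i) _.
  exact: (differentiable_orb _ t0 (smooth_partial i sh) (dS _ yd)).
- move=> y i j yd; rewrite -(near_eq_partial j (near1 _ yd i)).
  rewrite (partial_orb _ j t0 (smooth_partial i sh) (dS _ yd)).
  rewrite (le_trans (bC2 (i, j) _ _ (dS _ yd) t0))// ler_wpM2r ?expR_ge0//.
- by rewrite le_eqVlt; apply/orP; left; apply/eqP; ring.
Qed.

Lemma Tint_partial mu h x i : smooth_on S h -> adm 2 S mu h -> S x ->
  differentiable (Tint mu h) x /\
  partial i (Tint mu h) x = Tint (mu - lam i) (partial i h) x.
Proof.
move=> sh ah Sx; have [C [d [d0 _ bT]]] := Tint_quad sh ah Sx.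
have [dT TE] := differentiable_quad d0 bT.
by split.
Qed.

Lemma Tint_smooth mu h : smooth_on S h -> (forall k, adm k S mu h) ->
  smooth_on S (Tint mu h).
Proof.
move=> sh ah k; elim: k mu h sh ah => [|k IH] mu h sh ah.
  move=> x Sx; apply: differentiable_continuous.
  have [C [d [d0 _ bT]]] := Tint_quad sh (ah 2%N) Sx.
  by have [] := differentiable_quad d0 bT.
split.
  move=> x Sx; have [C [d [d0 _ bT]]] := Tint_quad sh (ah 2%N) Sx.
  by have [] := differentiable_quad d0 bT.
move=> i; apply: (@Ck_ext _ _ _ _ (Tint (mu - lam i) (partial i h))) => //.
  by move=> x Sx; rewrite (Tint_partial i sh (ah 2%N) Sx).2.
apply: IH; first exact: smooth_partial.
by move=> m; have [_] := ah m.+1; exact.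
Qed.

(** The integrand decays, so the integral of its time derivative is minus its value at time 0,
    namely [- h x]. That derivative consists of [- mu] times the integrand and of the derivative
    along the flow, whose summands are the integrands of the partial derivatives of [Tint mu h] by
    [Tint_partial]. *)
Lemma Tint_eq mu h x : smooth_on S h -> adm 2 S mu h -> S x ->
  \sum_i lam i * x 0 i * partial i (Tint mu h) x = mu * Tint mu h x + h x.
Proof.
move=> sh ah Sx.
have [[C0 bC0] /= a1] := ah.
have {}bC1 i : exists C, forall x t, S x -> 0 <= t ->
    `|orb (mu - lam i) (partial i h) x t| <= C * expR (- (1 * t)).
  by have [] := a1 i.
have /choice[C1 {}bC1] := bC1.
have dx := decaying_orb sh Sx bC0.
have d1 i := decaying_orb (smooth_partial i sh) Sx (bC1 i).
have dsum := decaying_sum (index_enum 'I_n) (fun i => decayingZ (lam i * x 0 i) (d1 i)).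
pose dphi t := (- mu) * orb mu h x t +
  \sum_i lam i * x 0 i * orb (mu - lam i) (partial i h) x t.
have ddphi := decayingD (decayingZ (- mu) dx) dsum.
have der (t : R) : 0 <= t -> is_derive t 1 (orb mu h x) (dphi t).
  move=> t0; have h1 := is_derive_flow (smooth_differentiable sh (flowS t0 Sx)).
  have h2 := is_derive_expRM mu t.
  have h3 : is_derive t 1 (fun s : R => expR (- (mu * s))) (- mu * expR (- (mu * t))).
    have h3 := is_deriveN h2.
    have h4 : is_derive t 1 (- (fun s : R => - expR (- (mu * s)))) (- mu * expR (- (mu * t))).
      by apply: (is_derive_eq h3); rewrite mulNr.
    by rewrite (_ : (fun s : R => _) = - (fun s : R => - expR (- (mu * s))))//;
       apply/funext => s; rewrite fctE opprK.
  have h4 := is_deriveM h3 h1; apply: (is_derive_eq h4).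
  rewrite /dphi /GRing.scale /= addrC; congr (_ + _); first by rewrite /orb; ring.
  rewrite mulr_sumr; apply: eq_bigr => i _; rewrite mxE /orb.
  rewrite (_ : - ((mu - lam i) * t) = - (mu * t) + lam i * t); last by ring.
  by rewrite expRD; ring.
have := half_int_derive der dx ddphi.
rewrite (half_intD ltr01 ltr01 (decayingZ (- mu) dx) dsum) (half_intZ (- mu) ltr01 dx).
rewrite (half_int_sum _ ltr01 (fun i => decayingZ (lam i * x 0 i) (d1 i))).
rewrite {3}/orb mulr0 oppr0 expR0 mul1r flow0 => intE.
under eq_bigr do rewrite (Tint_partial _ sh ah Sx).2 /Tint mulrN
  -(half_intZ _ ltr01 (d1 _)).
by rewrite sumrN /Tint; lra.
Qed.

End linear_flow.

(** * Locality of smoothness and bounds on compact sets *)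

Section boundedness.
Context {R : realType} {n : nat}.
Implicit Types (x v : 'rV[R]_n) (f g h : 'rV[R]_n -> R) (U : set 'rV[R]_n).

Lemma Ck_local k U f :
  (forall x, U x -> exists2 W : set 'rV[R]_n, W x & Ck_on k W f) -> Ck_on k U f.
Proof.
elim: k f => [|k IH] f /= H; first by move=> x /H[W Wx]; exact.
split; first by move=> x /H[W Wx [df _]]; exact: df.
by move=> i; apply: IH => x /H[W Wx [_ Cf]]; exists W.
Qed.

Lemma smooth_local U f :
  (forall x, U x -> exists2 W : set 'rV[R]_n, W x & smooth_on W f) -> smooth_on U f.
Proof.
move=> H k; apply: Ck_local => x /H[W Wx sW]; exists W => //; exact: sW.
Qed.

Lemma compact_norm_le (r : R) : compact [set x : 'rV[R]_n | `|x| <= r].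
Proof.
apply: bounded_closed_compact.
  exists r; split; first exact: num_real.
  by move=> M rM x /= xr; rewrite (le_trans xr)// ltW.
rewrite (_ : [set x | _] = (fun x : 'rV[R]_n => `|x|) @^-1` [set t | t <= r])//.
apply: closed_comp; last exact: closed_le.
by move=> x _; exact: norm_continuous.
Qed.

Lemma bounded_on_compact (A : set 'rV[R]_n) f : compact A ->
  (forall x, A x -> {for x, continuous f}) ->
  exists C : R, forall x, A x -> `|f x| <= C.
Proof.
move=> cA cf; have [A0|A0] := pselect (A !=set0); last first.
  by exists 0 => x Ax; exfalso; apply: A0; exists x.
have cnf : {within A, continuous (fun x => `|f x|)}.
  apply: continuous_in_subspaceT => x; rewrite inE => Ax.
  by apply: (@continuous_comp _ _ _ f); [exact: cf|exact: norm_continuous].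
have [c _ cmax] := EVT_max_rV A0 cA cnf.
by exists `|f c| => x Ax; apply: cmax; rewrite inE.
Qed.

Lemma bounded_ball f (r : R) : smooth_on setT f ->
  exists C : R, forall x, `|x| <= r -> `|f x| <= C.
Proof.
move=> sf; have [|C bC] := @bounded_on_compact _ f (compact_norm_le (r := r)).
  by move=> x _; exact/differentiable_continuous/(smooth_differentiable sf).
by exists C => x xr; exact: bC.
Qed.

End boundedness.

(** * Hadamard's lemma and the order of vanishing at the origin *)

Section hadamard.
Context {R : realType} {n : nat}.
Implicit Types (x v : 'rV[R]_n) (f g h : 'rV[R]_n -> R).

Notation smth f := (smooth_on setT f).

(* For the inward radial flow, [Tint] is the integral of Hadamard's lemma after
   the substitution [s = expR (- t)]. *)
Definition radial (i : 'I_n) : R := -1.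

Lemma flow_radial t x : flow radial t x = expR (- t) *: x.
Proof. by apply/rowP => i; rewrite !mxE mulN1r. Qed.

Lemma flow_radial_ball (r : R) t x : 0 <= t -> ball (0 : 'rV[R]_n) r x ->
  ball (0 : 'rV[R]_n) r (flow radial t x).
Proof.
move=> t0; rewrite -ball_normE /= !sub0r !normrN flow_radial normrZ.
rewrite ger0_norm ?expR_ge0// => xr; rewrite (le_lt_trans _ xr)// ler_piMl//.
by rewrite -expR0 ler_expR oppr_le0.
Qed.

(** The inward radial flow keeps a ball inside itself, and a smooth function is bounded there, so
    the factor [expR (- (mu * t))] alone gives convergence. Each derivative raises the exponent by
    one, which preserves [1 <= mu]. *)
Lemma adm_radial k (r mu : R) f : 1 <= mu -> smth f ->
  adm radial k (ball (0 : 'rV[R]_n) r) mu f.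
Proof.
move=> mu1 sf; elim: k mu f mu1 sf => [|k IH] mu f mu1 sf /=; (split; last first).
- by [].
- have [C bC] := bounded_ball r sf; exists C => x t xr t0.
  rewrite /orb normrM ger0_norm ?expR_ge0// mulrC ler_pM ?expR_ge0//.
    by apply: bC; have := flow_radial_ball t0 xr;
       rewrite -ball_normE /= sub0r normrN => /ltW.
  by rewrite ler_expR lerN2 ler_wpM2r.
- by move=> i; apply: IH; [rewrite /radial; lra|exact: smooth_partial].
- have [C bC] := bounded_ball r sf; exists C => x t xr t0.
  rewrite /orb normrM ger0_norm ?expR_ge0// mulrC ler_pM ?expR_ge0//.
    by apply: bC; have := flow_radial_ball t0 xr;
       rewrite -ball_normE /= sub0r normrN => /ltW.
  by rewrite ler_expR lerN2 ler_wpM2r.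
Qed.

Let in_ball x : ball (0 : 'rV[R]_n) (`|x| + 1) x.
Proof. by rewrite -ball_normE /= sub0r normrN ltrDl. Qed.

Let radial_ball (r : R) := @flow_radial_ball r.

Lemma smooth_Tint_radial (mu : R) f : 1 <= mu -> smth f -> smth (Tint radial mu f).
Proof.
move=> mu1 sf; apply: smooth_local => x _; exists (ball 0 (`|x| + 1)) => //.
apply: (Tint_smooth (lam := radial)).
- exact: ball_open.
- exact: radial_ball.
- exact: smooth_sub sf.
- by move=> k; exact: adm_radial.
Qed.

Lemma partial_Tint_radial (mu : R) f i : 1 <= mu -> smth f ->
  partial i (Tint radial mu f) = Tint radial (mu + 1) (partial i f).
Proof.
move=> mu1 sf; apply/funext => x.
rewrite (_ : mu + 1 = mu - radial i); last by rewrite /radial opprK.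
apply: (Tint_partial (S := ball 0 (`|x| + 1)) _ _ _ _ (adm_radial _ _ _ _) _).2 => //.
- exact: ball_open.
- exact: radial_ball.
- exact: smooth_sub sf.
Qed.

(** This is [Tint_eq] for the radial flow with exponent 0, together with the formula for the partial
    derivatives of [Tint radial 0 f]. With exponent 0 the convergence comes from [f 0 = 0]: the
    function is Lipschitz on the ball, hence decays along the flow like [expR (- t)]. *)
Lemma hadamard f : smth f -> f 0 = 0 ->
  forall x, f x = \sum_i x 0 i * - Tint radial 1 (partial i f) x.
Proof.
move=> sf f0 x; set r := `|x| + 1.
have a0 : adm radial 2 (ball (0 : 'rV[R]_n) r) 0 f.
  split; last first.
    move=> i; have := adm_radial 1 r (lexx 1) (smooth_partial i sf).
    by rewrite (_ : 0 - radial i = 1)// /radial opprK add0r.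
  have bp i : exists C, forall y, `|y| <= r -> `|partial i f y| <= C.
    exact: bounded_ball (smooth_partial i sf).
  have /choice[C bC] := bp; pose K := \sum_i `|C i|.
  exists (n%:R * (K * r)) => y t yr t0.
  have yr' : `|y| < r by move: yr; rewrite -ball_normE /= sub0r normrN.
  have fr : `|flow radial t y| < r.
    by have := radial_ball t0 yr; rewrite -ball_normE /= sub0r normrN.
  rewrite /orb mul0r oppr0 expR0 mul1r mul1r.
  have := @lipschitz_ball _ _ f 0 (flow radial t y) K r fr _ _.
  rewrite add0r f0 subr0 => /(_ _ _)/le_trans; apply.
  - by move=> z _; exact: (smooth_differentiable sf).
  - move=> z i; rewrite -ball_normE /= sub0r normrN => /ltW zr.
    rewrite (le_trans (bC i z zr))// (le_trans (ler_norm _))//.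
    by rewrite /K (bigD1 i)//= lerDl sumr_ge0.
  - rewrite -!mulrA ler_wpM2l// ler_wpM2l ?sumr_ge0// mulrC.
    by rewrite flow_radial normrZ ger0_norm ?expR_ge0// ler_wpM2l ?expR_ge0 ?ltW.
have := @Tint_eq _ _ radial (ball 0 r) (ball_open _ _) (@radial_ball r) 0 f x
  (smooth_sub (@subsetT _ _) sf) a0 (in_ball x).
rewrite mul0r add0r => <-; apply: eq_bigr => i _.
rewrite (Tint_partial (S := ball 0 r) (ball_open _ _) (@radial_ball r) i (smooth_sub (@subsetT _ _) sf) a0 (in_ball x)).2.
have -> : 0 - radial i = 1 by rewrite /radial opprK add0r.
by rewrite /radial; ring.
Qed.

(** For smooth functions this is membership in the [d]-th power of the ideal of functions vanishing
    at the origin. The recursion along partial derivatives replaces Taylor polynomials and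
    multi-indices; having it for all [d] is flatness at the origin. *)
Fixpoint vanish (d : nat) f : Prop :=
  if d is d'.+1 then f 0 = 0 /\ forall i, vanish d' (partial i f) else True.

Lemma vanishW d f : vanish d.+1 f -> vanish d f.
Proof. by elim: d f => [|d IH] f //= [f0 vf]; split=> // i; apply: IH; exact: vf. Qed.

Lemma vanish_le d e f : (d <= e)%N -> vanish e f -> vanish d f.
Proof.
move=> /subnK <-; elim: (e - d)%N => [|k IH] //.
by rewrite addSn => /vanishW.
Qed.

Lemma vanish_ext (U : set 'rV[R]_n) d f g : open U -> U 0 ->
  (forall x, U x -> f x = g x) -> vanish d f -> vanish d g.
Proof.
move=> oU U0; elim: d f g => //= d IH f g fg [f0 vf].
split; first by rewrite -fg.
move=> i; apply: IH (vf i) => x Ux; apply: near_eq_partial.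
by apply: filterS (open_nbhs_nbhs (conj oU Ux)) => y /fg.
Qed.

Lemma vanish0 d : vanish d (fun=> 0).
Proof.
elim: d => //= d IH; split=> // i.
by rewrite (_ : partial i _ = fun=> 0)//; apply/funext => x; rewrite partial_cst.
Qed.

Lemma vanishD d f g : smth f -> smth g -> vanish d f -> vanish d g ->
  vanish d (fun x => f x + g x).
Proof.
elim: d f g => //= d IH f g sf sg [f0 vf] [g0 vg].
split=> [|i]; first by rewrite f0 g0 addr0.
rewrite (_ : partial i _ = fun x => partial i f x + partial i g x).
  by apply: IH => //; exact: smooth_partial.
by apply/funext => x; rewrite partialD//; exact: (smooth_differentiable (U := setT)).
Qed.

Lemma vanishZ d a f : smth f -> vanish d f -> vanish d (fun x => a * f x).
Proof.
elim: d f => //= d IH f sf [f0 vf]; split=> [|i]; first by rewrite f0 mulr0.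
rewrite (_ : partial i _ = fun x => a * partial i f x).
  by apply: IH => //; exact: smooth_partial.
by apply/funext => x; rewrite partialZ//; exact: (smooth_differentiable (U := setT)).
Qed.

Lemma vanishB d f g : smth f -> smth g -> vanish d f -> vanish d g ->
  vanish d (fun x => f x - g x).
Proof.
move=> sf sg vf vg; rewrite (_ : (fun x => _) = fun x => f x + -1 * g x).
  by apply: vanishD => //; [apply: smoothZ => //; exact: openT|exact: vanishZ].
by apply/funext => x; rewrite mulN1r.
Qed.

Lemma vanish_sum d (I : finType) (F : I -> 'rV[R]_n -> R) :
  (forall i, smth (F i)) -> (forall i, vanish d (F i)) ->
  vanish d (fun x => \sum_i F i x).
Proof.
move=> sF vF; suff H : forall s : seq I, smth (fun x => \sum_(i <- s) F i x) /\
  vanish d (fun x => \sum_(i <- s) F i x) by have [] := H (index_enum I).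
elim=> [|i s [ss vs]].
  rewrite (_ : (fun x => _) = fun=> 0); last by apply/funext => x; rewrite big_nil.
  by split; [exact: smooth_cst|exact: vanish0].
rewrite (_ : (fun x => _) = fun x => F i x + \sum_(j <- s) F j x).
  by split; [apply: smoothD => //; exact: openT|exact: vanishD].
by apply/funext => x; rewrite big_cons.
Qed.

(** By Leibniz' rule. The order [m] is kept separate from [d + e] because a factor of order 0 cannot
    lose an order when it is differentiated; the inequality absorbs this case of the induction. *)
Lemma vanishM d e m f g : (m <= d + e)%N -> smth f -> smth g ->
  vanish d f -> vanish e g -> vanish m (fun x => f x * g x).
Proof.
elim: m d e f g => //= m IH d e f g mde sf sg vf vg; split.
  case: d mde vf => [|d] mde; last by case=> -> _; rewrite mul0r.
  by move=> _; case: e mde vg => [|e] // _ [-> _]; rewrite mulr0.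
move=> i; rewrite (_ : partial i _ =
    fun x => partial i f x * g x + f x * partial i g x); last first.
  by apply/funext => x; rewrite partialM//; exact: (smooth_differentiable (U := setT)).
have [sfi sgi] := (smooth_partial i sf, smooth_partial i sg).
have vp k h : vanish k h -> vanish k.-1 (partial i h) by case: k => //= k [].
apply: vanishD.
- by apply: smoothM => //; exact: openT.
- by apply: smoothM => //; exact: openT.
- apply: (IH d.-1 e) => //; last exact: vp.
  by case: d mde {vf} => //= mde; rewrite ltnW.
- apply: (IH d e.-1) => //; last exact: vp.
  by case: e mde {vg} => [|e]; rewrite ?addn0 ?addnS//= => mde; rewrite ltnW.
Qed.

Lemma vanish_coord i : vanish 1 (fun x => x 0 i).
Proof. by split=> //; rewrite mxE. Qed.

Lemma vanish_Tint_radial d (mu : R) f : 1 <= mu -> smth f -> vanish d f ->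
  vanish d (Tint radial mu f).
Proof.
elim: d mu f => //= d IH mu f mu1 sf [f0 vf]; split.
  rewrite /Tint (_ : orb _ _ _ _ = fun t => 0 * 0).
    by rewrite (half_intZ 0 ltr01 (decaying0 1)) mul0r oppr0.
  by apply/funext => t; rewrite /orb flow_radial scaler0 f0 !mulr0.
move=> i; rewrite partial_Tint_radial//; apply: IH => //.
  by rewrite (le_trans mu1)// lerDl.
exact: smooth_partial.
Qed.

(** Division by the coordinates costs one order of vanishing. It drives the inductions on the order
    in [vanish_bound] and on the degree in [solve_homological]. *)
Lemma vanish_hadamard d f : smth f -> vanish d.+1 f ->
  exists g : 'I_n -> 'rV[R]_n -> R,
  [/\ forall i, smth (g i), forall i, vanish d (g i) &
      f = fun x => \sum_i x 0 i * g i x].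
Proof.
move=> sf [f0 vf]; exists (fun i x => - Tint radial 1 (partial i f) x).
have sT i : smth (Tint radial 1 (partial i f)).
  by apply: smooth_Tint_radial => //; exact: smooth_partial.
split=> [i|i|].
- by apply: smoothN => //; exact: openT.
- rewrite (_ : (fun x => _) = fun x => -1 * Tint radial 1 (partial i f) x).
    apply: vanishZ => //; apply: vanish_Tint_radial => //; last exact: vf.
    exact: smooth_partial.
  by apply/funext => x; rewrite mulN1r.
- by apply/funext => x; exact: hadamard.
Qed.

Lemma vanish_bound d f (r : R) : smth f -> vanish d f ->
  exists C, forall x, `|x| <= r -> `|f x| <= C * wt xpredT x ^+ d.
Proof.
elim: d f => [|d IH] f sf vf.
  by have [C bC] := bounded_ball r sf; exists C => x /bC; rewrite expr0 mulr1.
have [g [sg vg fE]] := vanish_hadamard sf vf.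
have /choice[C bC] : forall i, exists C, forall x, `|x| <= r -> `|g i x| <= C * wt xpredT x ^+ d.
  by move=> i; exact: IH.
exists (\sum_i `|C i|) => x xr; rewrite fE (le_trans (ler_norm_sum _ _ _))//.
rewrite mulr_suml; apply: ler_sum => i _; rewrite normrM exprS mulrCA.
rewrite ler_pM//; first exact: le_wt.
rewrite (le_trans (bC i x xr))// ler_wpM2r ?exprn_ge0 ?wt_ge0//.
exact: ler_norm.
Qed.

End hadamard.

(** * Removing a remainder that is flat along the unstable directions *)

Section tame_sequences.
Context {R : realType} {n : nat}.
Implicit Types (x v : 'rV[R]_n) (f g h : nat -> 'rV[R]_n -> R) (U : set 'rV[R]_n)
  (rho : 'rV[R]_n -> R).

(* [rho] measures the order of vanishing: the bounds hold with every power of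
   it, and [rho = 1] gives plain boundedness. *)
Definition decay U rho h : Prop := forall N, exists2 C : R, 0 <= C &
  forall j x, U x -> `|h j x| <= C * rho x ^+ N /\
    `|h j.+1 x - h j x| <= C * 2^-1 ^+ j * rho x ^+ N.

(** Geometric convergence of all derivatives up to order [k], with bounds on all of [U]; for every
    [k] it makes the limit smooth ([flim_smooth]). A constant sequence [fun=> h] is covered as well:
    tameness then says that [h] and its derivatives are flat for [rho], so the same closure lemmas
    serve functions and sequences. *)
Fixpoint tame k U rho h : Prop :=
  decay U rho h /\
  if k is k'.+1 then (forall j x, U x -> differentiable (h j) x) /\
    forall i, tame k' U rho (fun j => partial i (h j))
  else True.

Definition one_wt : 'rV[R]_n -> R := fun=> 1.

Lemma tame_decay k U rho h : tame k U rho h -> decay U rho h.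
Proof. by case: k => [[]|k []]. Qed.

Lemma tameW k U rho h : tame k.+1 U rho h -> tame k U rho h.
Proof.
elim: k h => [|k IH] h /= [dh [Dh th]]; first by split.
by split=> //; split=> // i; apply: IH; exact: th.
Qed.

Lemma decay_ext U rho f g : (forall j x, U x -> f j x = g j x) ->
  decay U rho f -> decay U rho g.
Proof.
move=> fg df N; have [C C0 bC] := df N; exists C => // j x Ux.
by rewrite -!fg//; exact: bC.
Qed.

Lemma tame_ext k U rho f g : open U -> (forall j x, U x -> f j x = g j x) ->
  tame k U rho f -> tame k U rho g.
Proof.
move=> oU; elim: k f g => [|k IH] f g fg /=.
  by move=> [df _]; split=> //; exact: decay_ext df.
move=> [df [Df tf]]; split; first exact: decay_ext df.
have nfg j x : U x -> \forall y \near x, f j y = g j y.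
  by move=> Ux; apply: filterS (open_nbhs_nbhs (conj oU Ux)) => y; exact: fg.
split=> [j x Ux|i]; first exact: near_eq_differentiable (nfg j x Ux) (Df j x Ux).
by apply: IH (tf i) => j x Ux; apply: near_eq_partial; exact: nfg.
Qed.

Lemma tame_one k U rho h : tame k U rho h -> tame k U one_wt h.
Proof.
have dd g : decay U rho g -> decay U one_wt g.
  move=> /(_ 0%N)[C C0 bC] N; exists C => // j x Ux.
  by have := bC j x Ux; rewrite !expr0 expr1n !mulr1.
elim: k h => [|k IH] h /=; first by move=> [/dd dh _].
by move=> [/dd dh [Dh th]]; split=> //; split=> // i; exact: IH.
Qed.

Lemma decayD U rho f g : (forall x, U x -> 0 <= rho x) -> decay U rho f -> decay U rho g ->
  decay U rho (fun j x => f j x + g j x).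
Proof.
move=> rho0 df dg N; have [C C0 bC] := df N; have [D D0 bD] := dg N.
exists (C + D) => [|j x Ux]; first exact: addr_ge0.
have [c1 c2] := bC j x Ux; have [d1 d2] := bD j x Ux.
split; first by rewrite mulrDl (le_trans (ler_normD _ _))// lerD.
rewrite opprD addrACA (le_trans (ler_normD _ _))//.
by rewrite !mulrDl lerD.
Qed.

Lemma tameD k U rho f g : open U -> (forall x, U x -> 0 <= rho x) ->
  tame k U rho f -> tame k U rho g ->
  tame k U rho (fun j x => f j x + g j x).
Proof.
move=> oU rho0; elim: k f g => [|k IH] f g /=.
  by move=> [df _] [dg _]; split=> //; exact: decayD.
move=> [df [Df tf]] [dg [Dg tg]]; split; first exact: decayD.
split=> [j x Ux|i]; first by apply: differentiableD; [exact: Df|exact: Dg].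
apply: tame_ext (IH _ _ (tf i) (tg i)) => // j x Ux.
by rewrite partialD//; [exact: Df|exact: Dg].
Qed.

Lemma decayM U rho f g : (forall x, U x -> 0 <= rho x) ->
  decay U one_wt f -> decay U rho g ->
  decay U rho (fun j x => f j x * g j x).
Proof.
move=> rho0 df dg N; have [C C0 bC] := df 0%N; have [D D0 bD] := dg N.
exists (C * D + C * D) => [|j x Ux]; first by rewrite addr_ge0// mulr_ge0.
have := bC j x Ux; rewrite expr0 !mulr1 => -[c1 c2].
have [c1' _] := bC j.+1 x Ux; rewrite expr0 mulr1 in c1'.
have [d1 d2] := bD j x Ux.
have rN : 0 <= rho x ^+ N by rewrite exprn_ge0 ?rho0.
have h0 : 0 <= 2^-1 ^+ j :> R by rewrite exprn_ge0.
split.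
  rewrite normrM (@le_trans _ _ (C * D * rho x ^+ N))//.
    by rewrite -mulrA ler_pM.
  by rewrite ler_wpM2r// lerDl mulr_ge0.
have -> : f j.+1 x * g j.+1 x - f j x * g j x =
    f j.+1 x * (g j.+1 x - g j x) + (f j.+1 x - f j x) * g j x by ring.
rewrite (le_trans (ler_normD _ _))// !normrM.
rewrite (@le_trans _ _ (C * (D * 2^-1 ^+ j * rho x ^+ N) + (C * 2^-1 ^+ j) * (D * rho x ^+ N)))//.
  by rewrite lerD// ler_pM// ?mulr_ge0.
by rewrite le_eqVlt; apply/orP; left; apply/eqP; ring.
Qed.

(** One flat factor is enough, the other one only has to be bounded with its derivatives, hence
    [one_wt]. This is how entries of a Jacobian, which do not vanish with [rho], multiply flat
    terms. *)
Lemma tameM k U rho f g : open U -> (forall x, U x -> 0 <= rho x) ->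
  tame k U one_wt f -> tame k U rho g ->
  tame k U rho (fun j x => f j x * g j x).
Proof.
move=> oU rho0; elim: k f g => [|k IH] f g.
  by move=> [df _] [dg _]; split=> //; exact: decayM.
move=> tf tg; have [df [Df tpf]] := tf; have [dg [Dg tpg]] := tg.
split; first exact: decayM.
split=> [j x Ux|i]; first by apply: differentiableM; [exact: Df|exact: Dg].
have t1 := IH _ _ (tpf i) (tameW tg); have t2 := IH _ _ (tameW tf) (tpg i).
apply: tame_ext (tameD oU rho0 t1 t2) => // j x Ux.
by rewrite partialM//; [exact: Df|exact: Dg].
Qed.

Lemma decay_cst U (a : R) : decay U one_wt (fun _ _ => a).
Proof.
move=> N; exists `|a| => // j x Ux; rewrite subrr normr0 expr1n !mulr1.
by split=> //; rewrite mulr_ge0// exprn_ge0.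
Qed.

Lemma decay0 U rho : decay U rho (fun _ _ => 0).
Proof. by move=> N; exists 0 => // j x _; rewrite subrr normr0 !mul0r. Qed.

Lemma tame0 k U rho : tame k U rho (fun _ _ => 0).
Proof.
elim: k => [|k IH]; first by split=> //; exact: decay0.
split; first exact: decay0.
split=> [j x _|i]; first exact: differentiable_cst.
rewrite (_ : (fun _ => _) = (fun _ _ => 0))//.
by apply/funext => j; apply/funext => x; rewrite partial_cst.
Qed.

Lemma tame_cst k U (a : R) : tame k U one_wt (fun _ _ => a).
Proof.
case: k => [|k]; first by split=> //; exact: decay_cst.
split; first exact: decay_cst.
split=> [j x _|i]; first exact: differentiable_cst.
rewrite (_ : (fun _ => _) = (fun _ _ => 0)); first exact: tame0.
by apply/funext => j; apply/funext => x; rewrite partial_cst.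
Qed.

Lemma tame_sum k U rho (I : Type) (r : seq I) (P : pred I) (F : I -> nat -> 'rV[R]_n -> R) :
  open U -> (forall x, U x -> 0 <= rho x) -> (forall i, P i -> tame k U rho (F i)) ->
  tame k U rho (fun j x => \sum_(i <- r | P i) F i j x).
Proof.
move=> oU rho0 tF; elim: r => [|i r IH].
  by apply: tame_ext (tame0 k U rho) => // j x Ux; rewrite big_nil.
case: (boolP (P i)) => Pi.
  by apply: tame_ext (tameD oU rho0 (tF i Pi) IH) => // j x Ux; rewrite big_cons Pi.
by apply: tame_ext IH => // j x Ux; rewrite big_cons (negbTE Pi).
Qed.

Lemma tame_Ck k U rho h j : (forall k, tame k U rho h) -> Ck_on k U (h j).
Proof.
elim: k h => [|k IH] h th.
  by move=> x Ux; apply: differentiable_continuous; have [_ [+ _]] := th 1%N; exact.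
split=> [x Ux|i]; first by have [_ [+ _]] := th 1%N; exact.
by apply: (IH (fun j => partial i (h j))) => m; have [_ [_]] := th m.+1; exact.
Qed.

Lemma tame_smooth U rho h j : (forall k, tame k U rho h) -> smooth_on U (h j).
Proof. by move=> th k; exact: tame_Ck th. Qed.

Lemma geometric_dist (u : nat -> R) (C : R) :
  (forall j, `|u j.+1 - u j| <= C * 2^-1 ^+ j) ->
  forall j m, `|u (j + m)%N - u j| <= C * 2^-1 ^+ j * 2.
Proof.
move=> uC j m.
have C0 : 0 <= C by have := uC 0%N; rewrite expr0 mulr1; exact: le_trans.
(* The exact partial sum of the geometric series, so that the induction on [m] closes. *)
suff : `|u (j + m)%N - u j| <= C * 2^-1 ^+ j * (2 - 2 * 2^-1 ^+ m).
  move=> /le_trans; apply; rewrite ler_wpM2l ?mulr_ge0 ?exprn_ge0//.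
  by rewrite lerBlDr lerDl mulr_ge0// exprn_ge0.
elim: m => [|m IH]; first by rewrite addn0 subrr normr0 expr0 mulr1 subrr mulr0.
rewrite addnS (_ : u _ - u j = (u (j + m).+1 - u (j + m)%N) + (u (j + m)%N - u j)); last by ring.
rewrite (le_trans (ler_normD _ _))// (le_trans (lerD (uC _) IH))//.
rewrite exprD exprS le_eqVlt; apply/orP; left; apply/eqP.
by field.
Qed.

Lemma geometric_cvg (u : nat -> R) (C : R) :
  (forall j, `|u j.+1 - u j| <= C * 2^-1 ^+ j) ->
  u j @[j --> \oo] --> limn u /\ forall j, `|limn u - u j| <= C * 2^-1 ^+ j * 2.
Proof.
move=> uC; have dist := geometric_dist uC.
have half1 : `|2^-1 : R| < 1 by rewrite ger0_norm// invf_lt1// ltr1n.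
have cu : u j @[j --> \oo] --> limn u.
  have cs : cvgn (series (telescope u)).
    apply: normed_cvg; apply: (series_le_cvg _ _ _ (is_cvg_geometric_series (a := C) half1)) => j //=.
      exact: le_trans (uC j).
    exact: uC.
  have -> : u = (fun j => u 0%N + series (telescope u) j).
    by apply/funext => k; exact: eq_sum_telescope.
  apply: (cvgP (u 0%N + limn (series (telescope u)))).
  by apply: cvgD => //; exact: cvg_cst.
split=> // j.
have cd : `|u m - u j| @[m --> \oo] --> `|limn u - u j|.
  by apply: cvg_norm; apply: cvgB => //; exact: cvg_cst.
apply: (cvgr_to_le cd); near=> m.
have jm : (j <= m)%N by near: m; exact: nbhs_infty_ge.
by rewrite -(subnKC jm); exact: dist.
Unshelve. all: by end_near. Qed.

Lemma cvgn_sum (I : Type) (r : seq I) (F : I -> nat -> R) (l : I -> R) :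
  (forall i, F i m @[m --> \oo] --> l i) ->
  \sum_(i <- r) F i m @[m --> \oo] --> \sum_(i <- r) l i.
Proof.
move=> Fl; elim: r => [|i r IH].
  rewrite big_nil (_ : (fun m => _) = fun=> 0); first exact: cvg_cst.
  by apply/funext => m; rewrite big_nil.
rewrite big_cons (_ : (fun m => _) = fun m => F i m + \sum_(j <- r) F j m).
  by apply: cvgD.
by apply/funext => m; rewrite big_cons.
Qed.

Definition flim h x : R := limn (fun j => h j x).

Lemma flim_cvg U rho h x : decay U rho h -> U x ->
  h j x @[j --> \oo] --> flim h x.
Proof.
move=> /(_ 0%N)[C C0 bC] Ux; apply: (geometric_cvg (C := C) _).1 => j.
by have [_] := bC j x Ux; rewrite expr0 mulr1.
Qed.

Lemma flim_bound U rho h N : decay U rho h ->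
  exists2 C : R, 0 <= C & forall x, U x -> `|flim h x| <= C * rho x ^+ N.
Proof.
move=> dh; have [C C0 bC] := dh N; exists C => // x Ux.
have cn : `|h j x| @[j --> \oo] --> `|flim h x|.
  by apply: cvg_norm; exact: flim_cvg dh Ux.
apply: (cvgr_to_le cn); near=> j.
by have [] := bC j x Ux.
Unshelve. all: by end_near. Qed.

(** The second derivatives are bounded uniformly in the index of the sequence, so all terms satisfy
    the Taylor estimate with one constant. It passes to the pointwise limit, where
    [differentiable_quad] applies. *)
Lemma flim_partial U rho h x : open U -> tame 2 U rho h -> U x ->
  differentiable (flim h) x /\ forall i,
  partial i (flim h) x = flim (fun j => partial i (h j)) x.
Proof.
move=> oU th Ux; have [d d0 dU] : exists2 d : R, 0 < d & ball x d `<=` U.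
  by have /nbhs_ballP[d d0 dU] := open_nbhs_nbhs (conj oU Ux); exists d.
have [dh [Dh th1]] := th.
have {}bC2 (ij : 'I_n * 'I_n) : exists C : R, forall m x, U x ->
    `|partial ij.2 (partial ij.1 (h m)) x| <= C.
  have [_ [_ /(_ ij.2)[/(_ 0%N)[C C0 bC] _]]] := th1 ij.1.
  by exists C => m y Uy; have [+ _] := bC m y Uy; rewrite expr0 mulr1.
have /choice[C2 {}bC2] := bC2.
pose C := \sum_ij `|C2 ij|.
have CC2 ij : C2 ij <= C.
  rewrite (le_trans (ler_norm _))// /C (bigD1 ij)//= lerDl.
  exact: sumr_ge0.
have quad v : `|v| < d -> `|flim h (x + v) - flim h x -
    \sum_i flim (fun j => partial i (h j)) x * v 0 i| <= n%:R * (n%:R * C) * `|v| ^+ 2.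
  move=> vd; have Uxv : U (x + v) by exact/dU/ball_row_norm.
  have cl : `|h m (x + v) - h m x - \sum_i partial i (h m) x * v 0 i| @[m --> \oo] -->
      `|flim h (x + v) - flim h x - \sum_i flim (fun j => partial i (h j)) x * v 0 i|.
    apply: cvg_norm; apply: cvgB.
      by apply: cvgB; [exact: flim_cvg dh Uxv|exact: flim_cvg dh Ux].
    apply: cvgn_sum => j; apply: cvgMr_tmp.
    exact: (flim_cvg (th1 j).1 Ux).
  apply: (cvgr_to_le cl); near=> m.
  apply: taylor2_ball vd _ _ _.
  - by move=> y /dU; exact: Dh.
  - by move=> y j /dU; have [_ [+ _]] := th1 j; exact.
  - by move=> y j k /dU Uy; exact: le_trans (bC2 (j, k) m y Uy) (CC2 _).
exact: differentiable_quad d0 quad.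
Unshelve. all: by end_near. Qed.

Lemma flim_smooth U rho h : open U -> (forall k, tame k U rho h) ->
  smooth_on U (flim h).
Proof.
move=> oU th k; elim: k h th => [|k IH] h th.
  move=> x Ux; apply: differentiable_continuous.
  by have [] := flim_partial oU (th 2%N) Ux.
split=> [x Ux|i]; first by have [] := flim_partial oU (th 2%N) Ux.
apply: (@Ck_ext _ _ _ _ (flim (fun j => partial i (h j)))) => //.
  by move=> x Ux; have [_ ->] := flim_partial oU (th 2%N) Ux.
by apply: IH => m; have [_ [_]] := th m.+1; exact.
Qed.

End tame_sequences.

Section weights.
Context {R : realType} {n : nat}.
Implicit Types (x v : 'rV[R]_n) (P : pred 'I_n).

Lemma wtD P x v : wt P (x + v) <= wt P x + wt P v.
Proof.
rewrite /wt -big_split /=; apply: ler_sum => i _; rewrite mxE.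
exact: ler_normD.
Qed.

Lemma continuous_wt P : continuous (wt P : 'rV[R]_n -> R).
Proof.
rewrite /wt; apply: continuous_big; first exact: add_continuous.
move=> i _ x; apply: (@continuous_comp _ _ _ (fun y : 'rV[R]_n => y 0 i)).
  by apply: differentiable_continuous; exact: differentiable_coord.
exact: norm_continuous.
Qed.

Lemma open_wt P (r : R) : open [set x : 'rV[R]_n | wt P x < r].
Proof.
rewrite (_ : [set x | _] = wt P @^-1` [set t | t < r])//.
apply: open_comp; last exact: open_lt.
by move=> x _; exact: continuous_wt.
Qed.

Lemma wt0 P : wt P (0 : 'rV[R]_n) = 0.
Proof. by rewrite /wt big1// => i _; rewrite mxE normr0. Qed.

End weights.

Definition perturb {R : realType} {n : nat} (u : 'I_n -> 'rV[R]_n -> R) (x : 'rV[R]_n) :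
  'rV[R]_n := \row_i (x 0 i + u i x).

(** * Composition of flat functions with perturbations of the identity *)

Section composition.
Context {R : realType} {n : nat}.
Variables (S : set 'rV[R]_n) (rho : 'rV[R]_n -> R).
Hypothesis oS : open S.
Hypothesis rho0 : forall x, 0 <= rho x.

Notation flat U h := (forall k, tame k U rho (fun=> h)).

Lemma flat_partial U h i : flat U h -> flat U (partial i h).
Proof. by move=> fh k; have [_ [_]] := fh k.+1; exact. Qed.

Lemma flat_smooth U h : flat U h -> smooth_on U h.
Proof. by move=> fh; exact: (tame_smooth (h := fun=> h) 0%N). Qed.

Lemma flat_bound U h N : flat U h ->
  exists2 C : R, 0 <= C & forall x, U x -> `|h x| <= C * rho x ^+ N.
Proof.
move=> /(_ 0%N)[/(_ N)[C C0 bC] _]; exists C => // x Ux.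
by have [] := bC 0%N x Ux.
Qed.

Variable u : nat -> 'I_n -> 'rV[R]_n -> R.
Hypothesis rhou : forall j x, S x -> rho (perturb (u j) x) <= 2 * rho x.

Lemma decay_comp h : flat setT h -> (forall i, decay S rho (fun j => u j i)) ->
  decay S rho (fun j x => h (perturb (u j) x)).
Proof.
move=> fh du N.
have [C C0 bC] := flat_bound N fh.
have /choice[D bD] : forall i, exists D : R, forall x, `|partial i h x| <= D.
  move=> i; have [D D0 bD] := flat_bound 0 (flat_partial i fh).
  by exists D => x; rewrite -[D]mulr1 -[1](expr0 (rho x)) bD.
have /choice[K bK] : forall i, exists K : R, forall j x, S x ->
    `|u j.+1 i x - u j i x| <= K * 2^-1 ^+ j * rho x ^+ N.
  by move=> i; have [K K0 bK] := du i N; exists K => j x Sx; have [] := bK j x Sx.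
pose M := \sum_i `|D i| * `|K i|.
have M0 : 0 <= M by apply: sumr_ge0 => i _; rewrite mulr_ge0.
exists (C * 2 ^+ N + M) => [|j x Sx].
  by rewrite addr_ge0// mulr_ge0// exprn_ge0.
have rN : 0 <= rho x ^+ N by rewrite exprn_ge0.
have h0 : 0 <= 2^-1 ^+ j :> R by rewrite exprn_ge0.
split.
  rewrite (le_trans (bC _ I))// mulrDl -[leLHS]addr0 lerD ?mulr_ge0//.
  rewrite -mulrA ler_wpM2l// -exprMn lerXn2r ?nnegrE ?mulr_ge0//.
  exact: rhou.
(* The segment joining the two perturbed points may leave [S]; this is why [h] is flat on the whole
   space. Its gradient is merely bounded along the segment, and the factor [rho x ^+ N] comes from
   the difference of the [u j]. *)
have [|t t01] := @mean_value _ _ h (perturb (u j) x) (perturb (u j.+1) x - perturb (u j) x).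
  by move=> t _; exact: (smooth_differentiable (flat_smooth fh)).
rewrite [perturb (u j) x + _]addrC subrK => ->.
rewrite (@le_trans _ _ (M * 2^-1 ^+ j * rho x ^+ N))//; last first.
  by rewrite ler_wpM2r// ler_wpM2r// lerDr mulr_ge0// exprn_ge0.
rewrite (le_trans (ler_norm_sum _ _ _))// /M !mulr_suml ler_sum// => i _.
rewrite normrM -!mulrA ler_pM//; first by rewrite (le_trans (bD _ _))// ler_norm.
rewrite !mxE opprD addrACA subrr add0r (le_trans (bK i j x Sx))// -mulrA.
by rewrite ler_wpM2r ?mulr_ge0// ler_norm.
Qed.

Lemma differentiable_perturb (v : 'I_n -> 'rV[R]_n -> R) x j :
  (forall i, differentiable (v i) x) -> differentiable (fun y => perturb v y 0 j) x.
Proof.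
move=> dv; rewrite (_ : (fun y => _) = fun y : 'rV[R]_n => y 0 j + v j y).
  by apply: differentiableD => //; exact: differentiable_coord.
by apply/funext => y; rewrite mxE.
Qed.

Lemma partial_perturb (v : 'I_n -> 'rV[R]_n -> R) x i j :
  (forall i, differentiable (v i) x) ->
  partial i (fun y => perturb v y 0 j) x = (i == j)%:R + partial i (v j) x.
Proof.
move=> dv; rewrite (_ : (fun y => _) = fun y : 'rV[R]_n => y 0 j + v j y).
  by rewrite partialD// ?partial_coord//; exact: differentiable_coord.
by apply/funext => y; rewrite mxE.
Qed.

Lemma tame_comp k h : flat setT h -> (forall i, tame k S rho (fun j => u j i)) ->
  tame k S rho (fun j x => h (perturb (u j) x)).
Proof.
elim: k h => [|k IH] h fh tu.
  by split=> //; apply: decay_comp => // i; exact: tame_decay (tu i).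
have dh x : differentiable h x by exact: (smooth_differentiable (flat_smooth fh)).
have du j x i : S x -> differentiable (u j i) x.
  by move=> Sx; have [_ [+ _]] := tu i; exact.
split; first by apply: decay_comp => // i; exact: tame_decay (tu i).
split=> [j x Sx|a].
  by apply: differentiable_comp_row => // i; apply: differentiable_perturb => l; exact: du.
have tuk i : tame k S rho (fun j => u j i) by exact/tameW/tu.
have t1 l : tame k S rho (fun j x =>
    ((a == l)%:R + partial a (u j l) x) * partial l h (perturb (u j) x)).
  apply: tameM => //; last by apply: IH => //; exact: flat_partial.
  apply: tameD => //; first exact: tame_cst.
  by have [_ [_ /(_ a)]] := tu l; exact: tame_one.
apply: (tame_ext oS) (tame_sum (index_enum 'I_n) (P := xpredT) oS (fun x _ => rho0 x) (fun l _ => t1 l)).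
move=> j x Sx /=; rewrite partial_comp//; last first.
  by move=> i; apply: differentiable_perturb => l; exact: du.
by apply: eq_bigr => l _; rewrite partial_perturb 1?mulrC// => i; exact: du.
Qed.

End composition.

(** * Estimates for the linear flow on a strip around the unstable subspace *)

Section contraction.
Context {R : realType} {n : nat}.
Variables (lam : 'I_n -> R) (c r : R).
Hypothesis c0 : 0 < c.
Hypothesis lamc : forall i, lam i < 0 -> lam i <= - c.
Hypothesis r01 : 0 < r <= 1.

Notation rho := (wt (fun i => lam i < 0)).
Notation S := [set x : 'rV[R]_n | rho x < r].
Notation flat U h := (forall k, tame k U rho (fun=> h)).

Let oS : open S := @open_wt R n (fun i => lam i < 0) r.
Let rho0 (x : 'rV[R]_n) : 0 <= rho x := wt_ge0 _ x.

Lemma wt_flow t x : 0 <= t -> rho (flow lam t x) <= expR (- (c * t)) * rho x.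
Proof.
move=> t0; rewrite /wt mulr_sumr; apply: ler_sum => i li.
rewrite mxE normrM ger0_norm ?expR_ge0// ler_wpM2r// ler_expR -mulNr.
by rewrite ler_wpM2r// lamc.
Qed.

Lemma flow_strip t x : 0 <= t -> S x -> S (flow lam t x).
Proof.
move=> t0 /= xr; rewrite (le_lt_trans (wt_flow x t0))// (le_lt_trans _ xr)//.
rewrite ler_piMl// -[leRHS]expR0 ler_expR oppr_le0 mulr_ge0// ltW//.
Qed.

Let rho1 x : S x -> rho x <= 1.
Proof. by move=> /= /ltW xr; case/andP: r01 => _; exact: le_trans. Qed.

(** The flow contracts [rho] at rate [c], so order [N] of vanishing contributes the rate [c * N%:R];
    the exponent [mu] costs at most [|mu|]. *)
Lemma orb_bound mu h N K x t : 0 <= K ->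
  (forall y, S y -> `|h y| <= K * rho y ^+ N) -> S x -> 0 <= t ->
  `|orb lam mu h x t| <= K * rho x ^+ N * expR (- ((c * N%:R - `|mu|) * t)).
Proof.
move=> K0 bh Sx t0; rewrite /orb normrM ger0_norm ?expR_ge0//.
have -> : expR (- ((c * N%:R - `|mu|) * t)) = expR (`|mu| * t) * expR (- (c * t)) ^+ N.
  by rewrite -expRM_natl -expRD; congr expR; ring.
rewrite mulrCA ler_pM ?expR_ge0//.
  by rewrite ler_expR -mulNr ler_wpM2r// -normrN ler_norm.
rewrite (le_trans (bh _ (flow_strip t0 Sx)))// -mulrA ler_wpM2l//.
rewrite mulrC -exprMn lerXn2r ?nnegrE ?mulr_ge0 ?expR_ge0//.
exact: wt_flow.
Qed.

(** [M] is the decay rate wanted and [N0] the order of vanishing that must survive in the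
    conclusion. Since [Tint] divides by the rate, a free choice of [M] turns it into a contraction
    of any prescribed ratio. *)
Lemma ex_rate (mu M : R) (N0 : nat) : exists2 N : nat, (N0 <= N)%N &
  M <= c * N%:R - `|mu|.
Proof.
exists (N0 + (Num.truncn ((`|M| + `|mu|) / c)).+1)%N; first exact: leq_addr.
have := truncnS_gt ((`|M| + `|mu|) / c).
rewrite ltr_pdivrMr// mulrC => h; rewrite lerBrDr natrD mulrDr.
rewrite (le_trans (lerD (ler_norm M) (lexx _)))// (le_trans (ltW h))//.
by rewrite lerDr mulr_ge0// ltW.
Qed.

Lemma flat_adm k mu h : flat S h -> adm lam k S mu h.
Proof.
elim: k mu h => [|k IH] mu h fh /=; (split; last first) => //;
  try by move=> i; apply: IH; exact: flat_partial.
all: have [N _ rate] := ex_rate mu 1 0; have [C C0 bC] := flat_bound N fh.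
all: exists C => x t Sx t0; rewrite (le_trans (orb_bound _ C0 bC Sx t0))//.
all: rewrite ler_pM ?expR_ge0 ?mulr_ge0 ?exprn_ge0//;
  first by rewrite ler_piMr// exprn_ile1// rho1.
all: by rewrite ler_expR lerN2 ler_wpM2r.
Qed.

Lemma decaying_orb_rate mu h N K x : 0 <= K -> smooth_on S h ->
  (forall y, S y -> `|h y| <= K * rho y ^+ N) -> S x ->
  decaying (c * N%:R - `|mu|) (K * rho x ^+ N) (orb lam mu h x).
Proof.
move=> K0 sh bh Sx; split; last by move=> t t0; exact: orb_bound.
move=> t t0; apply: (@continuousM _ _ (fun t => expR (- (mu * t))) (fun t => h (flow lam t x))).
  exact: continuous_expRM.
by apply: continuous_flow; apply: (smooth_differentiable sh); exact: flow_strip.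
Qed.

Lemma Tint_bound mu h N K x : 0 <= K -> smooth_on S h ->
  0 < c * N%:R - `|mu| -> (forall y, S y -> `|h y| <= K * rho y ^+ N) -> S x ->
  `|Tint lam mu h x| <= K / (c * N%:R - `|mu|) * rho x ^+ N.
Proof.
move=> K0 sh rate bh Sx; rewrite /Tint normrN mulrAC; apply: half_int_bound => //.
exact: decaying_orb_rate.
Qed.

Lemma Tint_distB mu f g N K x : 0 <= K -> flat S f -> flat S g ->
  0 < c * N%:R - `|mu| -> (forall y, S y -> `|f y - g y| <= K * rho y ^+ N) ->
  S x -> `|Tint lam mu f x - Tint lam mu g x| <= K / (c * N%:R - `|mu|) * rho x ^+ N.
Proof.
move=> K0 ff fg rate bfg Sx.
have [sf sg] := (flat_smooth ff, flat_smooth fg).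
have [Cf bf] := adm_bound (flat_adm 0 mu ff).
have [Cg bg] := adm_bound (flat_adm 0 mu fg).
have df := decaying_orb flow_strip sf Sx bf.
have dg := decaying_orb flow_strip sg Sx bg.
have -> : Tint lam mu f x - Tint lam mu g x = Tint lam mu (fun y => f y - g y) x.
  have h : half_int (orb lam mu (fun y => f y - g y) x) =
      half_int (orb lam mu f x) + -1 * half_int (orb lam mu g x).
    rewrite -(half_intZ (-1) ltr01 dg) -(half_intD ltr01 ltr01 df (decayingZ (-1) dg)).
    by apply: eq_half_int => t _; rewrite /orb; ring.
  by rewrite /Tint h; ring.
by apply: Tint_bound => //; exact: smoothB.
Qed.

Lemma Tint_decay mu (h : nat -> 'rV[R]_n -> R) : (forall j, flat S (h j)) ->
  decay S rho h -> decay S rho (fun j => Tint lam mu (h j)).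
Proof.
(* The estimate is made at an order [N] where the rate is at least 1, then weakened to [N0] by
   [rho x <= 1]; the condition [r <= 1] provides this. *)
move=> fh dh N0; have [N N0N rate] := ex_rate mu 1 N0.
have rate0 : 0 < c * N%:R - `|mu| by rewrite (lt_le_trans _ rate).
have [C C0 bC] := dh N; exists C => // j x Sx.
have le1 K : 0 <= K -> K / (c * N%:R - `|mu|) * rho x ^+ N <= K * rho x ^+ N0.
  move=> K0; rewrite ler_pM ?exprn_ge0 ?divr_ge0 ?(ltW rate0)//.
    by rewrite ler_piMr// invf_le1.
  by rewrite ler_wiXn2l// rho1.
have h0 : 0 <= C * 2^-1 ^+ j by rewrite mulr_ge0// exprn_ge0.
split; apply: le_trans (le1 _ _) => //.
  apply: Tint_bound => //; first exact: flat_smooth.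
  by move=> y Sy; have [] := bC j y Sy.
by apply: Tint_distB => // y Sy; have [] := bC j y Sy.
Qed.

Lemma Tint_tame k mu (h : nat -> 'rV[R]_n -> R) : (forall j, flat S (h j)) ->
  tame k S rho h -> tame k S rho (fun j => Tint lam mu (h j)).
Proof.
elim: k mu h => [|k IH] mu h fh th.
  by split=> //; apply: Tint_decay => //; exact: tame_decay th.
split; first by apply: Tint_decay => //; exact: tame_decay th.
have TP j x i : S x -> differentiable (Tint lam mu (h j)) x /\
    partial i (Tint lam mu (h j)) x = Tint lam (mu - lam i) (partial i (h j)) x.
  move=> Sx; apply: (Tint_partial oS flow_strip i _ (flat_adm 2 mu (fh j)) Sx).
  exact: flat_smooth.
split=> [j x Sx|i].
  apply: (smooth_differentiable _ Sx); apply: (Tint_smooth oS flow_strip).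
    exact: flat_smooth.
  by move=> m; exact: flat_adm.
apply: (tame_ext oS _ (IH (mu - lam i) (fun j => partial i (h j)) _ _)) => [j x Sx||].
- by rewrite (TP j x i Sx).2.
- by move=> j; exact: flat_partial.
- by have [_ [_]] := th; exact.
Qed.

Lemma flat_Tint mu h : flat S h -> flat S (Tint lam mu h).
Proof. by move=> fh k; exact: (@Tint_tame k mu (fun=> h)). Qed.

(* A contraction for the weight [rho ^+ N] as soon as [N] is large. *)
Lemma linear_decay p (mu : 'I_p -> R) (A : 'I_p -> 'I_p -> nat -> 'rV[R]_n -> R)
    (g w : 'I_p -> nat -> 'rV[R]_n -> R) :
  (forall i l j, flat S (A i l j)) -> (forall i j, flat S (g i j)) ->
  (forall i j, flat S (w i j)) ->
  (forall i x, S x -> w i 0%N x = 0) ->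
  (forall i j x, S x -> w i j.+1 x =
     Tint lam (mu i) (fun y => \sum_l A i l j y * w l j y + g i j y) x) ->
  (forall i l, decay S rho (A i l)) -> (forall i, decay S rho (g i)) ->
  forall i, decay S rho (w i).
Proof.
move=> fA fg fw w0 wS dA dg.
have /choice[CA0 bA0] : forall il : 'I_p * 'I_p, exists C : R, forall j x, S x ->
    `|A il.1 il.2 j x| <= C /\ `|A il.1 il.2 j.+1 x - A il.1 il.2 j x| <= C * 2^-1 ^+ j.
  move=> [i l]; have [C C0 bC] := dA i l 0%N; exists C => j x Sx /=.
  by have := bC j x Sx; rewrite expr0 !mulr1.
pose CA := \sum_il `|CA0 il|.
have CA_ge0 : 0 <= CA by exact: sumr_ge0.
have bA i l j x : S x -> `|A i l j x| <= CA /\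
    `|A i l j.+1 x - A i l j x| <= CA * 2^-1 ^+ j.
  have CC : CA0 (i, l) <= CA.
    by rewrite (le_trans (ler_norm _))// /CA (bigD1 (i, l))//= lerDl sumr_ge0.
  move=> Sx; have [b1 b2] := bA0 (i, l) j x Sx; split; first exact: le_trans CC.
  by rewrite (le_trans b2)// ler_wpM2r// exprn_ge0.
move=> i0 N0.
(* The summand [4 * (p%:R * CA)] lets the coupling through [A] keep at most a quarter of the bound
   on [w] after integration; the summand 1 keeps the bound on [g] from growing. *)
have [N N0N rate] := ex_rate (\sum_i `|mu i|) (4 * (p%:R * CA) + 1) N0.
have ratei i : 4 * (p%:R * CA) + 1 <= c * N%:R - `|mu i|.
  rewrite (le_trans rate)// lerD2l lerN2 [leRHS]ger0_norm ?sumr_ge0//.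
  by rewrite (bigD1 i)//= lerDl sumr_ge0.
have pCA : 0 <= p%:R * CA by rewrite mulr_ge0.
have rate1 i : 1 <= c * N%:R - `|mu i|.
  by rewrite (le_trans _ (ratei i))// lerDr mulr_ge0.
have rate0 i : 0 < c * N%:R - `|mu i| by rewrite (lt_le_trans _ (rate1 i)).
have /choice[G0 bG0] : forall i, exists C : R, forall j x, S x ->
    `|g i j x| <= C * rho x ^+ N /\ `|g i j.+1 x - g i j x| <= C * 2^-1 ^+ j * rho x ^+ N.
  by move=> i; have [C C0 bC] := dg i N; exists C.
pose G := \sum_i `|G0 i|.
have G_ge0 : 0 <= G by exact: sumr_ge0.
have rN (x : 'rV[R]_n) : 0 <= rho x ^+ N by apply: exprn_ge0; exact: wt_ge0.
have h0 j : 0 <= 2^-1 ^+ j :> R by rewrite exprn_ge0.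
have bG i j x : S x -> `|g i j x| <= G * rho x ^+ N /\
    `|g i j.+1 x - g i j x| <= G * 2^-1 ^+ j * rho x ^+ N.
  have CC : G0 i <= G.
    by rewrite (le_trans (ler_norm _))// /G (bigD1 i)//= lerDl sumr_ge0.
  move=> Sx; have [b1 b2] := bG0 i j x Sx; split.
    by rewrite (le_trans b1)// ler_wpM2r.
  by rewrite (le_trans b2)// ler_wpM2r// ler_wpM2r.
(* The two numerical facts that make the recursion contract. *)
have shrink i K L : 0 <= K -> 0 <= L ->
    (p%:R * (CA * K) + L) / (c * N%:R - `|mu i|) <= K / 4 + L.
  move=> K0 L0; rewrite ler_pdivrMr// mulrDl lerD//; last by rewrite ler_peMr.
  by have := ler_wpM2l K0 (ratei i); lra.
pose phi i j y := \sum_l A i l j y * w l j y + g i j y.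
have fphi i j : flat S (phi i j).
  move=> k; apply: (tameD (rho := rho) oS) => //.
  apply: (tame_sum _ (F := fun l _ => fun y => A i l j y * w l j y)) => // l _.
  by apply: tameM => //; exact: tame_one.
have bw j : forall i x, S x -> `|w i j x| <= 2 * G * rho x ^+ N.
  elim: j => [|j IH] i x Sx; first by rewrite w0// normr0 !mulr_ge0.
  rewrite wS// (le_trans (Tint_bound (K := p%:R * (CA * (2 * G)) + G) (N := N) _ _ _ _ Sx))//.
  - by rewrite addr_ge0// mulr_ge0// mulr_ge0// mulr_ge0.
  - exact: (flat_smooth (fphi i j)).
  - move=> y Sy; rewrite mulrDl (le_trans (ler_normD _ _))// lerD//; last by have [] := bG i j y Sy.
    rewrite (le_trans (ler_norm_sum _ _ _))//.
    rewrite (@le_trans _ _ (\sum_(l < p) CA * (2 * G * rho y ^+ N)))//.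
      apply: ler_sum => l _; rewrite normrM ler_pM//; last exact: IH.
      by have [] := bA i l j y Sy.
    by rewrite sumr_const card_ord -[_ *+ p]mulr_natl !mulrA.
  - rewrite ler_wpM2r// (le_trans (shrink i _ _ _ _))// ?mulr_ge0//.
    by have := G_ge0; lra.
(* The constant 6 makes the induction close: with 6 from the difference of [w] and 2 from the
   difference of [A] against the bound on [w], [shrink] gives [8 / 4 + 1 = 3] times [G * 2^-1 ^+ j],
   which is [6 * G * 2^-1 ^+ j.+1]. *)
have dw j : forall i x, S x -> `|w i j.+1 x - w i j x| <= 6 * G * 2^-1 ^+ j * rho x ^+ N.
  elim: j => [|j IH] i x Sx.
    rewrite w0// subr0 (le_trans (bw 1%N i x Sx))// ler_wpM2r// expr0 mulr1.
    by have := G_ge0; lra.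
  rewrite (wS i j.+1)// (wS i j)//.
  pose D := p%:R * (CA * (6 * G * 2^-1 ^+ j + 2 * G * 2^-1 ^+ j)) + G * 2^-1 ^+ j.
  have D0 : 0 <= D by rewrite addr_ge0// !mulr_ge0// addr_ge0// !mulr_ge0.
  rewrite (le_trans (Tint_distB (K := D) (N := N) _ (fphi i j.+1) (fphi i j) _ _ Sx))//.
    move=> y Sy; have -> : phi i j.+1 y - phi i j y =
        \sum_l (A i l j.+1 y * (w l j.+1 y - w l j y) + (A i l j.+1 y - A i l j y) * w l j y)
        + (g i j.+1 y - g i j y).
      rewrite /phi opprD addrACA -sumrB; congr (_ + _); apply: eq_bigr => l _; ring.
    rewrite /D mulrDl (le_trans (ler_normD _ _))// lerD//; last by have [] := bG i j y Sy.
    rewrite (le_trans (ler_norm_sum _ _ _))//.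
    rewrite (@le_trans _ _ (\sum_(l < p) CA * ((6 * G * 2^-1 ^+ j + 2 * G * 2^-1 ^+ j) * rho y ^+ N)))//.
      apply: ler_sum => l _.
      rewrite [leRHS](_ : _ = CA * (6 * G * 2^-1 ^+ j * rho y ^+ N) +
        CA * (2 * G * 2^-1 ^+ j * rho y ^+ N)); last by ring.
      rewrite (le_trans (ler_normD _ _))// lerD// normrM.
        by rewrite ler_pM//; [have [] := bA i l j.+1 y Sy|exact: IH].
      rewrite (@le_trans _ _ (CA * 2^-1 ^+ j * (2 * G * rho y ^+ N)))//.
        by rewrite ler_pM//; [have [] := bA i l j y Sy|exact: bw].
      by rewrite le_eqVlt; apply/orP; left; apply/eqP; ring.
    by rewrite sumr_const card_ord -[_ *+ p]mulr_natl !mulrA.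
  rewrite ler_wpM2r// (le_trans (shrink i _ _ _ _))//.
  - by rewrite addr_ge0// !mulr_ge0.
  - by rewrite mulr_ge0.
  - by rewrite exprS; have := mulr_ge0 G_ge0 (h0 j); lra.
exists (6 * G) => [|j x Sx]; first by rewrite mulr_ge0.
have rNN : rho x ^+ N <= rho x ^+ N0 by rewrite ler_wiXn2l// rho1.
split.
  rewrite (le_trans (bw j i0 x Sx))// ler_pM// ?mulr_ge0//.
  by have := G_ge0; lra.
by rewrite (le_trans (dw j i0 x Sx))// ler_wpM2l// !mulr_ge0.
Qed.

(** Differentiating the recursion in direction [a] gives a recursion of the same form for
    [partial a w]: same coefficients [A], exponents [mu i - lam a], and a source [g'] that involves
    [w] itself but not its derivatives. Hence the induction on the order stays on the same strip. *)
Lemma linear_tame p m (mu : 'I_p -> R) (A : 'I_p -> 'I_p -> nat -> 'rV[R]_n -> R)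
    (g w : 'I_p -> nat -> 'rV[R]_n -> R) :
  (forall i l j, flat S (A i l j)) -> (forall i j, flat S (g i j)) ->
  (forall i j, flat S (w i j)) ->
  (forall i x, S x -> w i 0%N x = 0) ->
  (forall i j x, S x -> w i j.+1 x =
     Tint lam (mu i) (fun y => \sum_l A i l j y * w l j y + g i j y) x) ->
  (forall i l, tame m S rho (A i l)) -> (forall i, tame m S rho (g i)) ->
  forall i, tame m S rho (w i).
Proof.
elim: m mu g w => [|m IH] mu g w fA fg fw w0 wS tA tg i.
  split=> //; apply: (linear_decay fA fg fw w0 wS) => [i1 l|i1].
    exact: tame_decay (tA i1 l).
  exact: tame_decay (tg i1).
have tw : forall l, tame m S rho (w l).
  by apply: IH fA fg fw w0 wS _ _ => [i1 l|l]; exact: tameW.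
split; first exact: tame_decay (tw i).
split=> [j x Sx|a]; first by apply: (smooth_differentiable _ Sx); exact: flat_smooth (fw i j).
pose g' i j y := \sum_l partial a (A i l j) y * w l j y + partial a (g i j) y.
have fg' i1 j : flat S (g' i1 j).
  move=> k; apply: (tameD (rho := rho) oS) => //; last exact: flat_partial.
  apply: (tame_sum _ (F := fun l _ => fun y => partial a (A i1 l j) y * w l j y)) => // l _.
  by apply: tameM => //; apply: tame_one; exact: (flat_partial a (fA i1 l j)).
apply: (IH (fun i => mu i - lam a) g' (fun i j => partial a (w i j)) fA fg' _ _ _ _ _ i).
- by move=> i1 j; exact: flat_partial.
- move=> i1 x Sx; rewrite (@near_eq_partial _ _ _ (fun=> 0)) ?partial_cst//.
  by apply: filterS (open_nbhs_nbhs (conj oS Sx)) => y; exact: w0.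
- move=> i1 j x Sx.
  pose phi y := \sum_l A i1 l j y * w l j y + g i1 j y.
  have fphi : flat S phi.
    move=> k; apply: (tameD (rho := rho) oS) => //.
    apply: (tame_sum _ (F := fun l _ => fun y => A i1 l j y * w l j y)) => // l _.
    by apply: tameM => //; exact: tame_one.
  rewrite (@near_eq_partial _ _ _ (Tint lam (mu i1) phi)); last first.
    by apply: filterS (open_nbhs_nbhs (conj oS Sx)) => y; exact: wS.
  rewrite (Tint_partial oS flow_strip a (flat_smooth fphi) (flat_adm 2 _ fphi) Sx).2.
  rewrite /Tint; congr (- _); apply: eq_half_int => t t0; rewrite /orb; congr (_ * _).
  have Sf := flow_strip t0 Sx; move: (flow lam t x) Sf => y Sy.
  have dA l : differentiable (A i1 l j) y := smooth_differentiable (flat_smooth (fA i1 l j)) Sy.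
  have dw l : differentiable (w l j) y := smooth_differentiable (flat_smooth (fw l j)) Sy.
  rewrite partialD; last 2 first.
  + apply: (smooth_differentiable _ Sy); apply: smooth_sum => // l _.
    by apply: smoothM => //; exact: flat_smooth.
  + exact: smooth_differentiable (flat_smooth (fg i1 j)) Sy.
  rewrite partial_sum; last by move=> l; exact: differentiableM.
  rewrite /g' addrA -big_split /=; congr (_ + _); apply: eq_bigr => l _.
  by rewrite partialM// addrC.
- by move=> i1 l; exact/tameW/tA.
- move=> i1; apply: (tameD (rho := rho) oS) => //; last by have [_ [_]] := tg i1; exact.
  apply: (tame_sum _ (F := fun l j y => partial a (A i1 l j) y * w l j y)) => // l _.
  by apply: tameM => //; apply: tame_one; have [_ [_]] := tA i1 l; exact.
Qed.

End contraction.

(** The inverse of a sum of inverses lies below each of the terms; the summand 1 covers the case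
    without negative eigenvalues. *)
Lemma exists_gap {R : realType} {n : nat} (lam : 'I_n -> R) :
  exists2 c : R, 0 < c & forall i, lam i < 0 -> lam i <= - c.
Proof.
have S0 : 0 < 1 + \sum_(i | lam i < 0) `|lam i|^-1.
  by rewrite ltr_wpDr// sumr_ge0// => i _; rewrite invr_ge0.
exists (1 + \sum_(i | lam i < 0) `|lam i|^-1)^-1; first by rewrite invr_gt0.
move=> i li; rewrite lerNr -ltr0_norm//.
have l0 : 0 < `|lam i| by rewrite normr_gt0 lt_eqF.
rewrite -[leRHS]invrK lef_pV2 ?posrE ?invr_gt0//.
by rewrite (bigD1 i)//= addrCA lerDl addr_ge0// sumr_ge0.
Qed.

(** * Picard iteration on the strip *)

Section one_sided_linearization.
Context {R : realType} {n : nat}.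
Variable lam : 'I_n -> R.

Notation rho := (wt (fun i => lam i < 0)).
Notation flat U h := (forall k, tame k U rho (fun=> h)).

Let rho0 (x : 'rV[R]_n) : 0 <= rho x.
Proof. exact: wt_ge0. Qed.

(* Fixed-point iteration for [Vlin lam (u i) = lam i * u i + Rm i (id + u)]. *)
Fixpoint picard (Rm : 'I_n -> 'rV[R]_n -> R) j : 'I_n -> 'rV[R]_n -> R :=
  if j is j'.+1 then
    fun i => Tint lam (lam i) (fun y => Rm i (perturb (picard Rm j') y))
  else fun _ _ => 0.

(** The iteration is nonlinear only for the iterates themselves. Their derivatives obey a linear
    recursion with coefficients [partial l (Rm i)] at the perturbed point; tameness of the iterates
    to order [m] makes these coefficients tame to order [m], and [linear_tame] then gives order
    [m.+1]. One strip therefore serves all orders. *)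
Lemma one_sided_linearization (Rm : 'I_n -> 'rV[R]_n -> R) :
  (forall i, flat setT (Rm i)) ->
  exists (r : R) (u : 'I_n -> 'rV[R]_n -> R),
  [/\ 0 < r <= 1,
      forall i, smooth_on [set x | rho x < r] (u i),
      forall N, exists2 C : R, 0 <= C &
        forall i x, rho x < r -> `|u i x| <= C * rho x ^+ N &
      forall i x, rho x < r ->
        \sum_a lam a * x 0 a * partial a (u i) x =
        lam i * u i x + Rm i (perturb u x)].
Proof.
move=> fR; have [c c0 lamc] := exists_gap lam.
pose M := \sum_i `|lam i|.
have lamM i : `|lam i| <= `|M|.
  by rewrite (ger0_norm (sumr_ge0 _ _))// /M (bigD1 i)//= lerDl sumr_ge0.
have [N1 N1_ge2 rate1] := ex_rate c0 M 1 2.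
have ratei i : 1 <= c * N1%:R - `|lam i|.
  by rewrite (le_trans rate1)// lerD2l lerN2.
have /choice[CR0 bR0] : forall i, exists C : R, forall x, `|Rm i x| <= C * rho x ^+ N1.
  by move=> i; have [C C0 bC] := flat_bound N1 (fR i); exists C => x; exact: bC.
pose CR := \sum_i `|CR0 i|.
have CR_ge0 : 0 <= CR by exact: sumr_ge0.
have bR i x : `|Rm i x| <= CR * rho x ^+ N1.
  rewrite (le_trans (bR0 i x))// ler_wpM2r ?exprn_ge0//.
  by rewrite (le_trans (ler_norm _))// /CR (bigD1 i)//= lerDl sumr_ge0.
pose K := n%:R * (CR * 2 ^+ N1).
have K_ge0 : 0 <= K by rewrite !mulr_ge0// exprn_ge0.
(* The weight of an iterate is at most [K * rho x ^+ N1], where [2 ^+ N1] in [K] accounts for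
   evaluating [Rm] at a point of doubled weight. As [2 <= N1] and [rho x < r], this is at most
   [rho x], so the perturbation at most doubles the weight again. *)
pose r := (1 + K)^-1.
have K1 : 0 < 1 + K by rewrite ltr_wpDr.
have r01 : 0 < r <= 1 by rewrite invr_gt0 K1 invf_le1// lerDl.
pose S := [set x : 'rV[R]_n | rho x < r].
have oS : open S by exact: open_wt.
have rho1 x : S x -> rho x <= 1.
  by move=> /= /ltW xr; case/andP: r01 => _; exact: le_trans.
pose u := picard Rm.
have small j : (forall i, flat S (u j i)) /\
    forall x, S x -> rho (perturb (u j) x) <= 2 * rho x.
  elim: j => [|j [fu su]].
    split=> [i k|x Sx]; first exact: tame0.
    rewrite (_ : perturb _ _ = x); last by apply/rowP => i; rewrite mxE addr0.
    by rewrite ler_peMl// ler1n.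
  have fRu i : flat S (fun y => Rm i (perturb (u j) y)).
    move=> k; apply: (tame_comp (u := fun=> u j) oS rho0 (fun=> su) (fR i)) => l.
    exact: fu.
  split=> [i|x Sx]; first exact: (flat_Tint c0 lamc r01 _ (fRu i)).
  have bu i : `|u j.+1 i x| <= CR * 2 ^+ N1 * rho x ^+ N1.
    have C0 : 0 <= CR * 2 ^+ N1 by rewrite mulr_ge0// exprn_ge0.
    have rate0 : 0 < c * N1%:R - `|lam i| by rewrite (lt_le_trans _ (ratei i)).
    rewrite (le_trans (Tint_bound c0 lamc (K := CR * 2 ^+ N1) (N := N1) _ _ _ _ Sx))//.
    - exact: flat_smooth (fRu i).
    - move=> y Sy; rewrite (le_trans (bR i _))// -mulrA ler_wpM2l// -exprMn.
      by rewrite lerXn2r ?nnegrE ?mulr_ge0// su.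
    - by rewrite ler_wpM2r ?exprn_ge0// ler_piMr// invf_le1.
  have -> : perturb (u j.+1) x = x + \row_i u j.+1 i x.
    by apply/rowP => i; rewrite !mxE.
  rewrite (le_trans (wtD _ _ _))// mulr_natl mulr2n lerD2l.
  apply: (@le_trans _ _ (\sum_(i < n) CR * 2 ^+ N1 * rho x ^+ N1)).
    rewrite /wt big_mkcond /=; apply: ler_sum => i _; case: ifP => _; last first.
      exact: le_trans (bu i).
    by rewrite mxE.
  rewrite sumr_const card_ord -[_ *+ n]mulr_natl mulrA -/K.
  rewrite -(subnK N1_ge2) addn2 !exprS mulrA mulrA.
  apply: (@le_trans _ _ (K * rho x * rho x)).
    rewrite -[leRHS]mulrA ler_piMr ?mulr_ge0//.
    by rewrite exprn_ile1// rho1.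
  rewrite ler_piMl//; apply: (@le_trans _ _ (K * r)).
    by rewrite ler_wpM2l// ltW.
  by rewrite ler_pdivrMr// mul1r lerDr.
have fu j i := (small j).1 i; have su j x := (small j).2 x.
have fRu i j : flat S (fun y => Rm i (perturb (u j) y)).
  move=> k; apply: (tame_comp (u := fun=> u j) oS rho0 (fun=> su j) (fR i)) => l.
  exact: fu.
have du i : decay S rho (fun j => u j i).
  move=> N0.
  have /choice[D0 bD0] : forall ij : 'I_n * 'I_n, exists C : R, forall x, `|partial ij.1 (Rm ij.2) x| <= C.
    move=> [i1 i2]; have [C C0 bC] := flat_bound 0 (flat_partial i1 (fR i2)).
    by exists C => x; rewrite -[C]mulr1 -[1](expr0 (rho x)) bC.
  pose D := \sum_ij `|D0 ij|.
  have D_ge0 : 0 <= D by exact: sumr_ge0.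
  have bD i1 i2 x : `|partial i1 (Rm i2) x| <= D.
    rewrite (le_trans (bD0 (i1, i2) x))// (le_trans (ler_norm _))//.
    by rewrite /D (bigD1 (i1, i2))//= lerDl sumr_ge0.
  have nD : 0 <= n%:R * D by rewrite mulr_ge0.
  (* Twice the Lipschitz constant [n%:R * D] of [Rm]: each integration halves the difference of
     consecutive iterates. *)
  have [N N0N rate] := ex_rate c0 M (2 * (n%:R * D) + 1) N0.
  have ratej l : 2 * (n%:R * D) + 1 <= c * N%:R - `|lam l|.
    by rewrite (le_trans rate)// lerD2l lerN2.
  have rate1l l : 1 <= c * N%:R - `|lam l|.
    by rewrite (le_trans _ (ratej l))// lerDr mulr_ge0.
  have rate0 l : 0 < c * N%:R - `|lam l| by rewrite (lt_le_trans _ (rate1l l)).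
  have /choice[B0 bB0] : forall l, exists C : R, forall x, `|Rm l x| <= C * rho x ^+ N.
    by move=> l; have [C C0 bC] := flat_bound N (fR l); exists C => x; exact: bC.
  pose B := \sum_l `|B0 l|.
  have B_ge0 : 0 <= B by exact: sumr_ge0.
  have rN (x : 'rV[R]_n) : 0 <= rho x ^+ N by exact: exprn_ge0.
  have bB l x : `|Rm l x| <= B * rho x ^+ N.
    rewrite (le_trans (bB0 l x))// ler_wpM2r//.
    by rewrite (le_trans (ler_norm _))// /B (bigD1 l)//= lerDl sumr_ge0.
  pose E := B * 2 ^+ N.
  have E_ge0 : 0 <= E by rewrite mulr_ge0// exprn_ge0.
  have bRu l j x : S x -> `|Rm l (perturb (u j) x)| <= E * rho x ^+ N.
    move=> Sx; rewrite (le_trans (bB l _))// -mulrA ler_wpM2l// -exprMn.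
    by rewrite lerXn2r ?nnegrE ?mulr_ge0// su.
  have bu l j x : S x -> `|u j l x| <= E * rho x ^+ N.
    case: j => [|j] Sx; first by rewrite normr0 mulr_ge0.
    rewrite (le_trans (Tint_bound c0 lamc (K := E) (N := N) _ _ _ _ Sx))//.
    - exact: flat_smooth (fRu l j).
    - by move=> y; exact: bRu.
    - by rewrite ler_wpM2r// ler_piMr// invf_le1.
  have h0 j : 0 <= 2^-1 ^+ j :> R by rewrite exprn_ge0.
  have bdu j : forall l x, S x -> `|u j.+1 l x - u j l x| <= E * 2^-1 ^+ j * rho x ^+ N.
    elim: j => [|j IH] l x Sx; first by rewrite subr0 expr0 mulr1 bu.
    pose L := n%:R * (D * (E * 2^-1 ^+ j)).
    have L0 : 0 <= L by rewrite !mulr_ge0.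
    rewrite (le_trans (Tint_distB c0 lamc r01 (K := L) (N := N) _ (fRu l j.+1) (fRu l j) _ _ Sx))//.
      move=> y Sy.
      have [|t t01] := @mean_value _ _ (Rm l) (perturb (u j) y) (perturb (u j.+1) y - perturb (u j) y).
        by move=> t _; exact: (smooth_differentiable (flat_smooth (fR l))).
      rewrite [perturb (u j) y + _]addrC subrK => ->.
      rewrite (le_trans (ler_norm_sum _ _ _))//.
      apply: (@le_trans _ _ (\sum_(a < n) D * (E * 2^-1 ^+ j * rho y ^+ N))).
        apply: ler_sum => a _; rewrite normrM ler_pM//.
        by rewrite !mxE opprD addrACA subrr add0r IH.
      by rewrite sumr_const card_ord -[_ *+ n]mulr_natl /L !mulrA.
    rewrite ler_wpM2r// ler_pdivrMr// exprS.
    have := ler_wpM2l (mulr_ge0 E_ge0 (h0 j)) (ratej l).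
    by have := mulr_ge0 E_ge0 (h0 j); rewrite /L; lra.
  exists E => // j x Sx.
  have rNN : rho x ^+ N <= rho x ^+ N0 by rewrite ler_wiXn2l// rho1.
  split; first by rewrite (le_trans (bu i j x Sx))// ler_wpM2l.
  by rewrite (le_trans (bdu j i x Sx))// ler_wpM2l// mulr_ge0.
have tu m : forall i, tame m S rho (fun j => u j i).
  elim: m => [|m IH] i; first by split.
  split; first exact: du.
  split=> [j x Sx|a]; first by apply: (smooth_differentiable _ Sx); exact: flat_smooth (fu j i).
  pose A i l j y := partial l (Rm i) (perturb (u j) y).
  have fA i1 l j : flat S (A i1 l j).
    move=> k; apply: (tame_comp (u := fun=> u j) oS rho0 (fun=> su j) (flat_partial l (fR i1))) => l'.
    exact: fu.
  have tA i1 l : tame m S rho (A i1 l).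
    by apply: (tame_comp (u := u) oS rho0 su (flat_partial l (fR i1))).
  apply: (linear_tame c0 lamc r01 (p := n) (mu := fun i => lam i - lam a) (A := A)
    (g := fun i => A i a) (w := fun i j => partial a (u j i))) => //.
  - by move=> i1 j; exact: flat_partial.
  - by move=> i1 x Sx; rewrite partial_cst.
  - move=> i1 j x Sx.
    rewrite (Tint_partial oS (flow_strip c0 lamc) a (flat_smooth (fRu i1 j)) (flat_adm c0 lamc r01 2 _ (fRu i1 j)) Sx).2.
    rewrite /Tint; congr (- _); apply: eq_half_int => t t0; rewrite /orb; congr (_ * _).
    have Sf := flow_strip c0 lamc t0 Sx; move: (flow lam t x) Sf => y Sy.
    have duy l : differentiable (u j l) y := smooth_differentiable (flat_smooth (fu j l)) Sy.
    have dR : differentiable (Rm i1) (perturb (u j) y).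
      exact: (smooth_differentiable (flat_smooth (fR i1))).
    rewrite partial_comp//; last by move=> l; exact: differentiable_perturb.
    under eq_bigr do rewrite partial_perturb// mulrDr.
    rewrite big_split /= addrC; congr (_ + _); rewrite (bigD1 a)//= eqxx mulr1.
    by rewrite big1 ?addr0// => l /negbTE la; rewrite eq_sym la mulr0.
pose ul i := flim (fun j => u j i).
have sul i : smooth_on S (ul i) by apply: flim_smooth => // k; exact: tu.
exists r, ul; split=> //.
- move=> N; have /choice[C bC] : forall i, exists C : R, 0 <= C /\ forall x, S x -> `|ul i x| <= C * rho x ^+ N.
    by move=> i; have [C C0 bC] := flim_bound N (du i); exists C.
  exists (\sum_i C i) => [|i x Sx]; first by apply: sumr_ge0 => i _; have [] := bC i.
  have [_ /(_ x Sx)/le_trans] := bC i; apply; rewrite ler_wpM2r ?exprn_ge0//.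
  by rewrite (bigD1 i)//= lerDl sumr_ge0// => l _; have [] := bC l.
- move=> i x Sx.
  have cu l : u j l x @[j --> \oo] --> ul l x := flim_cvg (du l) Sx.
  have cp : perturb (u j) x @[j --> \oo] --> perturb ul x.
    apply/cvgrPdist_le => e e0; near=> j; apply: row_norm_ub; first exact: ltW.
    move=> l; rewrite !mxE opprD addrACA subrr add0r; move: l; near: j.
    by apply: filter_forall => l; have /cvgrPdist_le/(_ _ e0) := cu l.
  have cR : Rm i (perturb (u j) x) @[j --> \oo] --> Rm i (perturb ul x).
    have cRi : {for perturb ul x, continuous (Rm i)}.
      by apply: differentiable_continuous; exact: (smooth_differentiable (flat_smooth (fR i))).
    exact: (continuous_cvg _ cRi cp).
  have cl : \sum_a lam a * x 0 a * partial a (u j.+1 i) x @[j --> \oo] -->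
      \sum_a lam a * x 0 a * partial a (ul i) x.
    apply: cvgn_sum => a; apply: cvgMl_tmp.
    have [_ ->] := flim_partial oS (tu 2%N i) Sx.
    have [_ [_ ta]] := tu 1%N i.
    have := flim_cvg (ta a).1 Sx.
    by rewrite -(@cvg_shiftS _ (fun j => partial a (u j i) x)).
  have cr : lam i * u j.+1 i x + Rm i (perturb (u j) x) @[j --> \oo] -->
      lam i * ul i x + Rm i (perturb ul x).
    apply: cvgD => //; apply: cvgMl_tmp.
    by have := cu i; rewrite -(@cvg_shiftS _ (fun j => u j i x)).
  (* [Tint_eq] relates consecutive iterates by a differential equation. Both sides converge, so the
     limit solves the fixed-point equation without any limit inside an integral. *)
  have fE : (fun j => \sum_a lam a * x 0 a * partial a (u j.+1 i) x) =
      (fun j => lam i * u j.+1 i x + Rm i (perturb (u j) x)).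
    apply/funext => j.
    exact: (Tint_eq oS (flow_strip c0 lamc) (flat_smooth (fRu i j)) (flat_adm c0 lamc r01 2 _ (fRu i j)) Sx).
  move: cl; rewrite fE => cl.
  exact: (cvg_unique (@norm_hausdorff _ _) cl cr).
Unshelve. all: by end_near. Qed.

End one_sided_linearization.

(** * Cutoff functions *)

Section exp_inv.
Context {R : realType}.
Implicit Types (p : {poly R}).

(** The polynomial factor makes this family closed under differentiation, with [exp_inv_poly]
    describing the effect on [p]. The cutoffs use the member [p = 1], the others carry its
    derivatives. *)
Definition exp_inv p (x : R) : R := if 0 < x then p.[x^-1] * expR (- x^-1) else 0.

Definition exp_inv_poly p : {poly R} := 'X^2 * (p - p^`()).

Lemma poly_le_exp p : exists2 A : R, 0 <= A &
  forall t, 1 <= t -> `|p.[t]| <= A * expR t.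
Proof.
elim/poly_ind: p => [|p a [A A0 bA]]; first by exists 0 => // t _; rewrite horner0 normr0 mul0r.
have [k] : exists k, exists2 B : R, 0 <= B & forall t, 1 <= t -> `|p.[t]| <= B * t ^+ k.
  clear; elim/poly_ind: p => [|p a [k [B B0 bB]]].
    by exists 0%N, 0 => // t _; rewrite horner0 normr0 mul0r.
  exists k.+1, (B + `|a|) => [|t t1]; first by rewrite addr_ge0.
  have t0 : 0 <= t by exact: le_trans t1.
  rewrite hornerMXaddC (le_trans (ler_normD _ _))// mulrDl lerD//.
    by rewrite normrM exprSr mulrA (ger0_norm t0) ler_wpM2r// bB.
  by rewrite ler_peMr// exprn_ege1.
move=> [B B0 bB]; exists (B * (k.+1)`!%:R + `|a|) => [|t t1].
  by rewrite addr_ge0// mulr_ge0.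
have t0 : 0 <= t by exact: le_trans t1.
rewrite hornerMXaddC (le_trans (ler_normD _ _))// mulrDl lerD//; last first.
  by rewrite ler_peMr// -expR0 ler_expR.
rewrite normrM (ger0_norm t0).
apply: (@le_trans _ _ (B * t ^+ k.+1)).
  by rewrite exprSr mulrA ler_wpM2r// bB.
rewrite -mulrA ler_wpM2l//.
have f0 : 0 < (k.+1)`!%:R :> R by rewrite ltr0n fact_gt0.
have ek := expR_ge1Dxn k t0.
by rewrite mulrC -ler_pdivrMr// (le_trans _ ek)// lerDr.
Qed.

(** The exponential dominates ['X^2 * p] as well, and the extra ['X^2] turns into the factor
    [h ^+ 2]. This makes the difference quotient at 0 tend to 0 in [is_derive_exp_inv]. *)
Lemma exp_inv_bound p : exists2 A : R, 0 <= A &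
  forall h, `|h| <= 1 -> `|exp_inv p h| <= A * `|h| ^+ 2.
Proof.
have [A A0 bA] := poly_le_exp ('X^2 * p); exists A => // h h1.
rewrite /exp_inv; case: ifPn => h0; last by rewrite normr0 mulr_ge0// exprn_ge0.
have hV : 1 <= h^-1 by rewrite invf_ge1// (le_trans (ler_norm h)).
have := bA _ hV; rewrite hornerM hornerXn normrM (normrM _ (expR _)).
rewrite (ger0_norm (exprn_ge0 _ (le_trans ler01 hV))) (ger0_norm (expR_ge0 _)).
rewrite (ger0_norm (ltW h0)) exprVn => bA'.
have h2 : 0 < h ^+ 2 by rewrite exprn_gt0.
rewrite mulrC expRN ler_pdivrMl ?expR_gt0//.
move: bA'; rewrite ler_pdivrMl// => /le_trans; apply.
by rewrite le_eqVlt; apply/orP; left; apply/eqP; ring.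
Qed.

Lemma is_derive_exp_inv p (x : R) :
  is_derive x 1 (exp_inv p) (exp_inv (exp_inv_poly p) x).
Proof.
have [x0|x0|x0] := ltgtP 0 x.
- have x0' : x != 0 by rewrite gt_eqF.
  have h1 : is_derive x 1 (fun y : R => y^-1) (- x ^- 2).
    have := is_deriveV x0' (is_derive_id x (1 : R)).
    by move=> h; apply: (is_derive_eq h); rewrite /GRing.scale /= mulr1.
  have h2 : is_derive x 1 (fun y => p.[y^-1]) (p^`().[x^-1] * - x ^- 2).
    have hp : is_derive (x^-1) 1 (horner p) (p^`().[x^-1]).
      have h : derivable (horner p) (x^-1) 1 by exact: derivable_horner.
      by have := derivableP h; rewrite -derive1E -derivE.
    exact: (@is_derive1_comp _ (horner p) (fun y : R => y^-1) x _ _ hp h1).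
  have h3 : is_derive x 1 (fun y => expR (- y^-1)) (expR (- x^-1) * x ^- 2).
    have h := @is_derive1_comp _ expR (fun y : R => - y^-1) x _ _ (is_derive_expR (- x^-1)) (is_deriveN h1).
    by apply: (is_derive_eq h); rewrite opprK.
  have hn : \forall y \near x, p.[y^-1] * expR (- y^-1) = exp_inv p y.
    by near=> y; rewrite /exp_inv ifT//; near: y; apply: open_nbhs_nbhs; split=> //; exact: open_gt.
  apply: (near_eq_is_derive hn).
  apply: (is_derive_eq (is_deriveM h2 h3)); rewrite /exp_inv x0 /exp_inv_poly.
  by rewrite hornerM hornerXn hornerD hornerN exprVn /GRing.scale /=; ring.
- have hn : \forall y \near x, cst 0 y = exp_inv p y.
    near=> y; rewrite /exp_inv ifN// -leNgt; apply: ltW; near: y; apply: open_nbhs_nbhs; split=> //; exact: open_lt.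
  apply: (near_eq_is_derive hn).
  by rewrite /exp_inv ltNge (ltW x0)/=; exact: is_derive_cst.
- rewrite -x0; have [A A0 bA] := exp_inv_bound p.
  have cv : (fun h : R => h^-1 *: ((exp_inv p \o shift 0) (h *: 1) - exp_inv p 0)) @ 0^' --> (0 : R).
    apply/cvgrPdist_le => e e0; near=> h.
    have h0 : h != 0 by near: h; exact: nbhs_dnbhs_neq.
    have h1 : `|h| <= 1.
      by apply: ltW; near: h; exact: dnbhs0_lt.
    have h2 : `|h| * (A + 1) <= e.
      by rewrite -ler_pdivlMr ?ltr_wpDl//; near: h; apply: dnbhs0_le; rewrite divr_gt0// ltr_wpDl.
    rewrite sub0r normrN /= addr0 [h *: 1]mulr1 {2}/exp_inv ltxx subr0 normrZ normfV.
    rewrite ler_pdivrMl ?normr_gt0// (le_trans (bA h h1))// expr2 mulrCA ler_wpM2l//.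
    by rewrite (le_trans _ h2)// mulrC ler_wpM2l// lerDl.
  apply: DeriveDef; first by apply: cvgP cv.
  by rewrite /exp_inv ltxx; apply: cvg_lim cv.
Unshelve. all: by end_near. Qed.

End exp_inv.

Section cutoffs.
Context {R : realType} {n : nat}.
Implicit Types (x v : 'rV[R]_n) (U : set 'rV[R]_n).

Lemma exp_inv_comp (p : {poly R}) (a : 'rV[R]_n -> R) x :
  differentiable a x ->
  differentiable (fun y => exp_inv p (a y)) x /\
  forall i, partial i (fun y => exp_inv p (a y)) x =
    exp_inv (exp_inv_poly p) (a x) * partial i a x.
Proof.
move=> da; have [dE Eval] := is_derive_exp_inv p (a x).
have dE' : differentiable (exp_inv p) (a x) by exact/derivable1_diffP.
have dc : differentiable (exp_inv p \o a) x by exact: differentiable_comp.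
split=> // i; rewrite /partial deriveE// (@diff_comp _ _ _ _ a (exp_inv p))//=.
rewrite [in RHS]deriveE// -Eval -[in RHS]derive1E derive1E'//.
by rewrite -[X in 'd _ _ X = _]mulr1 [LHS]linearZ mulrC.
Qed.

Lemma smooth_exp_inv U (p : {poly R}) (a : 'rV[R]_n -> R) : open U -> smooth_on U a ->
  smooth_on U (fun x => exp_inv p (a x)).
Proof.
move=> oU sa k; elim: k p => [|k IH] p.
  move=> x Ux; apply: differentiable_continuous.
  by have [] := exp_inv_comp p (smooth_differentiable sa Ux).
split=> [x Ux|i]; first by have [] := exp_inv_comp p (smooth_differentiable sa Ux).
apply: (@Ck_ext _ _ _ _ (fun x => exp_inv (exp_inv_poly p) (a x) * partial i a x)) => //.
  by move=> x Ux; have [_ ->] := exp_inv_comp p (smooth_differentiable sa Ux).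
by apply: CkM => //; apply: smooth_partial sa k.
Qed.

Definition ramp (t : R) : R := exp_inv 1 t.

Lemma ramp_gt0 t : 0 < t -> 0 < ramp t.
Proof. by move=> t0; rewrite /ramp /exp_inv t0 hornerC mul1r expR_gt0. Qed.

Lemma ramp_eq0 t : t <= 0 -> ramp t = 0.
Proof. by move=> t0; rewrite /ramp /exp_inv ltNge t0. Qed.

Lemma ramp_ge0 t : 0 <= ramp t.
Proof. by have [/ramp_gt0/ltW//|/ramp_eq0->] := ltP 0 t. Qed.

(** A smooth step, 0 for [s <= 0] and 1 for [t <= 0]. It is used where [0 < s + t]: one argument is
    then positive, and so is the denominator. *)
Definition ratio (s t : R) : R := ramp s / (ramp s + ramp t).

Lemma ratio_den s t : 0 < s + t -> ramp s + ramp t != 0.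
Proof.
move=> st; rewrite gt_eqF//; have [s0|s0] := ltP 0 s.
  by rewrite ltr_wpDr ?ramp_ge0// ramp_gt0.
by rewrite ltr_wpDl ?ramp_ge0// ramp_gt0//; lra.
Qed.

Lemma ratio0 s t : s <= 0 -> ratio s t = 0.
Proof. by move=> /ramp_eq0 s0; rewrite /ratio s0 mul0r. Qed.

Lemma ratio1 s t : 0 < s + t -> t <= 0 -> ratio s t = 1.
Proof.
move=> st t0; have := ratio_den st; rewrite /ratio (ramp_eq0 t0) addr0 => s0.
by rewrite divff.
Qed.

Lemma smooth_ratio U (a b : 'rV[R]_n -> R) : open U ->
  (forall x, U x -> 0 < a x + b x) -> smooth_on U a -> smooth_on U b ->
  smooth_on U (fun x => ratio (a x) (b x)).
Proof.
move=> oU ab sa sb; apply: smoothM => //; first exact: smooth_exp_inv.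
apply: smoothV => //; first by move=> x Ux; apply: ratio_den; exact: ab.
by apply: smoothD => //; exact: smooth_exp_inv.
Qed.

(** A smooth companion of [wt P ^+ 2], comparable to it by [sqwt_le_wt] and [wt_le_sqwt]; cutoffs
    need it because of the absolute values in [wt]. *)
Definition sqwt (P : pred 'I_n) x : R := \sum_(i | P i) x 0 i ^+ 2.

Lemma sqwt_ge0 P x : 0 <= sqwt P x.
Proof. by apply: sumr_ge0 => i _; exact: sqr_ge0. Qed.

Lemma smooth_sqwt P U : open U -> smooth_on U (sqwt P).
Proof.
move=> oU; apply: smooth_sum => // i _.
by apply: smoothM => //; exact: smooth_coord.
Qed.

Lemma sqwtT_le x : sqwt xpredT x <= n%:R * `|x| ^+ 2.
Proof.
rewrite /sqwt; apply: (@le_trans _ _ (\sum_(i < n) `|x| ^+ 2)).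
  by apply: ler_sum => i _; rewrite -[x 0 i ^+ 2]real_normK ?num_real// lerXn2r ?nnegrE// row_norm_le.
by rewrite sumr_const card_ord -[_ *+ n]mulr_natl.
Qed.

Lemma norm_le_sqwt x : `|x| ^+ 2 <= sqwt xpredT x.
Proof.
rewrite -[leRHS]sqr_sqrtr ?sqwt_ge0// lerXn2r ?nnegrE ?sqrtr_ge0//.
apply: row_norm_ub => [|i]; first exact: sqrtr_ge0.
rewrite -sqrtr_sqr ler_wsqrtr// /sqwt (bigD1 i)//= lerDl.
by apply: sumr_ge0 => j _; exact: sqr_ge0.
Qed.

Lemma ex_bump : exists2 eta : 'rV[R]_n -> R, smooth_on setT eta &
  exists2 K : R, 1 < K & (forall x, `|x| <= 1 -> eta x = 1) /\
    (forall x, K <= `|x| -> eta x = 0).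
Proof.
(* The norm is the maximum norm, so the unit ball satisfies only [sqwt xpredT x <= n%:R]. The step
   runs from [n%:R] to [n%:R + 1], and the two arguments add up to 1. *)
pose a x : R := n%:R + 1 - sqwt xpredT x.
pose b x : R := sqwt xpredT x - n%:R.
exists (fun x => ratio (a x) (b x)).
  apply: smooth_ratio; first exact: openT.
  - by move=> x _; rewrite /a /b; lra.
  - by apply: smoothB; [exact: openT|exact: smooth_cst|apply: smooth_sqwt; exact: openT].
  - by apply: smoothB; [exact: openT|apply: smooth_sqwt; exact: openT|exact: smooth_cst].
exists (n%:R + 2); first by rewrite ltr_wpDl// ltr1n.
split=> x xK.
  apply: ratio1; first by rewrite /a /b; lra.
  rewrite /b subr_le0 (le_trans (sqwtT_le x))// ler_piMr// exprn_ile1//.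
apply: ratio0; rewrite /a subr_le0 (le_trans _ (norm_le_sqwt x))//.
have n0 : 0 <= n%:R :> R by [].
apply: (@le_trans _ _ ((n%:R + 2) ^+ 2)); first by nra.
by rewrite lerXn2r ?nnegrE// addr_ge0.
Qed.

(** A cutoff in the direction of [x]: division by [sqwt xpredT x] makes it homogeneous of degree 0.
    It is 1 near the subspace where the coordinates outside [P] vanish and 0 near the one where
    those in [P] vanish, the origin excepted. Off the origin the two arguments of [ratio] sum to
    3. *)
Definition cone (P : pred 'I_n) x : R :=
  ratio ((4 * sqwt P x - sqwt (predC P) x) / sqwt xpredT x)
        ((4 * sqwt (predC P) x - sqwt P x) / sqwt xpredT x).

Lemma sqwtC P x : sqwt P x + sqwt (predC P) x = sqwt xpredT x.
Proof. by rewrite /sqwt [RHS](bigID P). Qed.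

Lemma sqwt_gt0 x : x != 0 -> 0 < sqwt xpredT x.
Proof.
move=> x0; rewrite (lt_le_trans _ (norm_le_sqwt x))// exprn_gt0// normr_gt0//.
Qed.

Lemma cone_sum P x : x != 0 -> 0 < (4 * sqwt P x - sqwt (predC P) x) / sqwt xpredT x
  + (4 * sqwt (predC P) x - sqwt P x) / sqwt xpredT x.
Proof.
move=> x0; rewrite -mulrDl divr_gt0 ?sqwt_gt0//.
by have := sqwt_gt0 x0; rewrite -(sqwtC P x); lra.
Qed.

Lemma cone_smooth P : smooth_on [set x | x != 0] (cone P).
Proof.
have o0 : open [set x : 'rV[R]_n | x != 0].
  rewrite (_ : [set x | _] = (fun x : 'rV[R]_n => `|x|) @^-1` [set t | 0 < t]).
    apply: open_comp; last exact: open_gt.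
    by move=> x _; exact: norm_continuous.
  by apply/seteqP; split=> x /=; rewrite normr_gt0.
have sV : smooth_on [set x : 'rV[R]_n | x != 0] (fun x => (sqwt xpredT x)^-1).
  apply: smoothV => //; last exact: smooth_sqwt.
  by move=> x /= x0; rewrite gt_eqF// sqwt_gt0.
apply: smooth_ratio => //; first by move=> x; exact: cone_sum.
all: by apply: smoothM => //; apply: smoothB => //; try apply: smoothZ => //; exact: smooth_sqwt.
Qed.

Lemma sqwt_scale P (t : R) x : sqwt P (t *: x) = t ^+ 2 * sqwt P x.
Proof.
rewrite /sqwt mulr_sumr; apply: eq_bigr => i _.
by rewrite mxE exprMn.
Qed.

Lemma cone_scale P (t : R) x : 0 < t -> cone P (t *: x) = cone P x.
Proof.
move=> t0; have t2 : t ^+ 2 != 0 by rewrite expf_neq0// gt_eqF.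
rewrite /cone !sqwt_scale; congr ratio.
  by rewrite mulrCA -mulrBr -mulf_div divff// mul1r.
by rewrite mulrCA -mulrBr -mulf_div divff// mul1r.
Qed.

Lemma cone_eq0 P x : 4 * sqwt P x <= sqwt (predC P) x -> cone P x = 0.
Proof.
move=> h; apply: ratio0; rewrite mulr_le0_ge0 ?subr_le0// invr_ge0.
exact: sqwt_ge0.
Qed.

Lemma cone_eq1 P x : x != 0 -> 4 * sqwt (predC P) x <= sqwt P x -> cone P x = 1.
Proof.
move=> x0 h; apply: ratio1; first exact: cone_sum.
by rewrite mulr_le0_ge0 ?subr_le0// invr_ge0 sqwt_ge0.
Qed.

End cutoffs.

(** * Products of flat functions with homogeneous functions *)

Section homogeneous_multipliers.
Context {R : realType} {n : nat}.
Implicit Types (x v : 'rV[R]_n).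

Notation wtT := (wt (R := R) (n := n) xpredT).
Notation flat0 h := (forall k, tame k setT wtT (fun=> h)).
Notation U0 := [set x : 'rV[R]_n | x != 0].

Definition homogeneous m (h : 'rV[R]_n -> R) : Prop :=
  forall t x, 0 < t -> x != 0 -> h (t *: x) = (t ^+ m)^-1 * h x.

Lemma open_nonzero : open U0.
Proof.
rewrite (_ : [set x | _] = (fun x : 'rV[R]_n => `|x|) @^-1` [set t | 0 < t]).
  apply: open_comp; last exact: open_gt.
  by move=> x _; exact: norm_continuous.
by apply/seteqP; split=> x /=; rewrite normr_gt0.
Qed.

(** By homogeneity it suffices to bound [h] on the unit sphere, which is compact and avoids the
    singularity at the origin. *)
Lemma homogeneous_bound m h : smooth_on U0 h -> homogeneous m h ->
  exists2 C : R, 0 <= C & forall x, x != 0 -> `|h x| * wtT x ^+ m <= C.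
Proof.
move=> sh hh; pose A := [set x : 'rV[R]_n | `|x| = 1].
have cA : compact A.
  apply: bounded_closed_compact.
    by exists 1; split=> // M M1 x /= ->; exact: ltW.
  rewrite (_ : A = (fun x : 'rV[R]_n => `|x|) @^-1` [set t | t = 1])//.
  apply: closed_comp; last exact: closed_eq.
  by move=> x _; exact: norm_continuous.
have [x Ax|C bC] := bounded_on_compact (f := h) cA.
  apply/differentiable_continuous/(smooth_differentiable sh) => /=.
  by rewrite -normr_eq0 Ax oner_neq0.
exists (`|C| * n%:R ^+ m) => [|x x0]; first by rewrite mulr_ge0// exprn_ge0.
have nx0 : 0 < `|x| by rewrite normr_gt0.
pose y := `|x|^-1 *: x.
have xE : x = `|x| *: y by rewrite scalerA divff ?scale1r// gt_eqF.
have y1 : `|y| = 1 by rewrite normrZ ger0_norm ?invr_ge0// mulVf// gt_eqF.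
have y0 : y != 0 by rewrite -normr_eq0 y1 oner_neq0.
rewrite {1}xE hh// normrM normfV normrX (ger0_norm (ltW nx0)).
have -> : (`|x| ^+ m)^-1 * `|h y| * wtT x ^+ m = `|h y| * (wtT x / `|x|) ^+ m.
  by rewrite exprMn exprVn; ring.
have wx0 : 0 <= wtT x / `|x| by rewrite divr_ge0// wt_ge0.
rewrite ler_pM ?exprn_ge0//; first by rewrite (le_trans (bC y y1))// ler_norm.
by rewrite lerXn2r ?nnegrE// ler_pdivrMr// wtT_le.
Qed.

Lemma homogeneous_partial m h i : smooth_on U0 h -> homogeneous m h ->
  homogeneous m.+1 (partial i h).
Proof.
move=> sh hh t x t0 x0.
have t0' : t != 0 by rewrite gt_eqF.
have tx0 : t *: x != 0 by rewrite scaler_eq0 negb_or t0' x0.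
have dl j : differentiable (fun y : 'rV[R]_n => (t *: y) 0 j) x.
  rewrite (_ : (fun y => _) = fun y : 'rV[R]_n => t * y 0 j).
    by apply: differentiableM; [exact: differentiable_cst|exact: differentiable_coord].
  by apply/funext => y; rewrite mxE.
have dh y : y != 0 -> differentiable h y by move=> y0; exact: (smooth_differentiable sh).
have h1 : partial i (fun y => h (t *: y)) x = partial i h (t *: x) * t.
  rewrite partial_comp//; last exact: dh.
  have pl j : partial i (fun y : 'rV[R]_n => (t *: y) 0 j) x = t * (i == j)%:R.
    rewrite (_ : (fun y => _) = fun y : 'rV[R]_n => t * y 0 j).
      by rewrite partialZ ?partial_coord//; exact: differentiable_coord.
    by apply/funext => y; rewrite mxE.
  rewrite (bigD1 i)//= pl eqxx mulr1 big1 ?addr0// => j /negbTE ji.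
  by rewrite pl eq_sym ji !mulr0.
have h2 : partial i (fun y => h (t *: y)) x = (t ^+ m)^-1 * partial i h x.
  rewrite -partialZ; last exact: dh.
  apply: near_eq_partial; have := open_nbhs_nbhs (conj open_nonzero x0).
  by apply: filterS => y y0; rewrite hh.
by apply: (mulIf t0'); rewrite -h1 h2 exprS invfM [RHS]mulrC !mulrA mulfV// mul1r.
Qed.

Lemma flat_at0 h : (forall k, tame k setT wtT (fun=> h)) -> h 0 = 0.
Proof.
move=> fh; have [C C0 /(_ 0 I)] := flat_bound 1 fh.
by rewrite wt0 expr1 mulr0 normr_le0 => /eqP.
Qed.

(** A singularity of finite order [m] is absorbed by flatness, and differentiation of [h] only
    raises [m] to [m.+1]; hence both factors and [m] vary in the induction. At the origin the
    product is bounded by a square, so its differential there exists and is zero. *)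
Lemma flat_homogeneous k : forall (f h : 'rV[R]_n -> R) m, flat0 f ->
  smooth_on U0 h -> homogeneous m h -> tame k setT wtT (fun _ x => f x * h x).
Proof.
have bnd (f h : 'rV[R]_n -> R) m N : flat0 f -> smooth_on U0 h -> homogeneous m h ->
    exists2 C : R, 0 <= C & forall x, `|f x * h x| <= C * wtT x ^+ N.
  move=> ff sh hh; have [C C0 bC] := flat_bound (N + m) ff.
  have [D D0 bD] := homogeneous_bound sh hh.
  exists (C * D) => [|x]; first by rewrite mulr_ge0.
  have [->|x0] := eqVneq x 0.
    by rewrite (flat_at0 ff) mul0r normr0 !mulr_ge0// exprn_ge0// wt_ge0.
  rewrite normrM (@le_trans _ _ (C * wtT x ^+ (N + m) * `|h x|))//.
    by rewrite ler_wpM2r// bC.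
  have -> : C * wtT x ^+ (N + m) * `|h x| = C * (`|h x| * wtT x ^+ m) * wtT x ^+ N.
    by rewrite exprD; ring.
  by rewrite ler_wpM2r ?exprn_ge0 ?wt_ge0// ler_wpM2l// bD.
have dcy f h m : flat0 f -> smooth_on U0 h -> homogeneous m h ->
    decay setT wtT (fun _ x => f x * h x).
  move=> ff sh hh N; have [C C0 bC] := bnd f h m N ff sh hh.
  exists C => // j x _; split; first exact: bC.
  by rewrite subrr normr0 !mulr_ge0 ?exprn_ge0 ?wt_ge0.
elim: k => [|k IH] f h m ff sh hh; first by split=> //; exact: (dcy f h m).
split; first exact: (dcy f h m).
have df y : differentiable f y by exact: (smooth_differentiable (flat_smooth ff)).
have at0 : differentiable (fun x => f x * h x) 0 /\
    forall i, partial i (fun x => f x * h x) 0 = 0.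
  have [C C0 bC] := bnd f h m 2%N ff sh hh.
  apply: (@differentiable_quad _ _ _ _ _ (C * n%:R ^+ 2) 1) => // v _.
  rewrite add0r (flat_at0 ff) mul0r subr0 big1 ?subr0; last by move=> i _; rewrite mul0r.
  rewrite (le_trans (bC v))// -mulrA ler_wpM2l// -exprMn.
  by rewrite lerXn2r ?nnegrE ?wt_ge0 ?mulr_ge0// wtT_le.
split=> [_ x _|i].
  have [->|x0] := eqVneq x 0; first by have [] := at0.
  by apply: differentiableM => //; exact: (smooth_differentiable sh).
have t1 := IH _ _ _ (flat_partial i ff) sh hh.
have t2 := IH _ _ _ ff (smooth_partial i sh) (homogeneous_partial i sh hh).
apply: (tame_ext openT _ (tameD openT (fun x _ => wt_ge0 _ x) t1 t2)) => _ x _ /=.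
have [->|x0] := eqVneq x 0.
  by have [_ ->] := at0; rewrite (flat_at0 ff) (flat_at0 (flat_partial i ff)) !mul0r addr0.
by rewrite partialM//; exact: (smooth_differentiable sh).
Qed.

End homogeneous_multipliers.

(** * Borel's lemma *)

Section borel.
Context {R : realType} {n : nat}.
Implicit Types (x v : 'rV[R]_n) (f g h : 'rV[R]_n -> R).
Notation smth f := (smooth_on setT f).

Fixpoint bounded_derivs m (B : R) h : Prop :=
  (forall x, `|h x| <= B) /\
  if m is m'.+1 then forall i, bounded_derivs m' B (partial i h) else True.

Lemma bounded_derivs_le m B B' h : B <= B' -> bounded_derivs m B h ->
  bounded_derivs m B' h.
Proof.
move=> BB; elim: m h => [|m IH] h [bh ph]; split=> //;
  try by move=> x; exact: le_trans (bh x) BB.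
by move=> i; exact/IH/ph.
Qed.

Lemma bounded_derivsW m k B h : bounded_derivs (k + m) B h -> bounded_derivs m B h.
Proof.
elim: k => [|k IH] //; rewrite addSn => bh; apply: IH.
elim: (k + m)%N h bh => [|d IH] h /= [bh ph]; split=> // i.
by apply: IH; exact: ph.
Qed.

Lemma partial_eq0 (K : R) h i : (forall x, K < `|x| -> h x = 0) ->
  forall x, K < `|x| -> partial i h x = 0.
Proof.
move=> h0 x Kx; rewrite (@near_eq_partial _ _ _ (fun=> 0)) ?partial_cst//.
have oK : open [set y : 'rV[R]_n | K < `|y|].
  rewrite (_ : [set y | _] = (fun x : 'rV[R]_n => `|x|) @^-1` [set t | K < t])//.
  by apply: open_comp; [move=> y _; exact: norm_continuous|exact: open_gt].
by apply: filterS (open_nbhs_nbhs (conj oK Kx)) => y; exact: h0.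
Qed.

Lemma compact_support_bounded_derivs m (K : R) h : smth h ->
  (forall x, K < `|x| -> h x = 0) -> exists2 B : R, 0 <= B & bounded_derivs m B h.
Proof.
elim: m h => [|m IH] h sh h0.
  have [C bC] := bounded_ball K sh; exists `|C| => //; split=> // x.
  have [xK|Kx] := leP `|x| K; last by rewrite h0// normr0.
  by rewrite (le_trans (bC x xK))// ler_norm.
have [C bC] := bounded_ball K sh.
have /choice[B bB] : forall i, exists B : R, 0 <= B /\ bounded_derivs m B (partial i h).
  move=> i; have [B B0 bB] := IH _ (smooth_partial i sh) (partial_eq0 i h0).
  by exists B.
have sB : 0 <= \sum_i B i by apply: sumr_ge0 => i _; have [] := bB i.
exists (`|C| + \sum_i B i); first by rewrite addr_ge0.
split=> [x|i].
  have [xK|Kx] := leP `|x| K; last by rewrite h0// normr0 addr_ge0.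
  by rewrite (le_trans (bC x xK))// (le_trans (ler_norm _))// lerDl.
have [Bi0 bBi] := bB i; apply: bounded_derivs_le bBi.
rewrite (bigD1 i)//= addrCA lerDl addr_ge0// sumr_ge0// => j _.
by have [] := bB j.
Qed.

Lemma partial_scale h (e : R) x i : smth h ->
  partial i (fun y => h (e *: y)) x = e * partial i h (e *: x).
Proof.
move=> sh.
have cE j : (fun y : 'rV[R]_n => (e *: y) 0 j) = fun y : 'rV[R]_n => e * y 0 j.
  by apply/funext => y; rewrite mxE.
rewrite partial_comp; last 2 first.
- move=> j; rewrite cE; apply: differentiableM; first exact: differentiable_cst.
  exact: differentiable_coord.
- exact: (smooth_differentiable sh).
rewrite (bigD1 i)//= cE partialZ ?partial_coord; last exact: differentiable_coord.
rewrite eqxx mulr1 big1 ?addr0 1?mulrC// => j /negbTE ji.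
by rewrite cE partialZ ?partial_coord 1?eq_sym ?ji ?mulr0//; exact: differentiable_coord.
Qed.

Lemma smooth_scale h (e : R) : smth h -> smth (fun y => h (e *: y)).
Proof.
move=> sh; apply: (smooth_comp (W := setT)) => //; first exact: openT.
move=> j; rewrite (_ : (fun y => _) = fun y : 'rV[R]_n => e * y 0 j).
  by apply: smoothZ; [exact: openT|exact: smooth_coord].
by apply/funext => y; rewrite mxE.
Qed.

(** Each derivative costs one factor [e] out of [e ^+ d]. At most [m < d] derivatives are taken, so
    one factor [e] remains to make the bound small: the mechanism of Borel's lemma. *)
Lemma bounded_derivs_scale m B d (e : R) h : smth h -> 0 <= B -> 0 < e <= 1 ->
  (m < d)%N -> bounded_derivs m B h ->
  bounded_derivs m (e * B) (fun x => e ^+ d * h (e^-1 *: x)).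
Proof.
move=> sh B0 /andP[e0 e1]; have e0' := ltW e0.
have main d' (h' : 'rV[R]_n -> R) : (forall x, `|h' x| <= B) ->
    forall x, `|e ^+ d'.+1 * h' (e^-1 *: x)| <= e * B.
  move=> bh x; rewrite normrM (ger0_norm (exprn_ge0 _ e0')) ler_pM ?exprn_ge0//.
  by rewrite exprS ler_piMr// exprn_ile1.
elim: m d h sh => [|m IH] [|d] h sh // md [bh ph]; split=> //.
- exact: main.
- exact: main.
- move=> i; rewrite (_ : partial i _ = fun x => e ^+ d * partial i h (e^-1 *: x)).
    by apply: IH => //; [exact: smooth_partial|exact: ph].
  apply/funext => x; rewrite partialZ.
    rewrite partial_scale// exprS mulrA; congr (_ * _).
    by rewrite mulrAC mulfV ?mul1r// gt_eqF.
  by apply: (smooth_differentiable (U := setT)) => //; exact: smooth_scale.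
Qed.

Lemma tame_series m (s : nat -> 'rV[R]_n -> R) : (forall k, smth (s k)) ->
  (exists2 C : R, 0 <= C & forall k, bounded_derivs m (C * 2^-1 ^+ k) (s k)) ->
  tame m setT one_wt (fun j x => \sum_(k < j) s k x).
Proof.
have dcy (t : nat -> 'rV[R]_n -> R) : (exists2 C : R, 0 <= C & forall k x, `|t k x| <= C * 2^-1 ^+ k) ->
    decay setT one_wt (fun j x => \sum_(k < j) t k x).
  move=> [C C0 bC] N; exists (C * 2) => [|j x _]; first by rewrite mulr_ge0.
  rewrite expr1n !mulr1; split.
    suff : `|\sum_(k < j) t k x| <= C * (2 - 2 * 2^-1 ^+ j).
      move=> /le_trans; apply; rewrite ler_wpM2l// lerBlDr lerDl.
      by rewrite mulr_ge0// exprn_ge0.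
    elim: j => [|j IH]; first by rewrite big_ord0 normr0 expr0 mulr1 subrr mulr0.
    rewrite big_ord_recr /= (le_trans (ler_normD _ _))// (le_trans (lerD IH (bC j x)))//.
    by rewrite exprS le_eqVlt; apply/orP; left; apply/eqP; field.
  rewrite big_ord_recr /= addrAC subrr add0r (le_trans (bC j x))//.
  by rewrite ler_wpM2r ?exprn_ge0// ler_peMr// ler1n.
elim: m s => [|m IH] s ss [C C0 bC].
  split=> //; apply: dcy; exists C => // k; exact: (bC k).1.
split; first by apply: dcy; exists C => // k; exact: (bC k).1.
split=> [j x _|i].
  apply: (smooth_differentiable (U := setT)) => //; apply: smooth_sum => //.
  exact: openT.
apply: (tame_ext openT _ (IH (fun k => partial i (s k)) _ _)).
- move=> j x _; rewrite partial_sum// => k; exact: (smooth_differentiable (ss k)).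
- by move=> k; exact: smooth_partial.
- by exists C => // k; have [_] := bC k; exact.
Qed.

Lemma vanish_flim d (h : nat -> 'rV[R]_n -> R) g J :
  (forall m, tame m setT one_wt h) -> smth g ->
  (forall j, (J <= j)%N -> vanish d (fun x => h j x - g x)) ->
  vanish d (fun x => flim h x - g x).
Proof.
elim: d h g => //= d IH h g th sg vh; split.
  have c1 := flim_cvg (tame_decay (th 0%N)) (I : setT (0 : 'rV[R]_n)).
  suff -> : flim h 0 = g 0 by rewrite subrr.
  apply: (cvg_unique _ c1); first exact: norm_hausdorff.
  apply: cvg_near_cst; near=> j; apply/eqP; rewrite -subr_eq0.
  by apply/eqP; have [] := vh j _ => //; near: j; exact: nbhs_infty_ge.
move=> i.
have sh j : smth (h j) := tame_smooth j th.
rewrite (_ : partial i _ = fun x => flim (fun j => partial i (h j)) x - partial i g x).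
  apply: IH => [m||j Jj]; first by have [_ [_]] := th m.+1; exact.
    exact: smooth_partial.
  have [_ /(_ i)] := vh j Jj; congr vanish; apply/funext => x.
  rewrite -[fun x => _]/(fun x => h j x - g x) /partial deriveB//;
    by apply: diff_derivable; exact: (smooth_differentiable (U := setT)).
apply/funext => x; have [df <-] := flim_partial openT (th 2%N) (I : setT x).
rewrite /partial deriveB//; apply: diff_derivable => //.
exact: (smooth_differentiable sg).
Unshelve. all: by end_near. Qed.

(* A homogeneous polynomial of degree d, coded by splitting off one coordinate
   at a time. *)
Fixpoint hompoly d (P : 'rV[R]_n -> R) : Prop :=
  if d is d'.+1 then exists2 Q : 'I_n -> 'rV[R]_n -> R,
    forall i, hompoly d' (Q i) & P = fun x => \sum_i x 0 i * Q i x
  else exists a, P = fun=> a.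

Lemma hompoly_smooth d P : hompoly d P -> smth P.
Proof.
elim: d P => [|d IH] P /=; first by move=> [a ->]; exact: smooth_cst.
move=> [Q hQ ->]; apply: smooth_sum => [|i _]; first exact: openT.
by apply: smoothM; [exact: openT|exact: smooth_coord|exact/IH/hQ].
Qed.

Lemma hompoly_vanish d P : hompoly d P -> vanish d P.
Proof.
elim: d P => [|d IH] P //= [Q hQ ->].
have sQ i : smth (Q i) by exact: hompoly_smooth (hQ i).
apply: (@vanish_sum _ _ d.+1) => i.
  by apply: smoothM; [exact: openT|exact: smooth_coord|].
by apply: (vanishM (d := 1) (e := d)) => //; [exact: smooth_coord|exact: vanish_coord|exact: IH].
Qed.

Lemma hompoly_scale d P (t : R) x : hompoly d P -> P (t *: x) = t ^+ d * P x.
Proof.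
elim: d P => [|d IH] P /=; first by move=> [a ->]; rewrite mul1r.
move=> [Q hQ ->]; rewrite mulr_sumr; apply: eq_bigr => i _.
by rewrite mxE IH// exprS; ring.
Qed.

(** The [k]-th term is cut off on a ball shrinking with [k], so fast that its derivatives of order
    at most [k] are below [2^-1 ^+ k]. Degrees start at 2 because the identity is added separately
    in [formal_linearization]. *)
Lemma borel (P : nat -> 'rV[R]_n -> R) : (forall k, hompoly k.+2 (P k)) ->
  exists2 F, smth F & forall d, vanish d.+2 (fun x => F x - \sum_(k < d) P k x).
Proof.
move=> hP; have [eta seta [K K1 [eta1 eta0]]] := @ex_bump R n.
have sP k := hompoly_smooth (hP k).
pose q k x := eta x * P k x.
have sq k : smth (q k) by apply: smoothM => //; exact: openT.
have /choice[B bB] : forall k, exists B : R, 0 <= B /\ bounded_derivs k B (q k).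
  move=> k; have [|B B0 bB] := @compact_support_bounded_derivs k K (q k) (sq k).
    by move=> x Kx; rewrite /q eta0 ?mul0r// ltW.
  by exists B.
have B0 k : 0 <= B k by have [] := bB k.
have B1 k : 0 < 1 + B k by rewrite ltr_wpDr.
(* Chosen so that [e k * B k <= 2^-1 ^+ k] and [e k <= 1]. *)
pose e k : R := 2^-1 ^+ k / (1 + B k).
have e01 k : 0 < e k <= 1.
  rewrite divr_gt0 ?exprn_gt0//= ler_pdivrMr// mul1r.
  by rewrite (@le_trans _ _ 1)// ?lerDl// exprn_ile1// invf_le1// ler1n.
pose s k x := e k ^+ k.+2 * q k ((e k)^-1 *: x).
have sE k x : s k x = eta ((e k)^-1 *: x) * P k x.
  rewrite /s /q (hompoly_scale _ _ (hP k)) exprVn mulrCA mulVKf//.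
  by rewrite expf_neq0// gt_eqF//; case/andP: (e01 k).
have ss k : smth (s k).
  by apply: smoothZ; [exact: openT|exact: smooth_scale].
have bs k : bounded_derivs k (2^-1 ^+ k) (s k).
  have [_ bBk] := bB k.
  apply: bounded_derivs_le (bounded_derivs_scale (sq k) (B0 k) (e01 k) _ bBk) => //.
  rewrite /e -mulrA ler_piMr ?exprn_ge0// mulrC ler_pdivrMr// mul1r.
  by rewrite lerDr.
have ts m : tame m setT one_wt (fun j x => \sum_(k < j) s k x).
  apply: tame_series => //.
  have /choice[D bD] : forall k, exists D : R, 0 <= D /\ bounded_derivs m D (s k).
    move=> k; have [|D D0 bD] := @compact_support_bounded_derivs m (K * e k) (s k) (ss k).
      move=> x Kx; rewrite sE eta0 ?mul0r//.
      have /andP[ek0 _] := e01 k.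
      have eV : 0 <= (e k)^-1 by rewrite invr_ge0 ltW.
      by rewrite normrZ ger0_norm// mulrC ler_pdivlMr// ltW.
    by exists D.
  have D0 k : 0 <= D k by have [] := bD k.
  have S0 : 0 <= \sum_(k < m) D k * 2 ^+ k.
    by apply: sumr_ge0 => k _; rewrite mulr_ge0// exprn_ge0.
  (* The bound [bs] controls order [m] only from the term [k = m] on; the finitely many earlier
     terms are absorbed by the constant. *)
  exists (1 + \sum_(k < m) D k * 2 ^+ k) => [|k]; first by rewrite addr_ge0.
  have [mk|km] := leqP m k.
    have := bs k; rewrite -{1}(subnK mk) => /bounded_derivsW; apply: bounded_derivs_le.
    by rewrite ler_peMl ?exprn_ge0// lerDl.
  have [_ bDk] := bD k; apply: bounded_derivs_le bDk.
  rewrite exprVn ler_pdivlMr ?exprn_gt0// (bigD1 (Ordinal km))//= addrCA lerDl.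
  by rewrite addr_ge0// sumr_ge0// => j _; rewrite mulr_ge0// exprn_ge0.
exists (flim (fun j x => \sum_(k < j) s k x)).
  by apply: flim_smooth ts; exact: openT.
move=> d; apply: (vanish_flim (J := d) ts) => [|j dj].
  by apply: smooth_sum => //; exact: openT.
rewrite (_ : (fun x => _) = fun x => \sum_(k < j) (s k x - (if (k < d)%N then P k x else 0))); last first.
  apply/funext => x; rewrite sumrB; congr (_ - _).
  by rewrite (big_ord_widen j (fun k => P k x) dj) big_mkcond.
have sif k : smth (fun x => if (k < d)%N then P k x else 0).
  by case: (k < d)%N; [exact: sP|exact: smooth_cst].
apply: vanish_sum => k; first by apply: smoothB => //; exact: openT.
have [kd|dk] := ltnP k d.
  have /andP[ek0 _] := e01 k.
  apply: (@vanish_ext _ _ (ball 0 (e k)) _ (fun=> 0)); last exact: vanish0.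
  - exact: ball_open.
  - exact: ballxx.
  - move=> x; rewrite -ball_normE /= sub0r normrN => xe.
    have eV : 0 <= (e k)^-1 by rewrite invr_ge0 ltW.
    rewrite sE eta1 ?mul1r ?subrr// normrZ ger0_norm//.
    by rewrite mulrC ler_pdivrMr// mul1r ltW.
rewrite (_ : (fun x => _) = fun x => eta ((e k)^-1 *: x) * P k x); last first.
  by apply/funext => x; rewrite subr0 sE.
apply: (vanishM (d := 0) (e := k.+2)) => //; first exact: smooth_scale.
exact: hompoly_vanish.
Qed.

End borel.

Definition rowf {R : realType} {n m : nat} (F : 'I_m -> 'rV[R]_n -> R)
  (x : 'rV[R]_n) : 'rV[R]_m := \row_i F i x.

(** * Formal linearization *)

Section formal_linearization.
Context {R : realType} {n : nat}.
Implicit Types (x v : 'rV[R]_n) (f g h : 'rV[R]_n -> R).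
Notation smth f := (smooth_on setT f).

Lemma smth_differentiable f x : smth f -> differentiable f x.
Proof. by move=> sf; exact: (smooth_differentiable sf). Qed.

Lemma smth_comp f (F : 'I_n -> 'rV[R]_n -> R) : smth f -> (forall i, smth (F i)) ->
  smth (fun x => f (rowf F x)).
Proof.
move=> sf sF; apply: (smooth_comp (W := setT)) => //; first exact: openT.
move=> j; rewrite (_ : (fun x => _) = F j)//.
by apply/funext => x; rewrite mxE.
Qed.

Lemma partial_comp_rowf f (F : 'I_n -> 'rV[R]_n -> R) x i : smth f ->
  (forall i, smth (F i)) ->
  partial i (fun y => f (rowf F y)) x =
  \sum_l partial l f (rowf F x) * partial i (F l) x.
Proof.
move=> sf sF.
have FE l : (fun y => rowf F y 0 l) = F l by apply/funext => y; rewrite mxE.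
rewrite partial_comp; last exact: smth_differentiable.
  by apply: eq_bigr => l _; rewrite FE.
by move=> l; rewrite FE; exact: smth_differentiable.
Qed.

Lemma rowf0 (F : 'I_n -> 'rV[R]_n -> R) : (forall i, F i 0 = 0) -> rowf F 0 = 0.
Proof. by move=> F0; apply/rowP => i; rewrite !mxE F0. Qed.

Lemma vanish_comp d f (F : 'I_n -> 'rV[R]_n -> R) : smth f ->
  (forall i, smth (F i)) -> (forall i, F i 0 = 0) -> vanish d f ->
  vanish d (fun x => f (rowf F x)).
Proof.
elim: d f => //= d IH f sf sF F0 [f0 vf]; split; first by rewrite rowf0.
move=> i; rewrite (_ : partial i _ =
    fun x => \sum_l partial l f (rowf F x) * partial i (F l) x); last first.
  by apply/funext => x; exact: partial_comp_rowf.
apply: vanish_sum => l.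
  apply: smoothM; [exact: openT| |exact: smooth_partial].
  by apply: smth_comp => //; exact: smooth_partial.
apply: (vanishM (d := d) (e := 0)) => //; first by rewrite addn0.
- by apply: smth_comp => //; exact: smooth_partial.
- exact: smooth_partial.
- by apply: IH => //; exact: smooth_partial.
Qed.

Let partialB f g x i : smth f -> smth g ->
  partial i (fun y => f y - g y) x = partial i f x - partial i g x.
Proof.
move=> sf sg; rewrite /partial -deriveB//; exact/diff_derivable/smth_differentiable.
Qed.

Let partial_add f g x i : smth f -> smth g ->
  partial i (fun y => f y + g y) x = partial i f x + partial i g x.
Proof. by move=> sf sg; rewrite partialD//; exact: smth_differentiable. Qed.

Lemma vanish_increment d f (F P : 'I_n -> 'rV[R]_n -> R) : smth f ->
  (forall i, smth (F i)) -> (forall i, smth (P i)) -> (forall i, vanish d (P i)) ->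
  vanish d (fun x => f (rowf (fun i y => F i y + P i y) x) - f (rowf F x)).
Proof.
move=> + sF sP; have sFP i : smth (fun y => F i y + P i y).
  by apply: smoothD => //; exact: openT.
elim: d f => // d IH f sf vP.
have P0 i : P i 0 = 0 by have [] := vP i.
have vP' i : vanish d (P i) by exact: vanishW.
split.
  rewrite (_ : rowf _ 0 = rowf F 0) ?subrr//.
  by apply/rowP => i; rewrite !mxE P0 addr0.
move=> i; set G := fun i y => F i y + P i y.
rewrite (_ : partial i _ = fun x => \sum_l
   ((partial l f (rowf G x) - partial l f (rowf F x)) * partial i (F l) x +
    partial l f (rowf G x) * partial i (P l) x)); last first.
  apply/funext => x; rewrite partialB; [|exact: smth_comp|exact: smth_comp].
  rewrite !partial_comp_rowf// -sumrB; apply: eq_bigr => l _.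
  by rewrite /G partial_add//; ring.
have sl l : smth (partial l f) by exact: smooth_partial.
have sG l : smth (fun x => partial l f (rowf G x)) by exact: smth_comp.
have sFl l : smth (fun x => partial l f (rowf F x)) by exact: smth_comp.
have sd l : smth (fun x => partial l f (rowf G x) - partial l f (rowf F x)).
  by apply: smoothB => //; exact: openT.
have sFi l : smth (partial i (F l)) by exact: smooth_partial.
have sPi l : smth (partial i (P l)) by exact: smooth_partial.
apply: vanish_sum => l; first by apply: smoothD; [exact: openT| |]; (apply: smoothM => //; exact: openT).
apply: vanishD; try by apply: smoothM => //; exact: openT.
  by apply: (vanishM (d := d) (e := 0)) => //; [rewrite addn0|exact: IH].
by apply: (vanishM (d := 0) (e := d)) => //; have [_] := vP l; exact.
Qed.

(** One order more than in [vanish_increment]: to leading order the increment is [P] times first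
    derivatives of [f], and these vanish at the origin. *)
Lemma vanish_increment_flat d f (F P : 'I_n -> 'rV[R]_n -> R) : smth f ->
  (forall l, partial l f 0 = 0) ->
  (forall i, smth (F i)) -> (forall i, smth (P i)) -> (forall i, F i 0 = 0) ->
  (forall i, vanish d.+1 (P i)) ->
  vanish d.+2 (fun x => f (rowf (fun i y => F i y + P i y) x) - f (rowf F x)).
Proof.
move=> sf df0 sF sP F0 vP; have sFP i : smth (fun y => F i y + P i y).
  by apply: smoothD => //; exact: openT.
have P0 i : P i 0 = 0 by have [] := vP i.
split.
  rewrite (_ : rowf _ 0 = rowf F 0) ?subrr//.
  by apply/rowP => i; rewrite !mxE P0 addr0.
move=> i; set G := fun i y => F i y + P i y.
rewrite (_ : partial i _ = fun x => \sum_l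
   ((partial l f (rowf G x) - partial l f (rowf F x)) * partial i (F l) x +
    partial l f (rowf G x) * partial i (P l) x)); last first.
  apply/funext => x; rewrite partialB; [|exact: smth_comp|exact: smth_comp].
  rewrite !partial_comp_rowf// -sumrB; apply: eq_bigr => l _.
  by rewrite /G partial_add//; ring.
have sl l : smth (partial l f) by exact: smooth_partial.
have sG l : smth (fun x => partial l f (rowf G x)) by exact: smth_comp.
have sFl l : smth (fun x => partial l f (rowf F x)) by exact: smth_comp.
have sd l : smth (fun x => partial l f (rowf G x) - partial l f (rowf F x)).
  by apply: smoothB => //; exact: openT.
have sFi l : smth (partial i (F l)) by exact: smooth_partial.
have sPi l : smth (partial i (P l)) by exact: smooth_partial.
apply: vanish_sum => l; first by apply: smoothD; [exact: openT| |]; (apply: smoothM => //; exact: openT).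
apply: vanishD; try by apply: smoothM => //; exact: openT.
  apply: (vanishM (d := d.+1) (e := 0)) => //; first by rewrite addn0.
  by apply: vanish_increment.
apply: (vanishM (d := 1) (e := d)) => //; last by have [_] := vP l; exact.
apply: (vanish_comp (d := 1)) => //.
by move=> j; rewrite /G F0 P0 addr0.
Qed.

Variable lam : 'I_n -> R.

(** The derivative along the linear field. [Vlin (F i) x = V i (rowf F x)] for all [i] says that [F]
    carries the linear field to [V]. *)
Definition Vlin f x : R := \sum_j lam j * x 0 j * partial j f x.

Lemma smooth_Vlin f : smth f -> smth (Vlin f).
Proof.
move=> sf; apply: smooth_sum => [|j _]; first exact: openT.
apply: smoothM; [exact: openT| |exact: smooth_partial].
by apply: smoothZ; [exact: openT|exact: smooth_coord].
Qed.

Lemma VlinD f g x : smth f -> smth g -> Vlin (fun y => f y + g y) x = Vlin f x + Vlin g x.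
Proof.
move=> sf sg; rewrite /Vlin -big_split; apply: eq_bigr => j _ /=.
by rewrite partial_add// mulrDr.
Qed.

Lemma Vlin_coordM f x i : smth f ->
  Vlin (fun y => y 0 i * f y) x = lam i * x 0 i * f x + x 0 i * Vlin f x.
Proof.
move=> sf; rewrite /Vlin mulr_sumr.
have E j : partial j (fun y => y 0 i * f y) x = (j == i)%:R * f x + x 0 i * partial j f x.
  rewrite partialM ?partial_coord//; last exact: smth_differentiable.
  exact: differentiable_coord.
under eq_bigr do rewrite E mulrDr.
rewrite big_split /=; congr (_ + _); last by apply: eq_bigr => j _; ring.
rewrite (bigD1 i)//= eqxx mul1r big1 ?addr0// => j /negbTE ->.
by rewrite mul0r mulr0.
Qed.

Lemma vanish_Vlin d f : smth f -> vanish d f -> vanish d (Vlin f).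
Proof.
move=> sf vf; apply: vanish_sum => j.
  apply: smoothM; [exact: openT| |exact: smooth_partial].
  by apply: smoothZ; [exact: openT|exact: smooth_coord].
case: d vf => // d [_ vf].
apply: (vanishM (d := 1) (e := d)) => //.
- by apply: smoothZ; [exact: openT|exact: smooth_coord].
- exact: smooth_partial.
- by apply: vanishZ; [exact: smooth_coord|exact: vanish_coord].
- exact: vf.
Qed.

(** Induction on the degree replaces monomials: after division of [E] by the coordinates,
    [Vlin_coordM] turns the equation for [x 0 i * P] with [mu] into one for [P] with [mu - lam i]. A
    resonance of the latter in degree [d] would be one of the former in degree [d.+1]. In degree 0
    it remains to divide by [mu]. *)
Lemma solve_homological d (mu : R) E : smth E -> vanish d E ->
  (forall a : 'I_n -> nat, (\sum_j a j)%N = d -> \sum_j (a j)%:R * lam j <> mu) ->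
  exists2 P, hompoly d P & vanish d.+1 (fun x => E x + Vlin P x - mu * P x).
Proof.
elim: d mu E => [|d IH] mu E sE vE nr.
  have mu0 : mu != 0.
    apply/eqP => mu0; apply: (nr (fun=> 0%N)); first by rewrite big1.
    by rewrite mu0 big1// => j _; rewrite mul0r.
  exists (fun=> E 0 / mu); first by exists (E 0 / mu).
  split=> //; rewrite /Vlin big1 ?addr0; last by move=> j _; rewrite mxE mulr0 mul0r.
  by rewrite mulrC divfK// subrr.
have [g [sg vg gE]] := vanish_hadamard sE vE.
have /choice[P hP] : forall i, exists P, hompoly d P /\
    vanish d.+1 (fun x => g i x + Vlin P x - (mu - lam i) * P x).
  move=> i; have [|P hP vP] := IH (mu - lam i) (g i) (sg i) (vg i); last by exists P.
  move=> a sa ea; apply: (nr (fun j => a j + (j == i))%N).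
    rewrite big_split /= sa (bigD1 i)//= eqxx big1 => [|j /negbTE ->//].
    by rewrite addn0 addn1.
  under eq_bigr do rewrite natrD mulrDl.
  rewrite big_split /= ea (bigD1 i)//= eqxx mul1r big1 ?addr0 ?subrK// => j /negbTE ->.
  by rewrite mul0r.
have sP i : smth (P i) by have [hPi _] := hP i; exact: hompoly_smooth hPi.
exists (fun x => \sum_i x 0 i * P i x).
  by exists P => // i; have [] := hP i.
have VE x : Vlin (fun y => \sum_i y 0 i * P i y) x =
    \sum_i (lam i * x 0 i * P i x + x 0 i * Vlin (P i) x).
  rewrite /Vlin.
  have pE j : partial j (fun y => \sum_i y 0 i * P i y) x =
      \sum_i partial j (fun y => y 0 i * P i y) x.
    apply: partial_sum => i; apply: smth_differentiable.
    by apply: smoothM; [exact: openT|exact: smooth_coord|].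
  under eq_bigr do rewrite pE mulr_sumr.
  rewrite exchange_big /=; apply: eq_bigr => i _.
  exact: Vlin_coordM.
rewrite (_ : (fun x => _) = fun x => \sum_i x 0 i * (g i x + Vlin (P i) x - (mu - lam i) * P i x)).
  have sq i : smth (fun x => g i x + Vlin (P i) x - (mu - lam i) * P i x).
    apply: smoothB; [exact: openT| |by apply: smoothZ; [exact: openT|]].
    by apply: smoothD; [exact: openT| |exact: smooth_Vlin].
  apply: vanish_sum => i; first by apply: smoothM; [exact: openT|exact: smooth_coord|].
  apply: (vanishM (d := 1) (e := d.+1)) => //; [exact: smooth_coord|exact: vanish_coord|].
  by have [] := hP i.
apply/funext => x; rewrite VE gE mulr_sumr -big_split -sumrB; apply: eq_bigr => i _ /=.
by ring.
Qed.

Variable V : 'I_n -> 'rV[R]_n -> R.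
Hypothesis sV : forall i, smth (V i).
Hypothesis V0 : forall i, V i 0 = 0.
Hypothesis dV0 : forall i j, partial j (V i) 0 = lam i * (j == i)%:R.
Hypothesis nlin : N_linearity lam.

Let defect (F : 'I_n -> 'rV[R]_n -> R) i x := Vlin (F i) x - V i (rowf F x).

Let good d (F : 'I_n -> 'rV[R]_n -> R) := [/\ forall i, smth (F i),
  forall i, F i 0 = 0 & forall i, vanish d.+2 (defect F i)].

Let smooth_defect F i : (forall i, smth (F i)) -> smth (defect F i).
Proof.
move=> sF; apply: smoothB; [exact: openT|exact: smooth_Vlin|].
exact: smth_comp.
Qed.

(* Only the linear part of the increment of [V] matters at leading order. *)
Let correction (F P : 'I_n -> 'rV[R]_n -> R) i x :=
  (V i (rowf (fun i y => F i y + P i y) x) - lam i * (F i x + P i x)) -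
  (V i (rowf F x) - lam i * F i x).

Let vanish_correction d F P i : (forall i, smth (F i)) -> (forall i, smth (P i)) ->
  (forall i, F i 0 = 0) -> (forall i, vanish d.+1 (P i)) ->
  vanish d.+2 (correction F P i).
Proof.
move=> sF sP F0 vP; pose K y := V i y - lam i * y 0 i.
have sl : smth (fun y : 'rV[R]_n => lam i * y 0 i).
  by apply: smoothZ; [exact: openT|exact: smooth_coord].
have sK : smth K by apply: smoothB => //; exact: openT.
rewrite (_ : correction _ _ _ =
    fun x => K (rowf (fun i y => F i y + P i y) x) - K (rowf F x)).
  apply: vanish_increment_flat => // l.
  rewrite partialB// dV0 partialZ; last exact: differentiable_coord.
  by rewrite partial_coord subrr.
by apply/funext => x; rewrite /K /correction !mxE.
Qed.

(** The homological equation cancels the part of degree [d.+2] of the defect, and the nonlinear part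
    of [V] adds only terms of higher order by [vanish_correction]. The degree is at least 2, as
    N-linearity requires. *)
Let step d F : good d F -> exists P : 'I_n -> 'rV[R]_n -> R,
  (forall i, hompoly d.+2 (P i)) /\ good d.+1 (fun i y => F i y + P i y).
Proof.
move=> [sF F0 vF].
have /choice[P hP] : forall i, exists P, hompoly d.+2 P /\
    vanish d.+3 (fun x => defect F i x + Vlin P x - lam i * P x).
  move=> i; have [|P hP vP] := solve_homological (smooth_defect i sF) (vF i) (mu := lam i).
    move=> a sa ea; apply: (nlin (i := i) (a := a)); first by rewrite sa.
    by rewrite ea subrr.
  by exists P.
have sP i : smth (P i) by have [hPi _] := hP i; exact: hompoly_smooth hPi.
have vP i : vanish d.+2 (P i) by have [hPi _] := hP i; exact: hompoly_vanish hPi.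
exists P; split; first by move=> i; have [] := hP i.
split=> [i|i|i].
- by apply: smoothD => //; exact: openT.
- by rewrite F0 add0r; have [] := vP i.
have sC : smth (correction F P i).
  have sFP j : smth (fun y => F j y + P j y) by apply: smoothD => //; exact: openT.
  apply: smoothB; [exact: openT| |]; apply: smoothB; try exact: openT.
  + exact: smth_comp.
  + by apply: smoothZ => //; exact: openT.
  + exact: smth_comp.
  + by apply: smoothZ => //; exact: openT.
rewrite (_ : defect _ _ =
    fun x => (defect F i x + Vlin (P i) x - lam i * P i x) - correction F P i x).
  apply: vanishB.
  + apply: smoothB; [exact: openT| |by apply: smoothZ => //; exact: openT].
    by apply: smoothD; [exact: openT|exact: smooth_defect|exact: smooth_Vlin].
  + exact: sC.
  + by have [] := hP i.
  + exact: vanish_correction.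
by apply/funext => x; rewrite /defect /correction VlinD//; ring.
Qed.

Let good0 : good 0 (fun i y => y 0 i).
Proof.
split=> [i|i|i]; first exact: smooth_coord.
  by rewrite mxE.
have sl : smth (fun y : 'rV[R]_n => lam i * y 0 i).
  by apply: smoothZ; [exact: openT|exact: smooth_coord].
rewrite (_ : defect _ _ = fun x => lam i * x 0 i - V i x).
  split; first by rewrite mxE mulr0 V0 subrr.
  move=> j; split=> //; rewrite partialB// dV0 partialZ; last exact: differentiable_coord.
  by rewrite partial_coord subrr.
apply/funext => x; rewrite /defect; congr (_ - V i _); last first.
  by apply/rowP => j; rewrite mxE.
rewrite /Vlin (bigD1 i)//= partial_coord eqxx mulr1 big1 ?addr0// => j /negbTE ji.
by rewrite partial_coord ji mulr0.
Qed.

Lemma formal_linearization : exists F : 'I_n -> 'rV[R]_n -> R,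
  [/\ forall i, smth (F i), forall i, F i 0 = 0,
      forall i j, partial j (F i) 0 = (j == i)%:R &
      forall d i, vanish d (fun x => Vlin (F i) x - V i (rowf F x))].
Proof.
have /choice[st hst] : forall dF : nat * ('I_n -> 'rV[R]_n -> R),
    exists P : 'I_n -> 'rV[R]_n -> R, good dF.1 dF.2 ->
    (forall i, hompoly dF.1.+2 (P i)) /\ good dF.1.+1 (fun i y => dF.2 i y + P i y).
  (* Choice needs a step for every pair; pairs that are not [good] get zero. *)
  move=> [d F]; have [gF|ngF] := pselect (good d F); last by exists (fun _ => fun=> 0).
  by have [P hP] := step gF; exists P.
pose Psi := fix Psi d : 'I_n -> 'rV[R]_n -> R := if d is d'.+1
  then fun i y => Psi d' i y + st (d', Psi d') i y else fun i y => y 0 i.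
have gP d : good d (Psi d).
  by elim: d => [|d IH]; [exact: good0|have [_] := hst (d, Psi d) IH].
have hP d i : hompoly d.+2 (st (d, Psi d) i).
  by have [+ _] := hst (d, Psi d) (gP d); exact.
have PsiE d i y : Psi d i y = y 0 i + \sum_(k < d) st (nat_of_ord k, Psi k) i y.
  elim: d => [|d IH]; first by rewrite big_ord0 addr0.
  by rewrite big_ord_recr /= IH addrA.
have /choice[F hF] : forall i, exists F, smth F /\
    forall d, vanish d.+2 (fun x => F x - \sum_(k < d) st (nat_of_ord k, Psi k) i x).
  move=> i; have [F sF vF] := borel (fun k => hP k i); by exists F.
have sF i : smth (F i) by have [] := hF i.
have vF2 i : vanish 2 (F i).
  have [_ /(_ 0%N)] := hF i; rewrite (_ : (fun x => _) = F i)//.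
  by apply/funext => x; rewrite big_ord0 subr0.
pose G i x := x 0 i + F i x.
have sG i : smth (G i) by apply: smoothD; [exact: openT|exact: smooth_coord|].
(* [G] differs from the truncation [Psi d] by a term of order [d.+2], which changes the defect by
   the same order only; thus every truncation controls the defect of [G]. *)
have GE d : G = fun i y => Psi d i y + (F i y - \sum_(k < d) st (nat_of_ord k, Psi k) i y).
  by apply/funext => i; apply/funext => y; rewrite /G PsiE; ring.
exists G; split=> [//|i|i j|d i].
- by rewrite /G mxE add0r; have [] := vF2 i.
- rewrite /G partial_add//; last exact: smooth_coord.
  by rewrite partial_coord; have [_ /(_ j)[-> _]] := vF2 i; rewrite addr0.
have [sPsi P0 vPsi] := gP d; apply: (@vanish_le _ _ d d.+2); first exact: leqW (leqnSn d).
pose Q i y := F i y - \sum_(k < d) st (nat_of_ord k, Psi k) i y.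
have sQ j : smth (Q j).
  apply: smoothB; [exact: openT|exact: sF|]; apply: smooth_sum => [|k _]; first exact: openT.
  exact: hompoly_smooth (hP k j).
have vQ j : vanish d.+2 (Q j) by have [_] := hF j; exact.
rewrite (_ : (fun x => _) = fun x => (defect (Psi d) i x + Vlin (Q i) x) -
   (V i (rowf (fun i y => Psi d i y + Q i y) x) - V i (rowf (Psi d) x))).
  have sPQ j : smth (fun y => Psi d j y + Q j y) by apply: smoothD => //; exact: openT.
  apply: vanishB.
  + by apply: smoothD; [exact: openT|exact: smooth_defect|exact: smooth_Vlin].
  + by apply: smoothB; [exact: openT|exact: smth_comp|exact: smth_comp].
  + apply: vanishD => //; [exact: smooth_defect|exact: smooth_Vlin|exact: vanish_Vlin].
  + exact: vanish_increment.
apply/funext => x; rewrite (GE d) VlinD; [|exact: sPsi|exact: sQ].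
by rewrite /defect; ring.
Qed.

End formal_linearization.

(** * Smooth linearization *)

Section flatness.
Context {R : realType} {n : nat}.
Implicit Types (x v : 'rV[R]_n) (f g h : 'rV[R]_n -> R) (P : pred 'I_n).
Notation smth f := (smooth_on setT f).
Notation flat rho h := (forall k, tame k setT rho (fun=> h)).
Notation wtT := (wt (R := R) (n := n) xpredT).

(** [Q] is an invariant that differentiation preserves; bounds on the functions themselves then
    yield those on all their derivatives. *)
Lemma flat_of_bounds rho f (Q : ('rV[R]_n -> R) -> Prop) :
  (forall x, 0 <= rho x) ->
  (forall h, Q h -> forall N, exists2 C : R, 0 <= C & forall x, `|h x| <= C * rho x ^+ N) ->
  (forall h i, Q h -> Q (partial i h)) ->
  (forall h x, Q h -> differentiable h x) ->
  Q f -> flat rho f.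
Proof.
move=> rho0 Qb Qp Qd Qf k.
have dcy h : Q h -> decay setT rho (fun=> h).
  move=> Qh N; have [C C0 bC] := Qb h Qh N; exists C => // j x _; split=> //.
  by rewrite subrr normr0 !mulr_ge0// exprn_ge0.
elim: k f Qf => [|k IH] f Qf; first by split=> //; exact: dcy.
split; first exact: dcy.
by split=> [j x _|i]; [exact: Qd|exact/IH/Qp].
Qed.

(** Taylor's estimate holds on a ball, whereas flatness on [setT] is a global bound; the support
    condition closes the gap and is inherited by derivatives. *)
Lemma flat_of_vanish (K : R) f : smth f -> (forall d, vanish d f) ->
  (forall x, K < `|x| -> f x = 0) -> flat wtT f.
Proof.
move=> sf vf f0.
apply: (@flat_of_bounds _ _ (fun h => [/\ smth h, forall d, vanish d h &
  forall x, K < `|x| -> h x = 0])) => //.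
- by move=> x; exact: wt_ge0.
- move=> h [sh vh h0] N; have [C bC] := vanish_bound K sh (vh N).
  exists `|C| => // x; have [xK|Kx] := leP `|x| K.
    rewrite (le_trans (bC x xK))// ler_wpM2r ?exprn_ge0 ?wt_ge0//.
    exact: ler_norm.
  by rewrite h0// normr0 mulr_ge0// exprn_ge0// wt_ge0.
- move=> h i [sh vh h0]; split; first exact: smooth_partial.
    by move=> d; have [_] := vh d.+1; exact.
  exact: partial_eq0.
- by move=> h x [sh _ _]; exact: smth_differentiable.
Qed.

Lemma vanish_of_flat d f : flat wtT f -> vanish d f.
Proof.
elim: d f => //= d IH f ff; split; first exact: flat_at0.
by move=> i; apply: IH; exact: flat_partial.
Qed.

Lemma sqwt_le_wt P x : sqwt P x <= wt P x ^+ 2.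
Proof.
rewrite /sqwt expr2 {1}/wt mulr_suml; apply: ler_sum => i Pi.
rewrite -[x 0 i ^+ 2]real_normK ?num_real// expr2 ler_wpM2l//.
exact: le_wt.
Qed.

Lemma wt_le_sqwt P x : wt P x ^+ 2 <= n%:R ^+ 2 * sqwt P x.
Proof.
have s0 : 0 <= Num.sqrt (sqwt P x) by exact: sqrtr_ge0.
rewrite -[sqwt P x]sqr_sqrtr ?sqwt_ge0// -exprMn lerXn2r ?nnegrE ?wt_ge0 ?mulr_ge0//.
rewrite /wt big_mkcond /=; apply: (@le_trans _ _ (\sum_(i < n) Num.sqrt (sqwt P x))).
  apply: ler_sum => i _; case: ifP => // Pi.
  rewrite -sqrtr_sqr ler_wsqrtr// /sqwt (bigD1 i)//= lerDl.
  by apply: sumr_ge0 => j _; exact: sqr_ge0.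
by rewrite sumr_const card_ord -[_ *+ n]mulr_natl.
Qed.

Lemma open_cone P (M : R) : open [set x | M * sqwt P x < sqwt (predC P) x].
Proof.
pose a (x : 'rV[R]_n) := sqwt (predC P) x - M * sqwt P x.
have sa : smth a.
  apply: smoothB; [exact: openT| |apply: smoothZ; first exact: openT];
  by apply: smooth_sqwt; exact: openT.
rewrite (_ : [set x | _] = a @^-1` [set t | 0 < t]).
  apply: open_comp; last exact: open_gt.
  by move=> x _; apply: differentiable_continuous; exact: smth_differentiable.
by apply/seteqP; split=> x /=; rewrite /a subr_gt0.
Qed.

(** Where [f] need not vanish, the coordinates outside [P] are controlled by those in [P], so
    [wt xpredT] is at most a multiple of [wt P]. Flatness at the origin thereby becomes flatness
    along a subspace. The zero region is open, so derivatives vanish on it too. *)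
Lemma flat_cone P (M : R) f : 0 <= M -> flat wtT f ->
  (forall x, M * sqwt P x < sqwt (predC P) x -> f x = 0) -> flat (wt P) f.
Proof.
move=> M0 ff f0.
apply: (@flat_of_bounds _ _ (fun h => flat wtT h /\
   forall x, M * sqwt P x < sqwt (predC P) x -> h x = 0)) => //.
- by move=> x; exact: wt_ge0.
- move=> h [fh h0] N; have [C C0 bC] := flat_bound N fh.
  have c0 : 0 <= n%:R * (1 + M) by rewrite mulr_ge0// addr_ge0.
  exists (C * (n%:R * (1 + M)) ^+ N) => [|x]; first by rewrite mulr_ge0// exprn_ge0.
  have [xM|Mx] := ltP (M * sqwt P x) (sqwt (predC P) x).
    by rewrite h0// normr0 !mulr_ge0 ?exprn_ge0// wt_ge0.
  rewrite (le_trans (bC x I))// -mulrA ler_wpM2l// -exprMn.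
  suff wP : wtT x ^+ 2 <= (n%:R * (1 + M) * wt P x) ^+ 2.
    have w0 : wtT x \is Num.nneg by rewrite nnegrE wt_ge0.
    have w1 : n%:R * (1 + M) * wt P x \is Num.nneg.
      by rewrite nnegrE mulr_ge0// wt_ge0.
    by apply: lerXn2r => //; rewrite -(@ler_pXn2r _ 2).
  rewrite (le_trans (wt_le_sqwt _ _))// !exprMn -mulrA ler_wpM2l ?exprn_ge0//.
  rewrite -(sqwtC P x); apply: (@le_trans _ _ ((1 + M) * sqwt P x)); first by lra.
  apply: (@le_trans _ _ ((1 + M) ^+ 2 * sqwt P x)).
    by rewrite ler_wpM2r ?sqwt_ge0// expr2 ler_peMl// ?addr_ge0// lerDl.
  by rewrite ler_wpM2l ?exprn_ge0 ?addr_ge0// sqwt_le_wt.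
- move=> h i [fh h0]; split; first exact: flat_partial.
  move=> x xM; rewrite (@near_eq_partial _ _ _ (fun=> 0)) ?partial_cst//.
  have oc : open_nbhs x [set x | M * sqwt P x < sqwt (predC P) x].
    by split=> //; exact: open_cone.
  by apply: filterS (open_nbhs_nbhs oc) => y; exact: h0.
- by move=> h x [fh _]; exact: smth_differentiable (flat_smooth fh).
Qed.

Lemma smooth_glue U (K : R) f eta : open U -> smooth_on U f -> smth eta ->
  (forall x, K <= `|x| -> eta x = 0) -> (forall x, `|x| <= K -> U x) ->
  smth (fun x => eta x * f x).
Proof.
move=> oU sf seta eta0 KU.
have oK : open [set y : 'rV[R]_n | K < `|y|].
  rewrite (_ : [set y | _] = (fun x : 'rV[R]_n => `|x|) @^-1` [set t | K < t])//.
  by apply: open_comp; [move=> y _; exact: norm_continuous|exact: open_gt].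
apply: (@smooth_sub _ _ (U `|` [set y : 'rV[R]_n | K < `|y|])).
  by move=> x _; have [/KU|] := leP `|x| K; [left|right].
apply: smooth_setU.
  by apply: smoothM => //; exact: smooth_sub seta.
apply: (smooth_ext oK _ (smooth_cst _ 0)) => x /= Kx.
by rewrite eta0 ?mul0r// ltW.
Qed.

Lemma ex_cutoff (rho : R) : 0 < rho -> exists eta : 'rV[R]_n -> R,
  exists K : R, [/\ smth eta, 0 < K < rho, (forall x, K <= `|x| -> eta x = 0) &
    exists2 e : R, 0 < e & forall x, `|x| < e -> eta x = 1].
Proof.
move=> rho0; have [eta seta [K K1 [eta1 eta0]]] := @ex_bump R n.
have K0 : 0 < K by exact: lt_trans K1.
pose e := rho / (K + 1).
have e0 : 0 < e by rewrite divr_gt0// addr_gt0.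
have eV0 : 0 <= e^-1 by rewrite invr_ge0 ltW.
exists (fun x => eta (e^-1 *: x)), (K * e); split.
- exact: smooth_scale.
- rewrite mulr_gt0//= /e mulrA ltr_pdivrMr ?addr_gt0// mulrC ltr_pM2l//.
  by rewrite ltrDl.
- move=> x Kx; rewrite eta0// normrZ (ger0_norm eV0).
  by rewrite mulrC ler_pdivlMr.
- exists e => // x xe; rewrite eta1// normrZ (ger0_norm eV0).
  by rewrite mulrC ler_pdivrMr// mul1r ltW.
Qed.

Lemma continuous0 (F : 'I_n -> 'rV[R]_n -> R) (e : R) : (forall i, smth (F i)) ->
  (forall i, F i 0 = 0) -> 0 < e ->
  exists2 d : R, 0 < d & forall x, `|x| < d -> `|rowf F x| < e.
Proof.
move=> sF F0 e0; have cF : {for 0, continuous (rowf F)}.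
  apply: continuous_row => j; rewrite (_ : (fun y => _) = F j).
    by apply: differentiable_continuous; exact: smth_differentiable.
  by apply/funext => y; rewrite mxE.
have /cvgrPdist_lt/(_ _ e0) := cF; rewrite (rowf0 F0) => /nbhs_ballP[d d0 dF].
exists d => // x xd; have := dF x; rewrite /= sub0r normrN; apply.
by rewrite -ball_normE /= sub0r normrN.
Qed.

Lemma smooth_det m (U : set 'rV[R]_n) (A : 'rV[R]_n -> 'M[R]_m) : open U ->
  (forall i j, smooth_on U (fun x => A x i j)) -> smooth_on U (fun x => \det (A x)).
Proof.
move=> oU sA; apply: smooth_sum => // s _; apply: smoothZ => //.
by apply: smooth_prod.
Qed.

Lemma smooth_invmx m (U : set 'rV[R]_n) (A : 'rV[R]_n -> 'M[R]_m) i j : open U ->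
  (forall i j, smooth_on U (fun x => A x i j)) ->
  (forall x, U x -> \det (A x) != 0) -> smooth_on U (fun x => invmx (A x) i j).
Proof.
move=> oU sA dA.
apply: (@smooth_ext _ _ _ (fun x => (\det (A x))^-1 * cofactor (A x) j i)) => //.
  by move=> x Ux; rewrite /invmx unitmxE unitfE dA// !mxE.
apply: smoothM => //; first by apply: smoothV => //; exact: smooth_det.
apply: smoothZ => //; apply: smooth_det => // a b.
by apply: (smooth_ext oU _ (sA (lift j a) (lift i b))) => x _; rewrite !mxE.
Qed.

Definition jac (F : 'I_n -> 'rV[R]_n -> R) x : 'M[R]_n :=
  \matrix_(a, i) partial a (F i) x.

Lemma jac_unit_near0 (F : 'I_n -> 'rV[R]_n -> R) : (forall i, smth (F i)) ->
  (forall i j, partial j (F i) 0 = (j == i)%:R) ->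
  exists2 d : R, 0 < d & forall x, `|x| < d -> \det (jac F x) != 0.
Proof.
move=> sF dF; have sdet : smth (fun x => \det (jac F x)).
  apply: smooth_det => [|a i]; first exact: openT.
  apply: (smooth_ext openT _ (smooth_partial a (sF i))) => x _; rewrite mxE//.
have j0 : jac F 0 = 1%:M by apply/matrixP => a i; rewrite !mxE dF.
have cd : {for 0, continuous (fun x => \det (jac F x))}.
  by apply: differentiable_continuous; exact: smth_differentiable.
have /cvgrPdist_lt/(_ _ ltr01) := cd; rewrite j0 det1 => /nbhs_ballP[d d0 dd].
exists d => // x xd; have := dd x; rewrite /= -ball_normE /= sub0r normrN => /(_ xd).
by apply: contraTneq => ->; rewrite subr0 normr1 ltxx.
Qed.

(** Pulling a vector field back through [F] multiplies it by the inverse Jacobian, which exists only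
    near the origin. [c] is a global substitute: this inverse times a cutoff. *)
Lemma cutoff_inverse (F : 'I_n -> 'rV[R]_n -> R) (rho : R) : (forall i, smth (F i)) ->
  (forall i j, partial j (F i) 0 = (j == i)%:R) -> 0 < rho ->
  exists c : 'I_n -> 'I_n -> 'rV[R]_n -> R,
  [/\ forall l a, smth (c l a), forall l a x, rho <= `|x| -> c l a x = 0 &
    exists2 e : R, 0 < e & forall x, `|x| < e -> forall (w : 'I_n -> R) i,
      \sum_a (\sum_l w l * c l a x) * partial a (F i) x = w i].
Proof.
move=> sF dF rho0; have [d d0 dd] := jac_unit_near0 sF dF.
have m0 : 0 < Num.min rho d by rewrite lt_min rho0 d0.
have [eta [K [seta /andP[K0 Kr] eta0 [e e0 eta1]]]] := ex_cutoff m0.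
exists (fun l a x => eta x * invmx (jac F x) l a); split.
- move=> l a; apply: (smooth_glue (U := ball 0 d) (K := K)) => //.
  + exact: ball_open.
  + apply: smooth_invmx => [|b i|x]; first exact: ball_open.
      apply: (smooth_ext (ball_open _ _) _ (smooth_sub (@subsetT _ _) (smooth_partial b (sF i)))) => x _.
      by rewrite mxE.
    by rewrite -ball_normE /= sub0r normrN; exact: dd.
  + move=> x xK; rewrite -ball_normE /= sub0r normrN (le_lt_trans xK)//.
    by move: Kr; rewrite lt_min => /andP[].
- move=> l a x rx; rewrite eta0 ?mul0r// (le_trans _ rx)// ltW//.
  by move: Kr; rewrite lt_min => /andP[].
- exists (Num.min e d) => [|x]; first by rewrite lt_min e0 d0.
  rewrite lt_min => /andP[xe xd] w i.
  have ju : jac F x \in unitmx by rewrite unitmxE unitfE dd.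
  pose wr : 'rV[R]_n := \row_l w l.
  have := mulmxKV ju wr => /(congr1 (fun m : 'rV[R]_n => m 0 i)).
  rewrite [RHS]mxE => <-; rewrite mxE; apply: eq_bigr => a _.
  rewrite [X in _ = _ * X]mxE; congr (_ * _); rewrite mxE; apply: eq_bigr => l _.
  by rewrite eta1// mul1r mxE.
Qed.

End flatness.

(** * Removal of the flat remainder and the local normal form *)

Section normal_form.
Context {R : realType} {n : nat}.
Implicit Types (x v : 'rV[R]_n) (f g h : 'rV[R]_n -> R) (P : pred 'I_n).
Notation smth f := (smooth_on setT f).
Notation flat rho h := (forall k, tame k setT rho (fun=> h)).
Notation wtT := (wt (R := R) (n := n) xpredT).

Definition tangent_id (F : 'I_n -> 'rV[R]_n -> R) : Prop :=
  [/\ forall i, smth (F i), forall i, F i 0 = 0 &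
      forall i j, partial j (F i) 0 = (j == i)%:R].

Lemma tangent_id_comp F G : tangent_id F -> tangent_id G ->
  tangent_id (fun i x => F i (rowf G x)).
Proof.
move=> [sF F0 dF] [sG G0 dG]; split=> [i|i|i j]; first exact: smth_comp.
  by rewrite rowf0.
rewrite partial_comp_rowf// (rowf0 G0) (bigD1 i)//= dF dG eqxx mul1r big1 ?addr0//.
by move=> l /negbTE li; rewrite dF li mul0r.
Qed.

Lemma Vlin_comp (lam : 'I_n -> R) f (F : 'I_n -> 'rV[R]_n -> R) z : smth f ->
  (forall i, smth (F i)) ->
  Vlin lam (fun y => f (rowf F y)) z =
  \sum_l partial l f (rowf F z) * Vlin lam (F l) z.
Proof.
move=> sf sF; rewrite /Vlin.
under eq_bigr do rewrite partial_comp_rowf// mulr_sumr.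
rewrite exchange_big /=; apply: eq_bigr => l _; rewrite mulr_sumr.
by apply: eq_bigr => j _; ring.
Qed.

Lemma Vlin_perturb (lam : 'I_n -> R) (u : 'I_n -> 'rV[R]_n -> R) i x :
  (forall i, smth (u i)) ->
  Vlin lam (fun y => y 0 i + u i y) x = lam i * x 0 i + Vlin lam (u i) x.
Proof.
move=> su; rewrite VlinD//; last exact: smooth_coord.
congr (_ + _); rewrite /Vlin (bigD1 i)//= partial_coord eqxx mulr1 big1 ?addr0//.
by move=> j /negbTE ji; rewrite partial_coord ji mulr0.
Qed.

Lemma one_sided_global (lam : 'I_n -> R) (Rm : 'I_n -> 'rV[R]_n -> R) :
  (forall i, flat (wt (fun i => lam i < 0)) (Rm i)) ->
  exists u : 'I_n -> 'rV[R]_n -> R, exists C e : R,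
  [/\ tangent_id (fun i x => x 0 i + u i x), forall i, smth (u i), 0 <= C, 0 < e &
    forall x, `|x| < e -> forall i, `|u i x| <= C * wt (fun i => lam i < 0) x ^+ 2 /\
      Vlin lam (u i) x = lam i * u i x + Rm i (perturb u x)].
Proof.
move=> fR; have [r [u [/andP[r0 r1] su bu eu]]] := one_sided_linearization fR.
(* Order 2 gives derivative zero at the origin, hence tangency to the identity, and later makes
   [u i x] small compared with the weight, as [cone_stable] requires. *)
have [C C0 bC] := bu 2%N.
have n1 : 0 < n%:R + 1 :> R by rewrite ltr_wpDl.
have [eta [K [seta /andP[K0 Kr] eta0 [e e0 eta1]]]] := @ex_cutoff R n _ (divr_gt0 r0 n1).
have inS x : `|x| <= K -> wt (fun i => lam i < 0) x < r.
  move=> xK; apply: (@le_lt_trans _ _ ((n%:R + 1) * K)).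
    apply: (@le_trans _ _ (wtT x)).
      by rewrite /wt [leRHS](bigID (fun i => lam i < 0))/= lerDl sumr_ge0.
    by rewrite (le_trans (wtT_le x))// ler_pM// lerDl.
  by rewrite mulrC -ltr_pdivlMr.
pose v i x := eta x * u i x.
have sv i : smth (v i).
  exact: (smooth_glue (@open_wt _ _ (fun i => lam i < 0) r) (su i) seta eta0 inS).
pose e' := Num.min e K.
have e'0 : 0 < e' by rewrite lt_min e0 K0.
have ve x : `|x| < e' -> forall i, v i x = u i x.
  by rewrite lt_min => /andP[xe _] i; rewrite /v eta1// mul1r.
have e'S x : `|x| < e' -> wt (fun i => lam i < 0) x < r.
  by rewrite lt_min => /andP[_ /ltW xK]; exact: inS.
have bv x i : `|x| < e' -> `|v i x| <= C * wt (fun i => lam i < 0) x ^+ 2.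
  by move=> xe; rewrite ve// bC// e'S.
have v0 i : v i 0 = 0.
  have := bv 0 i; rewrite normr0 => /(_ e'0); rewrite wt0 expr0n mulr0 normr_le0.
  by move=> /eqP.
have dv i j : partial j (v i) 0 = 0.
  have [|_ ->//] := @differentiable_quad _ _ (v i) (fun=> 0) 0 (C * n%:R ^+ 2) e' e'0.
  move=> w we; rewrite add0r v0 subr0 big1 ?subr0; last by move=> k _; rewrite mul0r.
  rewrite (le_trans (bv _ _ we))// -mulrA ler_wpM2l// -exprMn lerXn2r ?nnegrE ?wt_ge0 ?mulr_ge0//.
  rewrite (le_trans _ (wtT_le w))//.
  by rewrite /wt [leRHS](bigID (fun i => lam i < 0))/= lerDl sumr_ge0.
exists v, C, e'; split=> //.
  split=> [i|i|i j]; first by apply: smoothD; [exact: openT|exact: smooth_coord|].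
    by rewrite mxE v0 addr0.
  rewrite partialD; last 2 first.
  - exact: differentiable_coord.
  - exact: smth_differentiable.
  by rewrite partial_coord dv addr0.
move=> x xe i; split; first exact: bv.
rewrite (_ : perturb v x = perturb u x); last by apply/rowP => j; rewrite !mxE ve.
rewrite (ve x xe) -eu ?e'S//; apply: eq_bigr => j _; congr (_ * _).
apply: near_eq_partial; have xb : ball (0 : 'rV[R]_n) e' x by rewrite -ball_normE /= sub0r normrN.
apply: filterS (open_nbhs_nbhs (conj (ball_open _ _) xb)) => y.
by rewrite -ball_normE /= sub0r normrN => /ve ->.
Qed.

(** Put [s = sqwt P x]. The squares of the [u i x] add up to at most [s / 36]. By
    [(a + b)^2 <= 2 a^2 + 2 b^2] the left side is at most [4 (2/32 + 2/36) s], and by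
    [(a + b)^2 >= a^2 / 2 - b^2] the right side is at least [(1/2 - 1/36) s]. Both equal [17/36 s],
    which is the origin of 32 and 36. *)
Lemma cone_stable P (u : 'I_n -> 'rV[R]_n -> R) (d : R) x : 0 <= d ->
  36 * n%:R ^+ 3 * d ^+ 2 <= 1 ->
  (forall i, `|u i x| <= d * wt P x) ->
  32 * sqwt (predC P) x < sqwt P x ->
  4 * sqwt (predC P) (perturb u x) <= sqwt P (perturb u x).
Proof.
move=> d0 dn bu cx.
have usq i : u i x ^+ 2 <= d ^+ 2 * (n%:R ^+ 2 * sqwt P x).
  rewrite -[u i x ^+ 2]real_normK ?num_real//.
  apply: (@le_trans _ _ ((d * wt P x) ^+ 2)).
    by rewrite lerXn2r ?nnegrE ?mulr_ge0 ?wt_ge0.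
  by rewrite exprMn ler_wpM2l ?sqr_ge0// wt_le_sqwt.
have su Q : \sum_(i | Q i) u i x ^+ 2 <= n%:R ^+ 3 * d ^+ 2 * sqwt P x.
  apply: (@le_trans _ _ (\sum_(i < n) d ^+ 2 * (n%:R ^+ 2 * sqwt P x))).
    rewrite big_mkcond /=; apply: ler_sum => i _; case: ifP => // _.
    by rewrite !mulr_ge0 ?exprn_ge0 ?sqwt_ge0.
  rewrite sumr_const card_ord -[_ *+ n]mulr_natl le_eqVlt.
  by apply/orP; left; apply/eqP; ring.
have up : sqwt (predC P) (perturb u x) <= 2 * sqwt (predC P) x + 2 * \sum_(i | predC P i) u i x ^+ 2.
  rewrite /sqwt !mulr_sumr -big_split /=; apply: ler_sum => i _; rewrite mxE.
  by have := sqr_ge0 (x 0 i - u i x); rewrite !expr2; lra.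
have lo : 2^-1 * sqwt P x - \sum_(i | P i) u i x ^+ 2 <= sqwt P (perturb u x).
  rewrite /sqwt mulr_sumr -sumrB; apply: ler_sum => i _; rewrite mxE.
  by have := sqr_ge0 (x 0 i + 2 * u i x); rewrite !expr2; lra.
have s1 := su (predC P); have s2 := su P.
have s0 := sqwt_ge0 P x.
have dn' : 36 * (n%:R ^+ 3 * d ^+ 2 * sqwt P x) <= sqwt P x.
  by have := ler_wpM2r s0 dn; rewrite mul1r !mulrA.
lra.
Qed.

(* The flat remainder is split by a conic cutoff into a part flat along the
   unstable directions, removed by flowing forward, and a part flat along the
   stable ones, removed by flowing backward. *)
Lemma remove_flat (lam : 'I_n -> R) (Rm : 'I_n -> 'rV[R]_n -> R) :
  (forall i, lam i != 0) -> (forall i, flat wtT (Rm i)) ->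
  exists F : 'I_n -> 'rV[R]_n -> R, tangent_id F /\
  exists2 e : R, 0 < e & forall z, `|z| < e -> forall i,
    Vlin lam (F i) z = lam i * F i z + Rm i (rowf F z).
Proof.
move=> lam0 fR; pose P : pred 'I_n := fun i => lam i < 0.
have hc : homogeneous 0 (cone (R := R) P).
  by move=> t x t0 x0; rewrite cone_scale// expr0 invr1 mul1r.
pose R1 i x := Rm i x * cone P x.
have fR1 i : flat wtT (R1 i).
  by move=> k; apply: (flat_homogeneous _ (fR i) _ hc); exact: cone_smooth.
have R10 i x : 4 * sqwt P x < sqwt (predC P) x -> R1 i x = 0.
  by move=> h; rewrite /R1 cone_eq0 ?mulr0// ltW.
have fR1P i : flat (wt P) (R1 i) by exact: flat_cone (fR1 i) (R10 i).
pose R2 i x := Rm i x - R1 i x.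
have sR i : smth (Rm i) := flat_smooth (fR i).
have sR1 i : smth (R1 i) := flat_smooth (fR1 i).
have sR2 i : smth (R2 i) by apply: smoothB => //; exact: openT.
have vR2 i d : vanish d (R2 i).
  by apply: vanishB => //; exact: vanish_of_flat.
have R20 i x : 4 * sqwt (predC P) x <= sqwt P x -> R2 i x = 0.
  move=> h; rewrite /R2 /R1; have [->|x0] := eqVneq x 0.
    by rewrite (flat_at0 (fR i)) mul0r subrr.
  by rewrite cone_eq1// mulr1 subrr.
have [u1 [C1 [e1 [t1 su1 C10 e10 h1]]]] := one_sided_global fR1P.
pose F1 i x := x 0 i + u1 i x.
have [sF1 F10 dF1] := t1.
have rowF1 x : rowf F1 x = perturb u1 x by apply/rowP => i; rewrite !mxE.
have n1 : 0 < n%:R + 1 :> R by rewrite ltr_wpDl.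
(* Below this radius the quadratic bound on [u1] becomes [d * wt P x] with
   [d = (6 * (n%:R + 1) ^+ 2)^-1], which meets the smallness condition of [cone_stable]. *)
pose rho := Num.min e1 (6 * (C1 + 1) * (n%:R + 1) ^+ 3)^-1.
have D0 : 0 < 6 * (C1 + 1) * (n%:R + 1) ^+ 3.
  by rewrite !mulr_gt0 ?exprn_gt0// ltr_wpDl.
have rho0 : 0 < rho by rewrite lt_min e10 invr_gt0 D0.
have [c [sc c0 [e2 e20 hc2]]] := cutoff_inverse sF1 dF1 rho0.
(* [R2] pulled back through [F1]: near the origin the Jacobian of [F1] sends the linear field plus
   [R3] to the linear field plus [R1] plus [R2]. *)
pose R3 a x := \sum_l R2 l (rowf F1 x) * c l a x.
have sR2F l : smth (fun x => R2 l (rowf F1 x)) by exact: smth_comp.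
have sR3 a : smth (R3 a).
  apply: smooth_sum => [|l _]; first exact: openT.
  by apply: smoothM => //; exact: openT.
have vR3 a d : vanish d (R3 a).
  apply: vanish_sum => l; first by apply: smoothM => //; exact: openT.
  apply: (vanishM (d := d) (e := 0)) => //; first by rewrite addn0.
  exact: vanish_comp.
have fR3 a : flat wtT (R3 a).
  apply: (flat_of_vanish (K := rho)) => // x rx; rewrite /R3 big1// => l _.
  by rewrite c0 ?mulr0// ltW.
have R30 a x : 32 * sqwt (predC P) x < sqwt P x -> R3 a x = 0.
  move=> cx; rewrite /R3 big1// => l _.
  have [rx|xr] := leP rho `|x|; first by rewrite c0 ?mulr0.
  have xe1 : `|x| < e1 by move: xr; rewrite lt_min => /andP[].
  rewrite rowF1 R20 ?mul0r//.
  pose d := (6 * (n%:R + 1) ^+ 2)^-1 : R.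
  have d0 : 0 <= d by rewrite invr_ge0 mulr_ge0// exprn_ge0// ltW.
  apply: (cone_stable d0) cx.
  - rewrite /d exprVn ler_pdivrMr ?exprn_gt0 ?mulr_gt0 ?exprn_gt0// mul1r.
    rewrite exprMn -exprM (_ : 36 = 6 ^+ 2 :> R); last by rewrite expr2; lra.
    rewrite ler_wpM2l ?exprn_ge0//.
    apply: (@le_trans _ _ ((n%:R + 1) ^+ 3)).
      by rewrite lerXn2r ?nnegrE ?(ltW n1)// lerDl.
    by rewrite ler_weXn2l// lerDr.
  - move=> i; have [bi _] := h1 x xe1 i; rewrite (le_trans bi)// expr2 mulrA.
    rewrite ler_wpM2r ?wt_ge0//.
    have wx : wt P x <= n%:R * `|x|.
      rewrite (le_trans _ (wtT_le x))//.
      by rewrite /wt [leRHS](bigID P)/= lerDl sumr_ge0.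
    have xD : `|x| <= (6 * (C1 + 1) * (n%:R + 1) ^+ 3)^-1.
      by move: xr; rewrite lt_min => /andP[_ /ltW].
    apply: (@le_trans _ _ ((C1 + 1) * ((n%:R + 1) * (6 * (C1 + 1) * (n%:R + 1) ^+ 3)^-1))).
      rewrite ler_pM ?wt_ge0//; first by rewrite lerDl.
      by rewrite (le_trans wx)// ler_pM// lerDl.
    rewrite /d le_eqVlt; apply/orP; left; apply/eqP.
    by field; rewrite !gt_eqF// ltr_wpDl.
(* Backward flow is forward flow for [- lam]. As no eigenvalue is zero, the contracted coordinates
   are now exactly those outside [P]; the equation for [- lam] and [- R3] is the original one up to
   sign. *)
have wE : wt (fun i => - lam i < 0) = wt (predC P) :> ('rV[R]_n -> R).
  apply/funext => x; apply: eq_bigl => i; rewrite /= /P oppr_lt0 -leNgt lt_def.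
  by rewrite lam0.
have fR3N a : flat (wt (fun i => - lam i < 0)) (fun x => -1 * R3 a x).
  have zR3 k : tame k setT wtT (fun _ x => -1 * R3 a x).
    by apply: (tameM openT) => //; [move=> x _; exact: wt_ge0|exact: tame_cst].
  rewrite wE; apply: (flat_cone (M := 32)) => // x cx.
  rewrite R30 ?mulr0//; move: cx; congr (_ < _).
  by rewrite /sqwt; apply: eq_bigl => i; rewrite /= negbK.
have [u2 [C2 [e3 [t2 su2 C20 e30 h2]]]] := one_sided_global fR3N.
pose F2 i x := x 0 i + u2 i x.
have [sF2 F20 dF2] := t2.
have rowF2 x : rowf F2 x = perturb u2 x by apply/rowP => i; rewrite !mxE.
exists (fun i x => F1 i (rowf F2 x)); split; first exact: tangent_id_comp.
have m0 : 0 < Num.min e1 e2 by rewrite lt_min e10 e20.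
have [d d0 dF] := continuous0 sF2 F20 m0.
exists (Num.min d e3) => [|z]; first by rewrite lt_min d0 e30.
rewrite lt_min => /andP[zd ze3] i.
have := dF _ zd; rewrite lt_min => /andP[ye1 ye2].
have EN l : Vlin lam (F2 l) z = lam l * rowf F2 z 0 l + R3 l (rowf F2 z).
  rewrite Vlin_perturb// rowF2 [perturb u2 z 0 l]mxE mulrDr -addrA; congr (_ + _).
  have [_] := h2 z ze3 l; rewrite /Vlin => h.
  rewrite -[LHS]opprK -sumrN.
  under eq_bigr do rewrite -!mulNr.
  by rewrite h; ring.
rewrite (Vlin_comp lam z (sF1 i) sF2); under eq_bigr do rewrite EN mulrDr.
have -> : rowf (fun i x => F1 i (rowf F2 x)) z = rowf F1 (rowf F2 z).
  by apply/rowP => j; rewrite !mxE.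
move: (rowf F2 z) ye1 ye2 => y ye1 ye2; rewrite big_split /=.
have -> : \sum_l partial l (F1 i) y * (lam l * y 0 l) = Vlin lam (F1 i) y.
  by apply: eq_bigr => l _; rewrite mulrC.
have -> : \sum_l partial l (F1 i) y * R3 l y = R2 i (rowf F1 y).
  rewrite -[RHS](hc2 y ye2 (fun l => R2 l (rowf F1 y)) i).
  by apply: eq_bigr => l _; rewrite mulrC.
rewrite Vlin_perturb//; have [_ ->] := h1 y ye1 i.
by rewrite /R2 rowF1 /F1; ring.
Qed.

(** The formal conjugacy [G] leaves a flat error [w]. Its pullback [Rm] through [G] is again flat,
    and a conjugacy of the linear field to the linear field plus [Rm], followed by [G], is exact
    near the origin. *)
Lemma normal_form (lam : 'I_n -> R) (V : 'I_n -> 'rV[R]_n -> R) :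
  (forall i, smth (V i)) -> (forall i, V i 0 = 0) ->
  (forall i j, partial j (V i) 0 = lam i * (j == i)%:R) -> N_linearity lam ->
  exists F : 'I_n -> 'rV[R]_n -> R, tangent_id F /\
  exists2 e : R, 0 < e & forall z, `|z| < e -> forall i,
    Vlin lam (F i) z = V i (rowf F z).
Proof.
move=> sV V0 dV nlin.
have lam0 i : lam i != 0.
  (* For this exponent the N-linearity condition reads [2 * lam i - lam i <> 0]. *)
  apply/eqP => li; apply: (nlin i (fun j => if j == i then 2 else 0)%N).
    by rewrite (bigD1 i)//= eqxx leq_addr.
  rewrite (bigD1 i)//= li mulr0 add0r subr0 big1// => j /negbTE ->.
  by rewrite mul0r.
have [G [sG G0 dG vG]] := formal_linearization sV V0 dV nlin.
pose w i x := V i (rowf G x) - Vlin lam (G i) x.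
have sw i : smth (w i).
  by apply: smoothB; [exact: openT|exact: smth_comp|exact: smooth_Vlin].
have vw i d : vanish d (w i).
  rewrite (_ : w i = fun x => -1 * (Vlin lam (G i) x - V i (rowf G x))).
    apply: vanishZ => //.
    by apply: smoothB; [exact: openT|exact: smooth_Vlin|exact: smth_comp].
  by apply/funext => x; rewrite /w; ring.
have [c [sc c0 [e1 e10 hc]]] := cutoff_inverse sG dG ltr01.
pose Rm a x := \sum_l w l x * c l a x.
have sR a : smth (Rm a).
  apply: smooth_sum => [|l _]; first exact: openT.
  by apply: smoothM => //; exact: openT.
have vR a d : vanish d (Rm a).
  apply: vanish_sum => l; first by apply: smoothM => //; exact: openT.
  by apply: (vanishM (d := d) (e := 0)) => //; rewrite addn0.
have fR a : flat wtT (Rm a).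
  apply: (flat_of_vanish (K := 1)) => // x rx; rewrite /Rm big1// => l _.
  by rewrite c0 ?mulr0// ltW.
have [F [tF [e2 e20 hF]]] := remove_flat lam0 fR.
have tG : tangent_id G by [].
exists (fun i x => G i (rowf F x)); split; first exact: tangent_id_comp.
have [sF F0 dF] := tF.
have [d d0 dd] := continuous0 sF F0 e10.
exists (Num.min d e2) => [|z]; first by rewrite lt_min d0 e20.
rewrite lt_min => /andP[zd ze] i.
rewrite Vlin_comp//.
have -> : rowf (fun i x => G i (rowf F x)) z = rowf G (rowf F z).
  by apply/rowP => j; rewrite !mxE.
have EN l : Vlin lam (F l) z = lam l * rowf F z 0 l + Rm l (rowf F z).
  by rewrite hF// mxE.
under eq_bigr do rewrite EN mulrDr.
have ye1 := dd z zd; move: (rowf F z) ye1 => y ye1; rewrite big_split /=.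
have -> : \sum_l partial l (G i) y * (lam l * y 0 l) = Vlin lam (G i) y.
  by apply: eq_bigr => l _; rewrite mulrC.
have -> : \sum_l partial l (G i) y * Rm l y = w i y.
  rewrite -[RHS](hc y ye1 (fun l => w l y) i).
  by apply: eq_bigr => l _; rewrite mulrC.
by rewrite /w; ring.
Qed.

End normal_form.

(** * The inverse function theorem *)

Section inverse_function.
Context {R : realType} {n : nat}.
Implicit Types (x y v : 'rV[R]_n) (F : 'I_n -> 'rV[R]_n -> R).
Notation smth f := (smooth_on setT f).

Lemma ball0E (r : R) x : ball (0 : 'rV[R]_n) r x <-> `|x| < r.
Proof. by rewrite -ball_normE /= sub0r normrN. Qed.

Lemma smth_continuous_rowf F x : (forall i, smth (F i)) -> {for x, continuous (rowf F)}.
Proof.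
move=> sF; apply: continuous_row => j; rewrite (_ : (fun y => _) = F j).
  by apply: differentiable_continuous; exact: smth_differentiable.
by apply/funext => y; rewrite mxE.
Qed.

Lemma tangent_id_lipschitz F : tangent_id F ->
  exists2 r : R, 0 < r & forall x y, `|x| < r -> `|y| < r ->
    `|(rowf F y - y) - (rowf F x - x)| <= 2^-1 * `|y - x|.
Proof.
move=> [sF F0 dF].
have sX i : smth (fun x : 'rV[R]_n => -1 * x 0 i).
  by apply: smoothZ; [exact: openT|exact: smooth_coord].
pose u i x := F i x + -1 * x 0 i.
have su i : smth (u i) by apply: smoothD; [exact: openT| |].
have du i j : partial j (u i) 0 = 0.
  rewrite partialD; [|exact: smth_differentiable|exact: smth_differentiable].
  by rewrite partialZ ?partial_coord ?dF; [rewrite mulN1r subrr|exact: differentiable_coord].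
have c0 : 0 < (2 * (n%:R + 1))^-1 :> R by rewrite invr_gt0 mulr_gt0// ltr_wpDl.
(* With [n] partial derivatives bounded by [c], the Lipschitz constant [n%:R * c] is at most one
   half. *)
set c := (2 * (n%:R + 1))^-1 in c0.
have : \forall x \near (0 : 'rV[R]_n), forall p : 'I_n * 'I_n,
    `|partial p.2 (u p.1) x| <= c.
  apply: (@filter_forall _ _ (fun p x => `|partial p.2 (u p.1) x| <= c) _ (nbhs_filter (0 : 'rV[R]_n))) => -[i j] /=.
  have cu : {for 0, continuous (partial j (u i))}.
    by apply: differentiable_continuous; apply: smth_differentiable; exact: smooth_partial.
  have /cvgrPdist_lt/(_ _ c0) := cu; apply: filterS => x.
  by rewrite du sub0r normrN => /ltW.
move=> /nbhs_ballP[d d0 dd].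
(* Two points within [d / 3] of the origin are less than [2 d / 3] apart, and the ball of that
   radius around either stays within [d]. *)
exists (d / 3) => [|x y xd yd]; first by rewrite divr_gt0.
apply: row_norm_ub => [|i]; first by rewrite mulr_ge0.
have -> : ((rowf F y - y) - (rowf F x - x)) 0 i = u i (x + (y - x)) - u i x.
  by rewrite subrKC !mxE /u; ring.
have vd : `|y - x| < d * (2 / 3).
  by rewrite (le_lt_trans (ler_normB _ _))//; move: xd yd; rewrite /=; lra.
have bd z : ball x (d * (2 / 3)) z -> `|z| < d.
  rewrite -ball_normE /= => xz; rewrite -[z](subKr x) (le_lt_trans (ler_normB _ _))//.
  by move: xd xz; lra.
rewrite (le_trans (lipschitz_ball (C := c) vd _ _))//.
- by move=> z _; exact: smth_differentiable.
- by move=> z j /bd zd; apply: (dd z _ (i, j)); apply/ball0E.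
rewrite mulrA ler_wpM2r// /c invfM mulrCA ler_piMr// ler_pdivrMr ?ltr_wpDl// mul1r.
by rewrite lerDl.
Qed.

(* The distance to y attains its minimum over a closed ball, and y - (F - id)
   halves it. *)
Lemma tangent_id_onto F (r : R) : (forall i, smth (F i)) -> (forall i, F i 0 = 0) ->
  0 < r -> (forall x y, `|x| < r -> `|y| < r ->
    `|(rowf F y - y) - (rowf F x - x)| <= 2^-1 * `|y - x|) ->
  forall y, `|y| < r / 2 -> exists2 x, `|x| < r & rowf F x = y.
Proof.
move=> sF F0 r0 lF y yr.
have inr x : `|x| <= 2 * `|y| -> `|x| < r by move: yr; lra.
have A0 : [set x : 'rV[R]_n | `|x| <= 2 * `|y|] !=set0.
  by exists 0; rewrite /= normr0 mulr_ge0.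
have cf : {within [set x : 'rV[R]_n | `|x| <= 2 * `|y|], continuous (fun x => `|y - rowf F x|)}.
  apply: continuous_in_subspaceT => x _.
  apply: (@continuous_comp _ _ _ (fun x => y - rowf F x)); last exact: norm_continuous.
  exact: (continuousB (@cst_continuous _ _ y x) (smth_continuous_rowf sF)).
have [x] := EVT_min_rV A0 (@compact_norm_le _ _ _) cf.
rewrite inE /= => xy xmin; exists x; first exact: inr.
pose x1 := y - (rowf F x - x).
have b0 : `|rowf F x - x| <= 2^-1 * `|x|.
  have := lF 0 x; rewrite normr0 (rowf0 F0) !subr0 => /(_ r0 (inr _ xy)).
  by [].
have x1y : `|x1| <= 2 * `|y|.
  by rewrite (le_trans (ler_normB _ _))//; move: xy b0; lra.
have := xmin x1; rewrite inE => /(_ x1y).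
have := lF _ _ (inr _ xy) (inr _ x1y).
have -> : rowf F x1 - x1 - (rowf F x - x) = - (y - rowf F x1).
  by rewrite /x1; apply/rowP => i; rewrite !mxE; ring.
have -> : x1 - x = y - rowf F x by rewrite /x1; apply/rowP => i; rewrite !mxE; ring.
rewrite normrN => h1 h2; have := normr_ge0 (y - rowf F x) => h3.
apply/esym/eqP; rewrite -subr_eq0 -normr_le0; lra.
Qed.

(* A row e with v = w A + e determines w up to the image of e under A^-1. *)
Lemma invmx_residue (A : 'M[R]_n) v (w : 'rV[R]_n) a : A \in unitmx ->
  w 0 a - \sum_i invmx A i a * v 0 i =
  - \sum_i (v 0 i - \sum_l A l i * w 0 l) * invmx A i a.
Proof.
move=> Au; have E := mulmxK Au w; have Ea : w 0 a = \sum_i (w *m A) 0 i * invmx A i a.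
  by rewrite -[in LHS]E mxE.
rewrite Ea -sumrB -sumrN; apply: eq_bigr => i _; rewrite mxE.
rewrite mulrBl opprB [X in _ - X]mulrC; congr (_ * _ - _).
by apply: eq_bigr => l _; rewrite mulrC.
Qed.

(** [F] minus the identity halves distances, so [F] is injective and its inverse expands distances
    at most by 2; the Taylor remainder of [F] then yields a quadratic one for the inverse [G]. Its
    Jacobian is [invmx (jac F (G y))], so [G] of class C^k has partial derivatives of class C^k, and
    smoothness follows by induction. *)
Lemma inverse_function F (rho : R) : tangent_id F -> 0 < rho ->
  exists r d : R, exists G : 'rV[R]_n -> 'rV[R]_n,
  [/\ 0 < d, 0 < r <= rho,
    forall x, `|x| < r -> `|rowf F x| < d -> G (rowf F x) = x,
    forall y, `|y| < d -> `|G y| < r /\ rowf F (G y) = y &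
    smooth_map_on (ball (0 : 'rV[R]_n) d) G /\
    forall x, `|x| < r -> \det (jac F x) != 0].
Proof.
move=> tF rho0; have [sF F0 dF] := tF.
have [r1 r10 lF1] := tangent_id_lipschitz tF.
have [r2 r20 jF] := jac_unit_near0 sF dF.
pose r := Num.min rho (Num.min r1 r2).
have r0 : 0 < r by rewrite !lt_min rho0 r10 r20.
have rr1 x : `|x| < r -> `|x| < r1 by rewrite !lt_min => /and3P[].
have rr2 x : `|x| < r -> `|x| < r2 by rewrite !lt_min => /and3P[].
have lF x y : `|x| < r -> `|y| < r ->
    `|(rowf F y - y) - (rowf F x - x)| <= 2^-1 * `|y - x|.
  by move=> xr yr; apply: lF1; exact: rr1.
have ex y : exists x, `|y| < r / 2 -> `|x| < r /\ rowf F x = y.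
  have [yr|yr] := ltP `|y| (r / 2); last by exists 0.
  by have [x xr xy] := tangent_id_onto sF F0 r0 lF yr; exists x.
have [G hG] := choice ex.
have expand x y : `|x| < r -> `|y| < r -> `|y - x| <= 2 * `|rowf F y - rowf F x|.
  move=> xr yr; have := lF x y xr yr; have := ler_normB (rowf F y - rowf F x) ((rowf F y - y) - (rowf F x - x)).
  have -> : rowf F y - rowf F x - (rowf F y - y - (rowf F x - x)) = y - x.
    by apply/rowP => i; rewrite !mxE; ring.
  by move: (normr_ge0 (y - x)); lra.
have inj x y : `|x| < r -> `|y| < r -> rowf F x = rowf F y -> x = y.
  move=> xr yr E; have := expand x y xr yr; rewrite E subrr normr0 mulr0 normr_le0 subr_eq0.
  by move=> /eqP.
have Gr y : `|y| < r / 2 -> `|G y| < r by move=> /hG[].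
have FG y : `|y| < r / 2 -> rowf F (G y) = y by move=> /hG[].
have d0 : 0 < r / 2 by rewrite divr_gt0.
have ju y : `|y| < r / 2 -> jac F (G y) \in unitmx.
  by move=> yr; rewrite unitmxE unitfE jF// rr2// Gr.
have dG y a : `|y| < r / 2 -> differentiable (fun y => G y 0 a) y /\
    forall i, partial i (fun y => G y 0 a) y = invmx (jac F (G y)) i a.
  move=> yr; have xr := Gr y yr; set x := G y.
  have [C bC] : exists C : R, forall i j k z, `|z| <= 3 * r ->
      `|partial k (partial j (F i)) z| <= C.
    have : forall p : 'I_n * 'I_n * 'I_n, exists C : R, forall z, `|z| <= 3 * r ->
        `|partial p.1.1 (partial p.1.2 (F p.2)) z| <= C.
      by move=> p; apply: bounded_ball; do 2! apply: smooth_partial.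
    move=> /choice[C bC]; exists (\sum_p `|C p|) => i j k z zr.
    rewrite (le_trans (bC (k, j, i) z zr))// (bigD1 (k, j, i))//=.
    by rewrite (le_trans (ler_norm _))// lerDl sumr_ge0.
  (* The factor 4 is the square of the bound 2 on [|w| / |v|]. The second derivatives in [C] are
     bounded on radius [3 * r] since [|x| < r] and [|w| < 2 * r]. *)
  pose K := \sum_i n%:R * (n%:R * C) * 4 * `|invmx (jac F x) i a|.
  apply: (differentiable_quad (d := r / 2 - `|y|) (C := K)); first by rewrite subr_gt0.
  move=> v vr; have yvr : `|y + v| < r / 2.
    by rewrite (le_lt_trans (ler_normD _ _))//; move: vr; lra.
  have xvr := Gr _ yvr; set w := G (y + v) - x.
  have w2 : `|w| <= 2 * `|v|.
    have := expand _ _ xr xvr; rewrite !FG//.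
    by rewrite [y + v - y]addrC addKr.
  rewrite (_ : G (y + v) 0 a - G y 0 a = w 0 a); last by rewrite !mxE.
  rewrite (invmx_residue _ _ _ (ju y yr)) normrN (le_trans (ler_norm_sum _ _ _))//.
  rewrite /K mulr_suml; apply: ler_sum => i _; rewrite normrM [leRHS]mulrAC ler_wpM2r//.
  have wr : `|w| < 2 * r.
    by rewrite (le_lt_trans (ler_normB _ _))//; move: xr xvr; rewrite /x; lra.
  have tb z : ball x (2 * r) z -> `|z| <= 3 * r.
    rewrite -ball_normE /= => xz; rewrite -[z](subKr x) (le_trans (ler_normB _ _))//.
    by move: xr xz; rewrite -/x; lra.
  have T : `|F i (x + w) - F i x - \sum_l partial l (F i) x * w 0 l| <=
      n%:R * (n%:R * C) * `|w| ^+ 2.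
    apply: (taylor2_ball wr).
    - by move=> z _; exact: smth_differentiable.
    - by move=> z j _; apply: smth_differentiable; exact: smooth_partial.
    - by move=> z j k /tb; exact: bC.
  have -> : v 0 i - \sum_l jac F (G y) l i * w 0 l =
      F i (x + w) - F i x - \sum_l partial l (F i) x * w 0 l.
    have -> : F i x = y 0 i by rewrite -[in RHS](FG y yr) mxE.
    have -> : F i (x + w) = (y + v) 0 i by rewrite /w subrKC -[in RHS](FG _ yvr) mxE.
    rewrite [(y + v) 0 i]mxE [X in X - _ = _](_ : _ = y 0 i + v 0 i - y 0 i); last by ring.
    by congr (_ - _); apply: eq_bigr => l _; rewrite mxE.
  have C0 : 0 <= C by apply: le_trans (bC i i i 0 _) => //; rewrite normr0 mulr_ge0// ltW.
  rewrite (le_trans T)// -[leRHS]mulrA ler_wpM2l ?mulr_ge0//.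
  rewrite (_ : 4 = 2 ^+ 2 :> R); last by rewrite expr2; lra.
  by rewrite -exprMn lerXn2r ?nnegrE ?mulr_ge0.
exists r, (r / 2), G; split=> //.
- by rewrite r0 /= ge_min lexx.
- by move=> x xr Fr; apply: inj => //; [exact: Gr|rewrite FG].
split; last by move=> x /rr2; exact: jF.
have oB : open (ball (0 : 'rV[R]_n) (r / 2)) by exact: ball_open.
move=> a k; elim: k a => [|k IH] a.
  by move=> y /ball0E yr; apply: differentiable_continuous; exact: (dG y a yr).1.
split; first by move=> y /ball0E yr; exact: (dG y a yr).1.
move=> i; apply: (@Ck_ext _ _ _ _ (fun y => invmx (jac F (G y)) i a)) => //.
  by move=> y /ball0E yr; rewrite (dG y a yr).2.
apply: (@Ck_comp _ _ _ k _ (ball (0 : 'rV[R]_n) r) (fun x => invmx (jac F x) i a)) => //.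
  by move=> y /ball0E /Gr Gyr; apply/ball0E.
have oB' : open (ball (0 : 'rV[R]_n) r) by exact: ball_open.
apply: smooth_invmx => // [b j|x /ball0E/rr2]; last exact: jF.
apply: (smooth_ext oB' _ (smooth_sub (@subsetT _ _) (smooth_partial b (sF j)))) => x _.
by rewrite mxE.
Qed.

End inverse_function.

(** * Self-adjoint matrices *)

Section spectral.
Context {R : realFieldType}.

Definition posdef m (G : 'M[R]_m) : Prop :=
  G^T = G /\ forall v : 'rV[R]_m, v != 0 -> 0 < (v *m G *m v^T) 0 0.

Lemma posdef_unit m (G : 'M[R]_m) : posdef G -> G \in unitmx.
Proof.
move=> [_ Gp]; rewrite -row_free_unit -kermx_eq0; apply/eqP/row_matrixP => i.
rewrite row0; apply/eqP; apply: contraT => /Gp.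
have -> : row i (kermx G) *m G = 0 by apply/sub_kermxP; exact: row_sub.
by rewrite mul0mx mxE ltxx.
Qed.

Lemma posdef_mul0 m (G A : 'M[R]_m) : posdef G -> A *m G *m A^T = 0 -> A = 0.
Proof.
move=> [_ Gp] A0; apply/row_matrixP => i; rewrite row0; apply/eqP; apply: contraT => /Gp.
have -> : row i A *m G *m (row i A)^T = row i (A *m G *m A^T) *m (delta_mx i 0).
  by rewrite !row_mul tr_row -!mulmxA colE.
by rewrite A0 row0 mul0mx mxE ltxx.
Qed.

(** With vectors as rows, this is self-adjointness of [v *m A] for the bilinear form
    [v *m G *m w^T]. *)
Definition selfadjoint m (G A : 'M[R]_m) := A *m G = G *m A^T.

Lemma selfadjoint_horner m (G M : 'M[R]_m.+1) (q : {poly R}) :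
  selfadjoint G M -> selfadjoint G (horner_mx M q).
Proof.
rewrite /selfadjoint => sM; elim/poly_ind: q => [|q c IH].
  by rewrite rmorph0 mul0mx trmx0 mulmx0.
rewrite rmorphD rmorphM /= horner_mx_X horner_mx_C linearD /= tr_scalar_mx.
rewrite mulmxDl mulmxDr scalar_mxC; congr (_ + _).
rewrite -mulmxE -mulmxA sM mulmxA IH -mulmxA -trmx_mul; congr (_ *m _^T).
apply: comm_mx_horner; exact: comm_mx_refl.
Qed.

(** If [A] is self-adjoint with [A *m A = 0], then [A *m G *m A^T = A *m A *m G = 0], and positivity
    forces [A = 0]. Applied to powers of [q] at [M], this halves the exponent, which is therefore
    first raised to a power of 2. *)
Lemma selfadjoint_nilpotent m (G M : 'M[R]_m.+1) (q : {poly R}) k :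
  posdef G -> selfadjoint G M -> horner_mx M (q ^+ k) = 0 -> horner_mx M q = 0.
Proof.
move=> Gp sM qk; have : horner_mx M (q ^+ (2 ^ k)) = 0.
  by rewrite -(subnK (ltnW (ltn_expl k (erefl (1 < 2)%N)))) exprD rmorphM /= qk mulr0.
elim: {qk} k => [//|k IH]; rewrite expnS mulnC exprM => H; apply: IH.
apply: (posdef_mul0 Gp); rewrite (selfadjoint_horner _ sM) -mulmxA -trmx_mul.
by move: H; rewrite expr2 rmorphM /= -mulmxE => ->; rewrite trmx0 mulmx0.
Qed.

(** The characteristic polynomial divides a power of the product [q] of its distinct linear factors.
    By Cayley-Hamilton and [selfadjoint_nilpotent], [q] annihilates [M], so [M] is
    diagonalizable. *)
Lemma spectral_diag m (G M : 'M[R]_m) (lam : 'I_m -> R) : posdef G ->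
  selfadjoint G M -> char_poly M = \prod_i ('X - (lam i)%:P) ->
  exists2 P, P \in unitmx & P *m M = diag_mx (\row_i lam i) *m P.
Proof.
case: m G M lam => [|m] G M lam Gp sM cM.
  by exists 1%:M; rewrite ?unitmx1//; apply/matrixP => -[].
pose s := [seq lam i | i <- enum 'I_m.+1].
pose q := \prod_(x <- undup s) ('X - x%:P) : {poly R}.
have dq : char_poly M %| q ^+ m.+1.
  rewrite cM -[in q ^+ _](card_ord m.+1) -prodr_const.
  apply: (big_ind2 (fun a b : {poly R} => a %| b)) => [|a b c d|i _] //.
    exact: dvdp_mul.
  by rewrite dvdp_XsubCl root_prod_XsubC mem_undup map_f// mem_enum.
have [P Pu] : diagonalizable M.
  apply/diagonalizableP; exists (undup s); first exact: undup_uniq.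
  apply: mxminpoly_min; apply: (@selfadjoint_nilpotent _ G _ _ m.+1) => //.
  have /dvdpP[c ->] := dq.
  by rewrite rmorphM /= Cayley_Hamilton mulr0.
move=> /diagonalizable_forPex[d /(simmxP Pu) PM].
pose t := [seq d 0 i | i <- enum 'I_m.+1].
have cd : char_poly (diag_mx d) = char_poly M.
  have -> : diag_mx d = P *m M *m invmx P by rewrite PM mulmxK.
  rewrite /char_poly /char_poly_mx !map_mxM /=.
  have Pu' : map_mx polyC P \in unitmx by rewrite map_unitmx.
  have E : ('X%:M - map_mx polyC P *m map_mx polyC M *m map_mx polyC (invmx P)) =
     map_mx polyC P *m ('X%:M - map_mx polyC M) *m map_mx polyC (invmx P).
    rewrite mulmxBr mulmxBl; congr (_ - _).
    by rewrite scalar_mxC -mulmxA -map_mxM mulmxV// map_mx1 mulmx1.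
  rewrite E !det_mulmx mulrAC -det_mulmx -map_mxM mulmxV// map_mx1 det1 mul1r//.
have : perm_eq t s.
  apply/prod_XsubC_eq; rewrite !big_image /=.
  rewrite -cM -cd char_poly_trig ?diag_mx_is_trig//; apply: eq_bigr => i _.
  by rewrite mxE eqxx mulr1n.
(* The diagonal entries come in an unknown order; permuting the rows of [P] restores that of
   [lam]. *)
move=> ts; have [p pE] : exists p : {perm 'I_m.+1}, forall i, lam i = d 0 (p i).
  have /tuple_permP[p tp] : perm_eq (map_tuple lam (ord_tuple m.+1)) (map_tuple (d 0) (ord_tuple m.+1)).
    by rewrite perm_sym.
  exists p => i.
  have := congr1 (fun u => nth 0 u i) tp; rewrite /=.
  rewrite (nth_map i) ?size_enum_ord// nth_ord_enum => ->.
  by rewrite (nth_map i) ?size_enum_ord// nth_ord_enum (tnth_nth 0) /= (nth_map i) ?size_enum_ord// nth_ord_enum.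
exists (row_perm p P).
  by rewrite row_permE unitmx_mul unitmx_perm.
rewrite row_permE -mulmxA PM -!row_permE !mul_diag_mx.
by apply/matrixP => i j; rewrite !mxE pE.
Qed.

End spectral.

(** * Affine changes of coordinates and symmetry of second derivatives *)

Section affine.
Context {R : realType} {n : nat}.
Implicit Types (x z v w : 'rV[R]_n) (f h : 'rV[R]_n -> R) (U : set 'rV[R]_n).

Definition aff w (A : 'M[R]_n) z : 'rV[R]_n := w + z *m A.

Lemma affE w A z j : aff w A z 0 j = w 0 j + \sum_k A k j * z 0 k.
Proof. by rewrite !mxE; congr (_ + _); apply: eq_bigr => k _; rewrite mulrC. Qed.

Lemma smooth_aff U w A : open U -> smooth_map_on U (aff w A).
Proof.
move=> oU j; apply: (smooth_ext oU (fun x _ => esym (affE w A x j))).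
apply: smoothD => //; first exact: smooth_cst.
apply: smooth_sum => // k _; apply: smoothZ => //; exact: smooth_coord.
Qed.

Lemma differentiable_aff w A z j : differentiable (fun y => aff w A y 0 j) z.
Proof. by apply: (smooth_differentiable (U := setT)) => //; apply: smooth_aff; exact: openT. Qed.

Lemma partial_aff w A z i j : partial i (fun y => aff w A y 0 j) z = A i j.
Proof.
rewrite (_ : (fun y : 'rV[R]_n => _) = fun y : 'rV[R]_n => w 0 j + \sum_k A k j * y 0 k); last first.
  by apply/funext => y; rewrite affE.
rewrite partialD; last 2 first.
- exact: differentiable_cst.
- by apply: (smooth_differentiable (U := setT)) => //; apply: smooth_sum => [|k _];
    [exact: openT|apply: smoothZ; [exact: openT|exact: smooth_coord]].
rewrite partial_cst add0r partial_sum; last first.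
  by move=> k; apply: (smooth_differentiable (U := setT)) => //; apply: smoothZ;
    [exact: openT|exact: smooth_coord].
rewrite (bigD1 i)//= partialZ ?partial_coord ?eqxx ?mulr1 ?big1 ?addr0//.
  by move=> k /negbTE ki; rewrite partialZ ?partial_coord 1?eq_sym ?ki ?mulr0//;
    exact: differentiable_coord.
exact: differentiable_coord.
Qed.

Lemma differentiable_comp_aff f w A z : differentiable f (aff w A z) ->
  differentiable (fun y => f (aff w A y)) z.
Proof. by move=> df; apply: differentiable_comp_row => // j; exact: differentiable_aff. Qed.

Lemma partial_comp_aff f w A z i : differentiable f (aff w A z) ->
  partial i (fun y => f (aff w A y)) z = \sum_j partial j f (aff w A z) * A i j.
Proof.
move=> df; rewrite partial_comp//; last by move=> j; exact: differentiable_aff.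
by apply: eq_bigr => j _; rewrite partial_aff.
Qed.

Lemma partial_translate f w z i : differentiable f (aff w 1%:M z) ->
  partial i (fun y => f (aff w 1%:M y)) z = partial i f (aff w 1%:M z).
Proof.
move=> df; rewrite partial_comp_aff// (bigD1 i)//= mxE eqxx mulr1 big1 ?addr0//.
by move=> j /negbTE ji; rewrite mxE eq_sym ji mulr0.
Qed.

Lemma mean_value_delta f x (t : R) i :
  (forall s : R, 0 <= s <= 1 -> differentiable f (x + (s * t) *: delta_mx 0 i)) ->
  exists2 s : R, 0 <= s <= 1 &
    f (x + t *: delta_mx 0 i) - f x = t * partial i f (x + (s * t) *: delta_mx 0 i).
Proof.
move=> df; have [|s s01 ->] := @mean_value _ _ f x (t *: delta_mx 0 i).
  by move=> s s01; rewrite scalerA; exact: df.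
exists s => //; rewrite scalerA (bigD1 i)//= !mxE !eqxx mulr1 mulrC big1 ?addr0//.
by move=> j ji; rewrite !mxE (negbTE ji) !mulr0.
Qed.

(** The mean value theorem is applied in direction [i] to the increment of [f] in direction [j],
    then in direction [j]. The left side is symmetric in [i] and [j], so mixed partial derivatives
    agree at two nearby points, and [partialC] concludes by continuity. *)
Lemma second_difference f x (r t : R) i j : 0 < t -> 2 * t < r ->
  smooth_on (ball x r) f -> exists2 y, ball x r y &
    f (x + t *: delta_mx 0 i + t *: delta_mx 0 j) - f (x + t *: delta_mx 0 i)
    - f (x + t *: delta_mx 0 j) + f x = t * (t * partial j (partial i f) y).
Proof.
move=> t0 tr sf; pose w : 'rV[R]_n := t *: delta_mx 0 j.
have nd (a b : R) k l : 0 <= a <= 1 -> 0 <= b <= 1 ->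
    ball x r (x + (a * t) *: delta_mx 0 k + (b * t) *: delta_mx 0 l).
  move=> /andP[a0 a1] /andP[b0 b1]; rewrite -addrA; apply: ball_row_norm.
  have e1 (m : 'I_n) : `|delta_mx 0 m : 'rV[R]_n| <= 1.
    by apply: row_norm_ub => // k'; rewrite mxE; case: (_ && _); rewrite ?normr1 ?normr0.
  have at0 : 0 <= a * t by rewrite mulr_ge0// ltW.
  have bt0 : 0 <= b * t by rewrite mulr_ge0// ltW.
  rewrite (le_lt_trans (ler_normD _ _))//.
  have -> : `|(a * t) *: delta_mx 0 k : 'rV[R]_n| = a * t * `|delta_mx 0 k : 'rV[R]_n|.
    by rewrite normrZ ger0_norm.
  have -> : `|(b * t) *: delta_mx 0 l : 'rV[R]_n| = b * t * `|delta_mx 0 l : 'rV[R]_n|.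
    by rewrite normrZ ger0_norm.
  have h1 := ler_wpM2l at0 (e1 k); have h2 := ler_wpM2l bt0 (e1 l).
  have h3 : a * t <= t by rewrite ler_piMl// ltW.
  have h4 : b * t <= t by rewrite ler_piMl// ltW.
  by lra.
have I0 : 0 <= (0 : R) <= 1 by rewrite lexx ler01.
have I1 : 0 <= (1 : R) <= 1 by rewrite lexx ler01.
pose phi y := f (aff w 1%:M y) - f y.
have affw y : aff w 1%:M y = y + w by rewrite /aff mulmx1 addrC.
have df0 s : 0 <= s <= 1 -> differentiable f (x + (s * t) *: delta_mx 0 i).
  move=> s01; apply: (smooth_differentiable sf).
  by have := nd s 0 i i s01 I0; rewrite mul0r scale0r addr0.
have df1 s : 0 <= s <= 1 -> differentiable f (aff w 1%:M (x + (s * t) *: delta_mx 0 i)).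
  move=> s01; apply: (smooth_differentiable sf).
  by have := nd s 1 i j s01 I1; rewrite mul1r affw.
have [|s s01] := @mean_value_delta phi x t i.
  move=> s s01; apply: differentiableB; last exact: df0.
  by apply: differentiable_comp_aff; exact: df1.
have -> : partial i phi (x + (s * t) *: delta_mx 0 i) =
    partial i f (x + (s * t) *: delta_mx 0 i + w) -
    partial i f (x + (s * t) *: delta_mx 0 i).
  rewrite /phi (_ : (fun y => _) = fun y => f (aff w 1%:M y) + -1 * f y); last first.
    by apply/funext => y; rewrite mulN1r.
  rewrite partialD; last 2 first.
  - by apply: differentiable_comp_aff; exact: df1.
  - by apply: differentiableM; [exact: differentiable_cst|exact: df0].
  by rewrite (partial_translate i (df1 s s01)) (partialZ _ i (df0 s s01)) mulN1r affw.
have [|s' s'01] := @mean_value_delta (partial i f) (x + (s * t) *: delta_mx 0 i) t j.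
  by move=> s' s'01; apply: (smooth_differentiable (smooth_partial i sf)); exact: nd.
rewrite -/w => -> E; exists (x + (s * t) *: delta_mx 0 i + (s' * t) *: delta_mx 0 j).
  exact: nd.
by rewrite -E /phi !affw opprB addrA [RHS]addrAC.
Qed.

Lemma partialC U f i j x : open U -> smooth_on U f -> U x ->
  partial i (partial j f) x = partial j (partial i f) x.
Proof.
move=> oU sf Ux.
suff H k l e : 0 < e -> \forall y \near x, `|partial k (partial l f) x - partial k (partial l f) y| < e.
  apply/eqP; rewrite -subr_eq0 -normr_le0; apply/ler_addgt0Pr => e e0; rewrite add0r.
  have e20 : 0 < e / 2 by rewrite divr_gt0.
  have Ux' : \forall y \near x, U y by exact: open_nbhs_nbhs.
  have halves (a b c c' : R) : c = c' -> `|a - c| < e / 2 -> `|b - c'| < e / 2 ->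
      `|a - b| <= e.
    move=> <- h1 h2; rewrite (_ : a - b = (a - c) - (b - c)); last by ring.
    by rewrite (le_trans (ler_normB _ _))//; lra.
  have := @filterI _ _ (nbhs_filter x) _ _ Ux'
    (@filterI _ _ (nbhs_filter x) _ _ (H i j _ e20) (H j i _ e20)).
  move=> /nbhs_ballP[r /= r0 rP]; pose t := r / 3.
  have t0 : 0 < t by rewrite divr_gt0.
  have tr : 2 * t < r by rewrite /t; lra.
  have sr : smooth_on (ball x r) f by apply: smooth_sub sf => y /rP[].
  have [y yr Ey] := second_difference i j t0 tr sr.
  have [z zr Ez] := second_difference j i t0 tr sr.
  have E : partial j (partial i f) y = partial i (partial j f) z.
    have tn : t != 0 by rewrite gt_eqF.
    move: Ez; rewrite (addrAC x (t *: delta_mx 0 j)) [X in X + f x = _ -> _]addrAC.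
    by move=> /(etrans (esym Ey))/(mulfI tn)/(mulfI tn).
  have [_ [_ hy]] := rP y yr; have [_ [hz _]] := rP z zr.
  exact: (halves _ _ _ _ (esym E) hz hy).
move=> e0; have c : {for x, continuous (partial k (partial l f))}.
  apply: differentiable_continuous; apply: (smooth_differentiable (U := U)) => //.
  by do 2! apply: smooth_partial.
by have /cvgrPdist_lt/(_ _ e0) := c.
Qed.

End affine.

(** * Linearization of a vector field in a coordinate domain *)

Section local_linearization.
Context {R : realType} {n : nat}.
Implicit Types (x z v w : 'rV[R]_n) (f h : 'rV[R]_n -> R) (U W Y : set 'rV[R]_n).
Notation smth f := (smooth_on setT f).

Lemma open_preim_ball (F : 'rV[R]_n -> 'rV[R]_n) (d : R) :
  (forall x, {for x, continuous F}) -> open [set x | `|F x| < d].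
Proof.
move=> cF; rewrite (_ : [set x | _] = F @^-1` ball (0 : 'rV[R]_n) d).
  by apply: open_comp => [x _|]; [exact: cF|exact: ball_open].
by apply/seteqP; split=> x /ball0E.
Qed.

Lemma continuous_aff w A x : {for x, continuous (aff w A : 'rV[R]_n -> 'rV[R]_n)}.
Proof. by apply: continuous_row => j; apply: differentiable_continuous; exact: differentiable_aff. Qed.

Lemma jacobian_aff_rowf w (A : 'M[R]_n) (F : 'I_n -> 'rV[R]_n -> R) z :
  (forall i, smth (F i)) -> 'J (fun y => aff w A (rowf F y)) z = jac F z *m A.
Proof.
move=> sF; have dr j : differentiable (fun y => rowf F y 0 j) z.
  rewrite (_ : (fun y => _) = F j); first exact: smth_differentiable.
  by apply/funext => y; rewrite mxE.
have dc j : differentiable (fun y => aff w A (rowf F y) 0 j) z.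
  apply: (@differentiable_comp_row _ _ _ (fun y => aff w A y 0 j) (rowf F)) => //.
  exact: differentiable_aff.
apply/matrixP => i j; rewrite jacobianE; last exact: differentiable_row.
rewrite (@partial_comp _ _ _ (fun y => aff w A y 0 j) (rowf F))//; last exact: differentiable_aff.
rewrite mxE; apply: eq_bigr => l _; rewrite partial_aff mxE mulrC; congr (_ * _).
by congr (partial i _ z); apply/funext => y; rewrite mxE.
Qed.

(** In the affine coordinates given by [A] the field has diagonal linear part, because
    [A *m M *m invmx A] is diagonal. After a cutoff [normal_form] applies, and [inverse_function]
    inverts the conjugacy. *)
Lemma local_linearization W (V : 'rV[R]_n -> 'rV[R]_n) x0 (lam : 'I_n -> R)
    (A M : 'M[R]_n) : open W -> W x0 -> smooth_map_on W V -> V x0 = 0 ->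
  (forall i k, M i k = partial i (fun y => V y 0 k) x0) ->
  A \in unitmx -> A *m M = diag_mx (\row_i lam i) *m A -> N_linearity lam ->
  exists U Y : set 'rV[R]_n, exists S T : 'rV[R]_n -> 'rV[R]_n,
  [/\ [/\ open U, U 0 & S 0 = x0], open Y /\ Y `<=` W,
    (forall z, U z -> Y (S z) /\ T (S z) = z) /\
    (forall y, Y y -> U (T y) /\ S (T y) = y),
    smooth_map_on U S /\ smooth_map_on Y T &
    forall z, U z -> 'J S z \in unitmx /\
      V (S z) = (\row_i (lam i * z 0 i)) *m 'J S z].
Proof.
move=> oW Wx0 sV V0 EM Au AM nlin.
pose B := invmx A; pose a := aff x0 A.
have a0 : a 0 = x0 by rewrite /a /aff mul0mx addr0.
have [rho rho0 rW] : exists2 rho : R, 0 < rho & forall z, `|z| < rho -> W (a z).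
  have : \forall z \near (0 : 'rV[R]_n), W (a z).
    by apply: continuous_aff; rewrite -/a a0; exact: open_nbhs_nbhs.
  by move=> /nbhs_ballP[d d0 dd]; exists d => // z zd; apply: dd; apply/ball0E.
have [eta [K [seta /andP[K0 Kr] eta0 [e e0 eta1]]]] := ex_cutoff (n := n) rho0.
pose w i z := \sum_k B k i * V (a z) 0 k.
have sw i : smooth_on (ball (0 : 'rV[R]_n) rho) (w i).
  apply: smooth_sum => [|k _]; first exact: ball_open.
  apply: smoothZ; first exact: ball_open.
  apply: (smooth_comp (W := W) (h := fun y => V y 0 k) (F := a)) => //.
  - exact: ball_open.
  - by move=> z /ball0E; exact: rW.
  - by apply: smooth_aff; exact: ball_open.
pose w' i z := eta z * w i z.
have sw' i : smth (w' i).
  apply: (smooth_glue (ball_open _ _) (sw i) seta eta0) => x xK.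
  by apply/ball0E; exact: le_lt_trans Kr.
have ww' z i : `|z| < e -> w' i z = w i z by move=> ze; rewrite /w' eta1// mul1r.
have w'0 i : w' i 0 = 0.
  by rewrite ww' ?normr0// /w big1// => k _; rewrite a0 V0 mxE mulr0.
have dw' i j : partial j (w' i) 0 = lam i * (j == i)%:R.
  have -> : partial j (w' i) 0 = partial j (w i) 0.
    apply: near_eq_partial; have oe : open_nbhs (0 : 'rV[R]_n) (ball (0 : 'rV[R]_n) e).
      by split; [exact: ball_open|apply/ball0E; rewrite normr0].
    by apply: filterS (open_nbhs_nbhs oe) => z /ball0E; exact: ww'.
  have dV k : differentiable (fun y => V y 0 k) (a 0).
    by rewrite a0; exact: (smooth_differentiable (sV k)).
  have dVa k : differentiable (fun z => V (a z) 0 k) 0.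
    exact: (differentiable_comp_aff (dV k)).
  rewrite /w partial_sum; last first.
    by move=> k; apply: differentiableM; [exact: differentiable_cst|exact: dVa].
  have : (A *m M *m B) j i = lam i * (j == i)%:R.
    rewrite AM mulmxK// !mxE; case: eqVneq => [->|]; first by rewrite mulr1 mulr1n.
    by rewrite mulr0 mulr0n.
  move=> <-; rewrite mxE; apply: eq_bigr => k _; rewrite partialZ// mulrC.
  congr (_ * _); rewrite (partial_comp_aff _ (dV k)) mxE -/a a0.
  by apply: eq_bigr => l _; rewrite EM mulrC.
have [F [tF [e1 e10 eF]]] := normal_form sw' w'0 dw' nlin.
have [sF F0 dF] := tF.
have [r [d [G [d0 /andP[r0 re1] GF FG [sG jF]]]]] := inverse_function tF e10.
(* Within [d'] three things hold at once: the local inverse [G] exists, the cutoff is 1, and [a]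
   stays in [W]. *)
pose d' := Num.min d (Num.min e rho).
have d'0 : 0 < d' by rewrite !lt_min d0 e0 rho0.
have d'P (t : R) : t < d' -> [/\ t < d, t < e & t < rho].
  by rewrite !lt_min => /and3P.
pose U := [set z : 'rV[R]_n | `|z| < r] `&` [set z | `|rowf F z| < d'].
pose b y := aff (- (x0 *m B)) B y.
have bE y : b y = (y - x0) *m B by rewrite /b /aff mulmxBl addrC.
have ab y : a (b y) = y by rewrite /a /aff bE mulmxKV// subrKC.
have ba z : b (a z) = z by rewrite bE /a /aff addrAC subrr add0r mulmxK.
pose Y := [set y : 'rV[R]_n | `|b y| < d'].
have cont_id x : {for x, continuous (fun z : 'rV[R]_n => z)} by exact: cvg_id.
have oU : open U.
  by apply: openI; apply: open_preim_ball => // x; exact: smth_continuous_rowf.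
have oY : open Y by apply: open_preim_ball => x; exact: continuous_aff.
exists U, Y, (fun z => a (rowf F z)), (fun y => G (b y)); split.
- split=> //; first by split; rewrite /= ?(rowf0 F0) normr0.
  by rewrite (rowf0 F0) a0.
- by split=> // y /d'P[_ _ /rW]; rewrite ab.
- split=> [z [zr /= zd]|y /= yd].
    by have [zd1 _ _] := d'P _ zd; rewrite /Y /= ba; split=> //; exact: GF.
  have [/FG[Gr GE] _ _] := d'P _ yd.
  by split; [split=> //=; rewrite GE|rewrite GE ab].
- split.
    move=> j; apply: (smooth_comp (W := setT) (h := fun y => a y 0 j) (F := rowf F)) => //.
      move=> i; apply: (smooth_ext oU _ (smooth_sub (@subsetT _ _) (sF i))) => x _.
      by rewrite mxE.
    by apply: smooth_aff; exact: openT.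
  move=> j; apply: (smooth_comp (W := ball (0 : 'rV[R]_n) d) (h := fun y => G y 0 j) (F := b)) => //.
  - by move=> y /d'P[yd _ _]; apply/ball0E.
  - by apply: smooth_aff.
move=> z [/= zr zd]; have [_ ze _] := d'P _ zd.
rewrite jacobian_aff_rowf//; split.
  by rewrite unitmx_mul Au unitmxE unitfE jF.
have -> : (\row_i (lam i * z 0 i)) *m (jac F z *m A) = rowf w' (rowf F z) *m A.
  rewrite mulmxA; congr (_ *m A); apply/rowP => i; rewrite !mxE.
  rewrite -eF ?(lt_le_trans zr)//; apply: eq_bigr => j _; rewrite !mxE//.
have -> : rowf w' (rowf F z) = V (a (rowf F z)) *m B.
  by apply/rowP => i; rewrite !mxE ww'//; apply: eq_bigr => k _; rewrite mulrC.
by rewrite mulmxKV.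
Qed.

End local_linearization.

Lemma symE (R : Type) n (A : 'M[R]_n) i j : A^T = A -> A i j = A j i.
Proof. by move=> sA; rewrite -[in LHS]sA mxE. Qed.

Lemma mulmx2K (R : comUnitRingType) m n (v : 'M[R]_(m, n)) (A B : 'M[R]_n) :
  A \in unitmx -> B \in unitmx -> v *m A *m B *m invmx (A *m B) = v.
Proof. by move=> Au Bu; rewrite -(mulmxA v) mulmxK// unitmx_mul Au. Qed.

Lemma jacobian_comp (R : realType) n m k (F : 'rV[R]_n -> 'rV[R]_m)
    (H : 'rV[R]_m -> 'rV[R]_k) x :
  (forall j, differentiable (fun y => F y 0 j) x) ->
  (forall j, differentiable (fun y => H y 0 j) (F x)) ->
  'J (H \o F) x = 'J F x *m 'J H (F x).
Proof.
move=> dF dH; have dFr := differentiable_row dF; have dHr := differentiable_row dH.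
have dC j : differentiable (fun y => (H \o F) y 0 j) x.
  exact: (@differentiable_comp_row _ _ _ (fun y => H y 0 j) F).
apply/matrixP => i j; rewrite (jacobianE i j (differentiable_row dC)) mxE.
rewrite (@partial_comp _ _ _ (fun y => H y 0 j) F x i dF (dH j)).
by apply: eq_bigr => l _; rewrite (jacobianE i l dFr) (jacobianE l j dHr) mulrC.
Qed.

(** * The gradient field on the manifold *)

Section charts.
Context {R : realType} {n : nat}.

Lemma open_param_preim (X : topologicalType) (c : chart R X n) (B : set X) :
  open B -> open (target c `&` param c @^-1` B).
Proof.
move=> oB; rewrite openE => x [tx Bx]; apply: filterI.
  by apply: open_nbhs_nbhs; split=> //; exact: open_target.
by apply: (param_continuous tx); exact: open_nbhs_nbhs.
Qed.

Lemma open_coord_preim (X : topologicalType) (c : chart R X n) (Y : set 'rV[R]_n) :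
  open Y -> open (source c `&` coord c @^-1` Y).
Proof.
move=> oY; rewrite openE => q [sq Yq]; apply: filterI.
  by apply: open_nbhs_nbhs; split=> //; exact: open_source.
by apply: (coord_continuous sq); exact: open_nbhs_nbhs.
Qed.

Lemma smooth_map_continuous m (U : set 'rV[R]_n) (F : 'rV[R]_n -> 'rV[R]_m) x :
  smooth_map_on U F -> U x -> {for x, continuous F}.
Proof. by move=> sF Ux; apply: continuous_row => j; exact: (sF j 0%N). Qed.

Lemma reparametrize (X : topologicalType) (c : chart R X n) (U Y : set 'rV[R]_n)
    (S T : 'rV[R]_n -> 'rV[R]_n) :
  open U -> open Y -> Y `<=` target c ->
  (forall z, U z -> Y (S z) /\ T (S z) = z) ->
  (forall y, Y y -> U (T y) /\ S (T y) = y) ->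
  smooth_map_on U S -> smooth_map_on Y T ->
  exists Phi : chart R X n,
    [/\ source Phi = source c `&` coord c @^-1` Y, target Phi = U,
        coord Phi = T \o coord c & param Phi = param c \o S].
Proof.
move=> oU oY Yc US YT sS sT.
have h1 : open (source c `&` coord c @^-1` Y) by exact: open_coord_preim.
have h3 q : (source c `&` coord c @^-1` Y) q -> U ((T \o coord c) q).
  by move=> [_ /YT[]].
have h4 x : U x -> (source c `&` coord c @^-1` Y) ((param c \o S) x).
  move=> /US[/= YS _]; split=> /=; first exact/param_source/Yc.
  by rewrite paramK//; exact: Yc.
have h5 q : (source c `&` coord c @^-1` Y) q -> (param c \o S) ((T \o coord c) q) = q.
  by move=> [sq /YT[_ /= ->]]; exact: coordK.
have h6 x : U x -> (T \o coord c) ((param c \o S) x) = x.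
  by move=> /US[/= YS TS]; rewrite paramK//; exact: Yc.
have h7 q : (source c `&` coord c @^-1` Y) q -> {for q, continuous (T \o coord c)}.
  move=> [sq Yq]; apply: continuous_comp; first exact: coord_continuous.
  exact: smooth_map_continuous Yq.
have h8 x : U x -> {for x, continuous (param c \o S)}.
  move=> Ux; apply: continuous_comp; first exact: smooth_map_continuous Ux.
  by apply: param_continuous; apply: Yc; have [] := US x Ux.
by exists (Chart h1 oU h3 h4 h5 h6 h7 h8).
Qed.

(** Both transition maps factor through [c], whose transitions to the atlas are smooth, followed by
    [T] or preceded by [S]. *)
Lemma smooth_chart_reparametrize (X : smooth_manifold R n) (c Phi : chart R X n)
    (Y : set 'rV[R]_n) (S T : 'rV[R]_n -> 'rV[R]_n) : atlas c ->
  Y `<=` target c -> (forall z, target Phi z -> Y (S z)) ->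
  smooth_map_on (target Phi) S -> smooth_map_on Y T ->
  source Phi = source c `&` coord c @^-1` Y ->
  coord Phi = T \o coord c -> param Phi = param c \o S -> smooth_chart Phi.
Proof.
move=> ac Yc US sS sT sE cE pE d ad; have [s1 s2] := atlas_compatible ad ac.
have [s3 _] := atlas_compatible ac ad.
split=> j.
- have oO : open (overlap d Phi) by apply: open_param_preim; exact: open_source.
  have sub : overlap d Phi `<=` overlap d c.
    by move=> x [tx]; rewrite /= sE => -[].
  apply: (smooth_ext oO _ (smooth_comp (W := Y) (h := fun y => T y 0 j)
    (F := transition d c) oO _ _ (sT j))).
  + by move=> x _; rewrite /transition cE.
  + by move=> x [tx]; rewrite /= sE => -[].
  + by move=> i; exact: (smooth_sub sub (s1 i)).
- have oO : open (overlap Phi d) by apply: open_param_preim; exact: open_source.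
  have oO' : smooth_map_on (overlap Phi d) S.
    by move=> i; apply: smooth_sub (sS i) => x [].
  apply: (smooth_ext oO _ (smooth_comp (W := overlap c d)
    (h := fun y => transition c d y 0 j) (F := S) oO _ oO' (s3 j))).
  + by move=> x _; rewrite /transition pE.
  + by move=> x [tx]; rewrite /= pE => sx; split=> //; apply: Yc; exact: US.
Qed.

End charts.

Section gradient_field.
Context {R : realType} {n : nat}.
Variables (X : smooth_manifold R n) (g : riemannian_metric X) (f : X -> R).
Hypothesis sf : smooth_fun f.
Implicit Types (c d : chart R X n) (x : 'rV[R]_n).

Lemma metric_posdef c x : atlas c -> target c x -> posdef (metric g c x).
Proof. by move=> ac tx; split; [exact: metric_sym|exact: metric_pos]. Qed.

Lemma metric_unit c x : atlas c -> target c x -> metric g c x \in unitmx.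
Proof. by move=> ac tx; apply: posdef_unit; exact: metric_posdef. Qed.

Lemma inv_metric_sym c x : atlas c -> target c x -> (inv_metric g c x)^T = inv_metric g c x.
Proof. by move=> ac tx; rewrite /inv_metric trmx_inv metric_sym. Qed.

Lemma smooth_inv_metric c k l : atlas c ->
  smooth_on (target c) (fun x => inv_metric g c x k l).
Proof.
move=> ac; apply: smooth_invmx => [|i j|x tx]; first exact: open_target.
  exact: metric_smooth.
by rewrite -unitfE -unitmxE; exact: metric_unit.
Qed.

Lemma smooth_differential c k : atlas c ->
  smooth_on (target c) (fun x => differential f c x 0 k).
Proof.
move=> ac; apply: (smooth_ext (@open_target _ _ _ c) _ (smooth_partial k (sf ac))) => x _.
by rewrite mxE.
Qed.

Lemma smooth_gradient c : atlas c -> smooth_map_on (target c) (gradient g f c).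
Proof.
move=> ac k; have oc := @open_target _ _ _ c.
apply: (smooth_ext oc (f := fun x => \sum_l inv_metric g c x k l * differential f c x 0 l)).
  by move=> x _; rewrite mxE.
apply: smooth_sum => // l _; apply: smoothM => //; first exact: smooth_inv_metric.
exact: smooth_differential.
Qed.

Lemma gradientE c x : atlas c -> target c x ->
  gradient g f c x = differential f c x *m inv_metric g c x.
Proof.
move=> ac tx; apply/rowP => k; rewrite !mxE; apply: eq_bigr => l _.
by rewrite mulrC (symE _ _ (inv_metric_sym ac tx)).
Qed.

Lemma gradient_metric c x : atlas c -> target c x ->
  gradient g f c x *m metric g c x = differential f c x.
Proof. by move=> ac tx; rewrite gradientE// mulmxKV// metric_unit. Qed.

Lemma lower_gradient c x j : atlas c -> target c x ->
  lower_index g (gradient g f) c j x = differential f c x 0 j.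
Proof.
move=> ac tx; rewrite -(gradient_metric ac tx) mxE; apply: eq_bigr => k _.
by rewrite mulrC (symE _ _ (metric_sym g ac tx)).
Qed.

Lemma near_target c x : target c x -> \forall y \near x, target c y.
Proof. by move=> tx; apply: open_nbhs_nbhs; split=> //; exact: open_target. Qed.

(** Lowering the index of the gradient gives back the differential of [f], which is zero at the
    point, so the Christoffel terms drop out. *)
Lemma morse_endomorphismE c x : atlas c -> target c x -> differential f c x = 0 ->
  morse_endomorphism g f c x = hessian f c x *m inv_metric g c x.
Proof.
move=> ac tx d0; apply/matrixP => i k; rewrite !mxE; apply: eq_bigr => j _.
rewrite mulrC; congr (_ * _); rewrite mxE /covariant_derivative.
rewrite [X in _ - X]big1 ?subr0; last first.
  by move=> l _; rewrite lower_gradient// d0 mxE mulr0.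
apply: near_eq_partial; apply: filterS (near_target tx) => y ty.
by rewrite lower_gradient// mxE.
Qed.

Lemma hessian_sym c x : atlas c -> target c x -> (hessian f c x)^T = hessian f c x.
Proof.
move=> ac tx; apply/matrixP => i j; rewrite !mxE.
exact: (partialC j i (@open_target _ _ _ c) (sf ac) tx).
Qed.

(** In the product rule the derivatives of the inverse metric are multiplied by the differential of
    [f], zero at the point. This identifies the Morse endomorphism with the Jacobian to be
    diagonalized. *)
Lemma partial_gradient c x i k : atlas c -> target c x -> differential f c x = 0 ->
  partial i (fun y => gradient g f c y 0 k) x = morse_endomorphism g f c x i k.
Proof.
move=> ac tx d0; rewrite morse_endomorphismE// mxE.
have dB l : differentiable (fun y => inv_metric g c y k l) x.
  exact: (smooth_differentiable (smooth_inv_metric k l ac)).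
have dd l : differentiable (fun y => differential f c y 0 l) x.
  exact: (smooth_differentiable (smooth_differential l ac)).
rewrite (_ : (fun y => _) = fun y => \sum_l inv_metric g c y k l * differential f c y 0 l);
  last by apply/funext => y; rewrite mxE.
rewrite partial_sum; last by move=> l; exact: differentiableM.
apply: eq_bigr => l _; rewrite partialM// d0 mxE mulr0 add0r mulrC; congr (_ * _).
  by rewrite mxE; congr (partial i _ x); apply/funext => y; rewrite mxE.
by rewrite (symE _ _ (inv_metric_sym ac tx)).
Qed.

Lemma morse_selfadjoint c x : atlas c -> target c x -> differential f c x = 0 ->
  selfadjoint (metric g c x) (morse_endomorphism g f c x).
Proof.
move=> ac tx d0; have gu := metric_unit ac tx.
rewrite /selfadjoint morse_endomorphismE// mulmxKV// trmx_mul hessian_sym//.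
by rewrite inv_metric_sym// mulKVmx.
Qed.

Lemma transition_differentiable c d x j : atlas c -> atlas d -> overlap c d x ->
  differentiable (fun y => transition c d y 0 j) x.
Proof. by move=> ac ad ox; have [s _] := atlas_compatible ac ad; exact: (smooth_differentiable (s j)). Qed.

Lemma overlap_target c d x : overlap c d x -> target d (transition c d x).
Proof. by move=> [_ sx]; exact: coord_target. Qed.

Lemma differential_change c d x : atlas c -> atlas d -> overlap c d x ->
  differential f c x = differential f d (transition c d x) *m ('J (transition c d) x)^T.
Proof.
move=> ac ad ox; have td := overlap_target ox.
have dt j := transition_differentiable j ac ad ox.
have dJ : differentiable (transition c d) x by exact: differentiable_row.
apply/rowP => i; rewrite !mxE.
rewrite (@near_eq_partial _ _ _ (fun y => local_expr f d (transition c d y))).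
  rewrite partial_comp//; last exact: (smooth_differentiable (sf ad)).
  by apply: eq_bigr => j _; rewrite !mxE -jacobianE// mxE.
have oo : open_nbhs x (overlap c d).
  by split=> //; apply: open_param_preim; exact: open_source.
apply: filterS (open_nbhs_nbhs oo) => y [ty sy].
by rewrite /local_expr /transition /= coordK.
Qed.

(** Read off from [metric_change]: the Jacobian is a factor of the invertible matrix of the
    metric. *)
Lemma transition_unit c d x : atlas c -> atlas d -> overlap c d x ->
  'J (transition c d) x \in unitmx.
Proof.
move=> ac ad ox; have [tx _] := ox.
by have := metric_unit ac tx; rewrite (metric_change g ac ad ox) !unitmx_mul => /andP[/andP[]].
Qed.

Lemma gradient_change c d x : atlas c -> atlas d -> overlap c d x ->
  gradient g f d (transition c d x) = gradient g f c x *m 'J (transition c d) x.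
Proof.
move=> ac ad ox; have [tx _] := ox; have td := overlap_target ox.
have Ju := transition_unit ac ad ox; set J := 'J _ x in Ju *.
have JTu : J^T \in unitmx by rewrite unitmx_tr.
have gu := metric_unit ad td.
have E : gradient g f c x *m J *m metric g d (transition c d x) =
    differential f d (transition c d x).
  rewrite -[LHS](mulmxK JTu) -[RHS](mulmxK JTu); congr (_ *m _).
  rewrite -differential_change// -gradient_metric// (metric_change g ac ad ox) -/J.
  by rewrite !mulmxA.
by rewrite gradientE// -E mulmxK.
Qed.

End gradient_field.

Theorem theorem1p2 (R : realType) (n : nat) (X : smooth_manifold R n)
    (g : riemannian_metric X) (f : X -> R) (p : X) (lambda : 'I_n -> R)
    (f_morse : morse_function f)
    (p_critical : critical_point f p)
    (lambda_eigen : morse_eigenvalues g f p lambda)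
    (lambda_Nlin : N_linearity lambda) :
  exists (Utilde : set X) (U : set 'rV[R]_n) (Phi : chart R X n),
    [/\ open Utilde /\ Utilde p,
        open U /\ U 0,
        source Phi = Utilde /\ target Phi = U,
        smooth_chart Phi /\ param Phi 0 = p
      & forall x : 'rV[R]_n, U x ->
        forall c : chart R X n, atlas c -> source c (param Phi x) ->
          pullback (param Phi) (gradient g f) c x =
          \row_(i < n) (lambda i * x 0 i)].
Proof.
have [sf _] := f_morse.
have [c0 ac0 sp] := atlas_cover p.
pose x0 := coord c0 p; have tx0 : target c0 x0 := coord_target sp.
have d0 : differential f c0 x0 = 0 := p_critical c0 ac0 sp.
have V0 : gradient g f c0 x0 = 0 by rewrite gradientE// d0 mul0mx.
have [A Au AM] := spectral_diag (metric_posdef g ac0 tx0)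
  (morse_selfadjoint g sf ac0 tx0 d0) (lambda_eigen c0 ac0 sp).
have [U [Y [S [T [[oU U0 S0] [oY Yc] [US YT] [sS sT] eS]]]]] :=
  local_linearization (@open_target _ _ _ c0) tx0 (smooth_gradient g sf ac0) V0
    (fun i k => esym (partial_gradient g sf i k ac0 tx0 d0)) Au AM lambda_Nlin.
have [Phi [sE tE cE pE]] := reparametrize oU oY Yc US YT sS sT.
exists (source Phi), U, Phi; split=> //.
- split; first exact: open_source.
  by rewrite sE; split=> //=; have [YS _] := US 0 U0; rewrite -/x0 -S0.
- split; last by rewrite pE /= S0 /x0 coordK.
  apply: (smooth_chart_reparametrize ac0 Yc _ _ sT sE cE pE); rewrite tE//.
  by move=> z /US[].
(* The chart [c] is arbitrary. Passing from [c0] to [c] multiplies both the gradient and the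
   Jacobian of the parametrization on the right by the Jacobian of the transition, which cancels in
   the pullback. *)
move=> z Uz c ac; rewrite pE /= => sc.
have [YS _] := US z Uz; have tS := Yc _ YS.
have oS : overlap c0 c (S z) by [].
have [JSu VS] := eS z Uz.
have Ju := transition_unit g ac0 ac oS.
have dS j : differentiable (fun y => S y 0 j) z by exact: (smooth_differentiable (sS j)).
have dt j := transition_differentiable j ac0 ac oS.
have JE : 'J (coord c \o (param c0 \o S)) z = 'J S z *m 'J (transition c0 c) (S z).
  exact: (@jacobian_comp _ _ _ _ S (transition c0 c) z dS dt).
rewrite /pullback JE.
rewrite [coord c _](_ : _ = transition c0 c (S z))// (gradient_change g sf ac0 ac oS) VS.
exact: (mulmx2K _ JSu Ju).
Qed.
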